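(* Let $M$ and $N$ be smooth closed manifolds and let $C^\infty(N\times M,\mathbb R)$ be endowed with the $C^2$-topology. If $F\in C^\infty(N\times M,\mathbb R)$, then for any open neighborhood $U\subseteq C^\infty(N\times M,\mathbb R)$ of $F$ there exist $\tilde F\in U$ and an open dense subset $N_0\subseteq N$ such that the complement $N_0^c$ of $N_0$ is of measure zero and, for every $s\in N_0$, $\tilde F_s$ is a Morse function on $M$.
   Context: All manifolds are smooth and connected; closed means compact without boundary. $\tilde F_s$ denotes the restriction $\tilde F|_{\{s\}\times M}$, viewed as a function on $M$. A Morse function is a smooth function all of whose critical points are non-degenerate. Measure zero means zero Riemannian measure for any (equivalently every) Riemannian metric. The $C^2$-topology on smooth functions on a compact manifold $X$ is the one induced by the norm $\|f\|_{C^2}=\sum_{i=0}^2\sup_X|\nabla^i f|$ for any chosen Riemannian metric. *)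

(* Defs.v *)
From HB Require Import structures.
From mathcomp Require Import all_boot all_order all_algebra.
From mathcomp Require Import all_classical all_reals all_analysis.

Set Implicit Arguments.
Unset Strict Implicit.
Unset Printing Implicit Defensive.

Import Order.TTheory GRing.Theory Num.Theory.
Import numFieldNormedType.Exports.

Local Open Scope classical_set_scope.
Local Open Scope ring_scope.

Section smooth_maps.
Context {R : realType}.

Definition ebase n (i : 'I_n) : 'rV[R]_n := delta_mx 0 i.

Section Ck.
Context {n : nat} {W : normedModType R}.

(* The partial derivatives are taken in all of 'rV_n, so [Ck] and [smooth] are
   meaningful for open sets U only. *)
Fixpoint Ck (k : nat) (f : 'rV[R]_n -> W) (U : set 'rV[R]_n) : Prop :=
  {in U, continuous f} /\
  (if k is k'.+1 then forall i : 'I_n,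
     (forall x, U x -> derivable f x (ebase i)) /\ Ck k' ('D_(ebase i) f) U
   else True).

Definition smooth (f : 'rV[R]_n -> W) (U : set 'rV[R]_n) : Prop :=
  forall k, Ck k f U.

End Ck.

Lemma Ck_continuous n (W : normedModType R) k (f : 'rV[R]_n -> W) U :
  Ck k f U -> {in U, continuous f}.
Proof. by case: k => [|k] []. Qed.

Lemma Ck_eq n (W : normedModType R) k (f g : 'rV[R]_n -> W) U : open U ->
  (forall x, U x -> f x = g x) -> Ck k f U -> Ck k g U.
Proof.
move=> oU; elim: k f g => [|k IH] f g fg.
all: have nfg x : U x -> \forall y \near x, f y = g y.
1,3: by move=> Ux; apply: (@filterS _ (nbhs x) _ U) => //; exact: open_nbhs_nbhs.
all: have gc : {in U, continuous f} -> {in U, continuous g}.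
1,3: by move=> cf x xU; have Ux : U x := set_mem xU;
  rewrite /continuous_at -(fg _ Ux); apply: cvg_trans (cf x xU);
  exact: near_eq_cvg (nfg _ Ux).
  by case=> /gc.
move=> [/gc cg df]; split=> // i; have [dfi Cfi] := df i; split=> [x Ux|].
  by apply: near_eq_derivable (dfi x Ux); exact: nfg.
by apply: IH Cfi => x Ux; apply: near_eq_derive; exact: nfg.
Qed.

Lemma Ck_cst n (W : normedModType R) k (w : W) (U : set 'rV[R]_n) :
  Ck k (fun=> w) U.
Proof.
elim: k w => [|k IH] w; split=> //. 1,2: by move=> x _; apply: (@cst_continuous _ _ w).
move=> i; split=> [x _|]; first exact/diff_derivable.
rewrite (_ : 'D__ _ = fun=> 0) //.
by apply/funext => x; exact: derive_cst.
Qed.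

Lemma row_mx_cvg (T : Type) (F : set_system T) {FF : Filter F} n m
    (f : T -> 'rV[R]_n) (g : T -> 'rV[R]_m) (a : 'rV[R]_n) (b : 'rV[R]_m) :
  f @ F --> a -> g @ F --> b ->
  (fun x => row_mx (f x) (g x)) @ F --> row_mx a b.
Proof.
move=> fa gb A [P nP PA].
have fP : \forall x \near F, forall i j, P i (lshift m j) (f x i j).
  apply: (fa [set v | forall i j, P i (lshift m j) (v i j)]).
  exists (fun i j => P i (lshift m j)) => // i j.
  by have := nP i (lshift m j); rewrite row_mxEl.
have gP : \forall x \near F, forall i j, P i (rshift n j) (g x i j).
  apply: (gb [set v | forall i j, P i (rshift n j) (v i j)]).
  exists (fun i j => P i (rshift n j)) => // i j.
  by have := nP i (rshift n j); rewrite row_mxEr.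
apply: filterS2 fP gP => x fx gx; apply: PA => i j.
by rewrite -(splitK j); case: (fintype.split j) => j' /=; rewrite ?row_mxEl ?row_mxEr.
Qed.

Lemma lsubmx_continuous n m : continuous (@lsubmx R 1 n m).
Proof.
move=> x A [P nP PA]; exists (fun i j => if fintype.split j is inl j' then P i j' else setT).
  move=> i j; case: splitP => j' ej; last exact: filterT.
  have -> : j = lshift m j' by exact: val_inj.
  by have := nP i j'; rewrite mxE.
move=> y yP; apply: PA => i j; have := yP i (lshift m j).
rewrite mxE; case: splitP => j' /= e; first by have -> : j = j' by exact: val_inj.
by have := ltn_ord j; rewrite e ltnNge leq_addr.
Qed.

Lemma rsubmx_continuous n m : continuous (@rsubmx R 1 n m).
Proof.
move=> x A [P nP PA]; exists (fun i j => if fintype.split j is inr j' then P i j' else setT).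
  move=> i j; case: splitP => j' ej; first exact: filterT.
  have -> : j = rshift n j' by exact: val_inj.
  by have := nP i j'; rewrite mxE.
move=> y yP; apply: PA => i j; have := yP i (rshift n j).
rewrite mxE; case: splitP => j' /= e; last first.
  by have -> : j = j' by apply/val_inj/(@addnI n).
by have := ltn_ord j'; rewrite -e ltnNge leq_addr.
Qed.

Lemma open_lsubmx n m (A : set 'rV[R]_n) :
  open A -> open (@lsubmx R 1 n m @^-1` A).
Proof. by apply: open_comp => x _; exact: lsubmx_continuous. Qed.

Lemma open_rsubmx n m (A : set 'rV[R]_m) :
  open A -> open (@rsubmx R 1 n m @^-1` A).
Proof. by apply: open_comp => x _; exact: rsubmx_continuous. Qed.

Lemma Ck_row_mx n p q k (f : 'rV[R]_n -> 'rV[R]_p) (g : 'rV[R]_n -> 'rV[R]_q) U :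
  open U -> Ck k f U -> Ck k g U -> Ck k (fun x => row_mx (f x) (g x)) U.
Proof.
move=> oU; elim: k f g => [|k IH] f g [cf df] [cg dg].
  by split=> // x xU; apply: (@row_mx_cvg _ (nbhs x)); [exact: cf|exact: cg].
split; first by move=> x xU; apply: (@row_mx_cvg _ (nbhs x)); [exact: cf|exact: cg].
move=> i; have [dfi Cfi] := df i; have [dgi Cgi] := dg i.
have H x : U x ->
    (fun h => h^-1 *: (((fun x => row_mx (f x) (g x)) \o shift x) (h *: ebase i)
       - row_mx (f x) (g x))) @ 0^' --> row_mx ('D_(ebase i) f x) ('D_(ebase i) g x).
  move=> Ux; under eq_fun do rewrite /= opp_row_mx add_row_mx scale_row_mx.
  by apply: row_mx_cvg; [exact: dfi | exact: dgi].
split=> [x Ux|]; first by apply/cvg_ex; eexists; exact: H.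
apply: Ck_eq oU _ (IH _ _ Cfi Cgi) => x Ux.
by apply/esym/cvg_lim; [exact: norm_hausdorff | exact: H].
Qed.

Lemma Ck_precomp n m k (W : normedModType R) (l : {linear 'rV[R]_n -> 'rV[R]_m})
    (f : 'rV[R]_m -> W) U : continuous l ->
  (forall i, (exists j, l (ebase i) = ebase j) \/ l (ebase i) = 0) ->
  Ck k f U -> Ck k (f \o l) (l @^-1` U).
Proof.
move=> cl le; elim: k f => [|k IH] f [cf df].
all: have cfl : {in l @^-1` U, continuous (f \o l)}.
1,3: by move=> x; rewrite inE => xU; apply: continuous_comp;
  [exact: cl|apply: cf; rewrite inE].
  by split.
split=> // i.
have E x : (fun h => h^-1 *: (((f \o l) \o shift x) (h *: ebase i) - (f \o l) x))
   = (fun h => h^-1 *: ((f \o shift (l x)) (h *: l (ebase i)) - f (l x))).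
  by apply/funext => h /=; congr (_ *: (f _ - _)); rewrite linearD; congr (_ + _);
    exact: linearZ.
have [[j lij]|li0] := le i; last first.
  have E0 x : (fun h => h^-1 *: (((f \o l) \o shift x) (h *: ebase i) - (f \o l) x))
     = cst 0.
    by rewrite E li0; apply/funext => h /=; rewrite scaler0 add0r subrr scaler0.
  split=> [x Ux|]; first by rewrite /derivable E0; exact: is_cvg_cst.
  rewrite (_ : 'D__ _ = fun=> 0); first exact: Ck_cst.
  apply/funext => x; rewrite /derive E0; apply: cvg_lim; last exact: cvg_cst.
  exact: norm_hausdorff.
have [dfj Cfj] := df j; split=> [x Ux|]; first by rewrite /derivable E lij; exact: dfj.
rewrite (_ : 'D__ _ = 'D_(ebase j) f \o l); first exact: IH.
by apply/funext => x; rewrite /derive E lij.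
Qed.

Lemma lsubmx_ebase n m (i : 'I_(n + m)) :
  (exists j, lsubmx (ebase i) = ebase j) \/ lsubmx (ebase i) = 0 :> 'rV[R]_n.
Proof.
rewrite /ebase -(splitK i); case: (fintype.split i) => j /=; [left; exists j|right];
  apply/rowP => a; rewrite !mxE ?eqxx //=.
by rewrite eq_lrshift.
Qed.

Lemma rsubmx_ebase n m (i : 'I_(n + m)) :
  (exists j, rsubmx (ebase i) = ebase j) \/ rsubmx (ebase i) = 0 :> 'rV[R]_m.
Proof.
rewrite /ebase -(splitK i); case: (fintype.split i) => j /=; [right|left; exists j];
  apply/rowP => a; rewrite !mxE ?eqxx //=.
  by rewrite eq_rlshift.
by rewrite (inj_eq (@rshift_inj _ _)).
Qed.

End smooth_maps.

Lemma connected_setXT (T U : topologicalType) :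
  connected [set: T] -> connected [set: U] -> connected [set: T * U].
Proof.
move=> cT cU; have [[[t0 u0] _]|/nonemptyPn ->] := pselect ([set: T * U] !=set0);
  last exact: connected0.
have cl t : connected [set x : T * U | x.1 = t].
  rewrite (_ : [set _ | _] = (fun u => (t, u)) @` [set: U]).
    apply: connected_continuous_connected => //; apply: continuous_subspaceT => u.
    by apply: cvg_pair; [exact: cvg_cst|exact: cvg_id].
  by apply/seteqP; split=> [[a b] /= ->|_ [b _ <-]//]; exists b.
have cr : connected [set x : T * U | x.2 = u0].
  rewrite (_ : [set _ | _] = (fun t => (t, u0)) @` [set: T]).
    apply: connected_continuous_connected => //; apply: continuous_subspaceT => t.
    by apply: cvg_pair; [exact: cvg_id|exact: cvg_cst].
  by apply/seteqP; split=> [[a b] /= ->|_ [b _ <-]//]; exists a.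
rewrite (_ : [set: T * U] =
    \bigcup_(t in setT) ([set x : T * U | x.1 = t] `|` [set x | x.2 = u0])).
  apply: bigcup_connected; first by exists (t0, u0) => t _; right.
  by move=> t _; apply: connectedU => //; exists (t, u0).
by apply/seteqP; split=> // -[t u] _; exists t => //; left.
Qed.

Lemma hausdorff_prod (T U : topologicalType) :
  hausdorff_space T -> hausdorff_space U -> hausdorff_space (T * U)%type.
Proof.
move=> hT hU [a b] [c d] cl; congr (_, _); [apply: hT|apply: hU] => A B nA nB.
  have [||[x y] [/= ? ?]] := cl (fst @^-1` A) (fst @^-1` B); last by exists x.
  - by exists (A, setT) => [|[? ?] []//]; split=> //; exact: filterT.
  - by exists (B, setT) => [|[? ?] []//]; split=> //; exact: filterT.
have [||[x y] [/= ? ?]] := cl (snd @^-1` A) (snd @^-1` B); last by exists y.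
- by exists (setT, A) => [|[? ?] []//]; split=> //; exact: filterT.
- by exists (setT, B) => [|[? ?] []//]; split=> //; exact: filterT.
Qed.

Section manifolds.
Context {R : realType}.

(* A homeomorphism [phi] of the open set [dom] onto the open set [cod] with
   inverse [psi]; the values of phi and psi elsewhere are irrelevant. *)
Record chart (n : nat) (M : topologicalType) := Chart {
  dom : set M;
  cod : set 'rV[R]_n;
  phi : M -> 'rV[R]_n;
  psi : 'rV[R]_n -> M;
  open_dom : open dom;
  open_cod : open cod;
  phi_cod : forall p, dom p -> cod (phi p);
  psi_dom : forall x, cod x -> dom (psi x);
  phiK : forall p, dom p -> psi (phi p) = p;
  psiK : forall x, cod x -> phi (psi x) = x;
  phi_continuous : {in dom, continuous phi};
  psi_continuous : {in cod, continuous psi} }.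

#[global] Arguments open_dom {n M} c.
#[global] Arguments open_cod {n M} c.

Definition transition n (M : topologicalType) (c d : chart n M) :
  'rV[R]_n -> 'rV[R]_n := phi d \o psi c.

Definition transition_dom n (M : topologicalType) (c d : chart n M) :
  set 'rV[R]_n := [set x | cod c x /\ dom d (psi c x)].

(* Smooth closed connected n-manifolds, a connected space being by convention
   nonempty. Charts are onto open subsets of R^n, hence there is no boundary;
   second countability follows from compactness. *)
Record closed_manifold (n : nat) := ClosedManifold {
  carrier :> topologicalType;
  atlas : set (chart n carrier);
  atlas_cover : forall p : carrier, exists2 c, atlas c & dom c p;
  atlas_smooth : forall c d, atlas c -> atlas d ->
    smooth (transition c d) (transition_dom c d);
  manifold_hausdorff : hausdorff_space carrier;
  manifold_compact : compact [set: carrier];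
  manifold_connected : connected [set: carrier];
  manifold_nonempty : [set: carrier] !=set0 }.

#[global] Arguments atlas {n} c0.
#[global] Arguments atlas_cover {n} c0.
#[global] Arguments atlas_smooth {n} c0.
#[global] Arguments manifold_hausdorff {n} c0.
#[global] Arguments manifold_compact {n} c0.
#[global] Arguments manifold_connected {n} c0.
#[global] Arguments manifold_nonempty {n} c0.

Lemma transition_dom_open n (M : topologicalType) (c d : chart n M) :
  open (transition_dom c d).
Proof.
rewrite openE => x [cx dx]; rewrite /interior.
have : nbhs x (cod c `&` psi c @^-1` dom d).
  apply: filterI; first exact: open_nbhs_nbhs (conj (open_cod c) cx).
  apply: (psi_continuous (mem_set cx)).
  exact: open_nbhs_nbhs (conj (open_dom d) dx).
by [].
Qed.

Section product.
Context (n m : nat).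

Section product_chart.
Context (N M : topologicalType) (c : chart n N) (d : chart m M).

Definition prod_dom : set (N * M) := dom c `*` dom d.
Definition prod_cod : set 'rV[R]_(n + m) :=
  [set x | cod c (lsubmx x) /\ cod d (rsubmx x)].
Definition prod_phi (p : N * M) : 'rV[R]_(n + m) :=
  row_mx (phi c p.1) (phi d p.2).
Definition prod_psi (x : 'rV[R]_(n + m)) : N * M :=
  (psi c (lsubmx x), psi d (rsubmx x)).

Let open_prod_dom : open prod_dom.
Proof.
apply: (@openI _ (fst @^-1` dom c) (snd @^-1` dom d)).
  by apply: open_comp (open_dom c) => x _; exact: cvg_fst.
by apply: open_comp (open_dom d) => x _; exact: cvg_snd.
Qed.

Let open_prod_cod : open prod_cod.
Proof.
apply: (@openI _ (lsubmx @^-1` cod c) (rsubmx @^-1` cod d)).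
  exact/open_lsubmx/open_cod.
exact/open_rsubmx/open_cod.
Qed.

Let prod_phi_cod p : prod_dom p -> prod_cod (prod_phi p).
Proof.
by move=> [cp dp]; rewrite /prod_cod /prod_phi /= row_mxKl row_mxKr;
  split; exact: phi_cod.
Qed.

Let prod_psi_dom x : prod_cod x -> prod_dom (prod_psi x).
Proof. by move=> [cx dx]; split; exact: psi_dom. Qed.

Let prod_phiK p : prod_dom p -> prod_psi (prod_phi p) = p.
Proof.
by case: p => a b [/= ca db]; rewrite /prod_psi /prod_phi row_mxKl row_mxKr !phiK.
Qed.

Let prod_psiK x : prod_cod x -> prod_phi (prod_psi x) = x.
Proof. by move=> [cx dx]; rewrite /prod_phi /= !psiK// hsubmxK. Qed.

Let prod_phi_continuous : {in prod_dom, continuous prod_phi}.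
Proof.
move=> p; rewrite inE => -[cp dp]; apply: (@row_mx_cvg _ _ (nbhs p)).
  by apply: cvg_comp; [exact: cvg_fst|exact: phi_continuous (mem_set cp)].
by apply: cvg_comp; [exact: cvg_snd|exact: phi_continuous (mem_set dp)].
Qed.

Let prod_psi_continuous : {in prod_cod, continuous prod_psi}.
Proof.
move=> x; rewrite inE => -[cx dx].
apply: (@cvg_pair _ _ _ (nbhs x) (nbhs (prod_psi x).1) (nbhs (prod_psi x).2)).
  apply: (@continuous_comp _ _ _ lsubmx (psi c)); first exact: lsubmx_continuous.
  exact: psi_continuous (mem_set cx).
apply: (@continuous_comp _ _ _ rsubmx (psi d)); first exact: rsubmx_continuous.
exact: psi_continuous (mem_set dx).
Qed.

Definition prod_chart : chart (n + m) (N * M)%type :=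
  Chart open_prod_dom open_prod_cod prod_phi_cod prod_psi_dom
    prod_phiK prod_psiK prod_phi_continuous prod_psi_continuous.

End product_chart.

Context (N : closed_manifold n) (M : closed_manifold m).

Definition prod_atlas : set (chart (n + m) (N * M)%type) :=
  [set prod_chart c d | c in atlas N & d in atlas M].

Let prod_atlas_cover (p : N * M) : exists2 c, prod_atlas c & dom c p.
Proof.
have [c Nc cp] := atlas_cover N p.1; have [d Md dp] := atlas_cover M p.2.
by exists (prod_chart c d) => //; exists c => //; exists d.
Qed.

Let prod_atlas_smooth c d : prod_atlas c -> prod_atlas d ->
  smooth (transition c d) (transition_dom c d).
Proof.
move=> [c1 Nc1 [c2 Mc2 <-]] [d1 Nd1 [d2 Md2 <-]] k.
set V := transition_dom _ _.
have -> : V = (lsubmx @^-1` transition_dom c1 d1) `&`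
              (rsubmx @^-1` transition_dom c2 d2).
  by apply/seteqP; split=> x; rewrite /V /transition_dom /= => -[[? ?] [? ?]].
have VS (W : normedModType R) (f : 'rV[R]_(n + m) -> W) A B :
    Ck k f A -> B `<=` A -> Ck k f B.
  move=> + BA; elim: (k) f => [|j IH] f [cf df]; split=> //.
  - by move=> x; rewrite inE => /BA Ax; apply: cf; rewrite inE.
  - by move=> x; rewrite inE => /BA Ax; apply: cf; rewrite inE.
  - by move=> i; have [d1f d2f] := df i; split=> [x /BA|]; [exact: d1f|exact: IH].
apply: (@Ck_row_mx _ _ _ _ _ (transition c1 d1 \o lsubmx)
                              (transition c2 d2 \o rsubmx)).
- apply: openI.
    exact/open_lsubmx/transition_dom_open.
  exact/open_rsubmx/transition_dom_open.
- apply: VS (@subIsetl _ _ _); apply: Ck_precomp.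
  + exact: lsubmx_continuous.
  + exact: lsubmx_ebase.
  + exact: atlas_smooth.
- apply: VS (@subIsetr _ _ _); apply: Ck_precomp.
  + exact: rsubmx_continuous.
  + exact: rsubmx_ebase.
  + exact: atlas_smooth.
Qed.

Let prod_compact : compact [set: N * M].
Proof.
by rewrite -setXTT; apply: compact_setX; exact: manifold_compact.
Qed.

Let prod_nonempty : [set: N * M] !=set0.
Proof.
by have [x _] := manifold_nonempty N; have [y _] := manifold_nonempty M;
  exists (x, y).
Qed.

Definition prod_manifold : closed_manifold (n + m) :=
  ClosedManifold prod_atlas_cover prod_atlas_smooth
    (hausdorff_prod (manifold_hausdorff N) (manifold_hausdorff M))
    prod_compact
    (connected_setXT (manifold_connected N) (manifold_connected M))
    prod_nonempty.

End product.

End manifolds.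

Arguments chart : clear implicits.
Arguments closed_manifold : clear implicits.

Section lebesgue_outer_measure.
Context {R : realType} {n : nat}.
Implicit Types (A : set 'rV[R]_n) (ab : 'rV[R]_n * 'rV[R]_n)
  (o : option ('rV[R]_n * 'rV[R]_n)).
Local Open Scope ereal_scope.

Definition box ab : set 'rV[R]_n :=
  [set x | forall i, (ab.1 0%R i <= x 0%R i <= ab.2 0%R i)%R].

Definition box_volume ab : \bar R :=
  (\prod_(i < n) Num.max 0 (ab.2 0 i - ab.1 0 i))%R%:E.

(* [None] is an additional empty box: in dimension 0 there is no other one. *)
Definition obox o : set 'rV[R]_n := if o is Some ab then box ab else set0.

Definition obox_volume o : \bar R := if o is Some ab then box_volume ab else 0.

Definition box_cover A : set (nat -> option ('rV[R]_n * 'rV[R]_n)) :=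
  [set Q | A `<=` \bigcup_k obox (Q k)].

Definition lebesgue_outer A : \bar R :=
  ereal_inf [set \sum_(k <oo) obox_volume (Q k) | Q in box_cover A].

Let obox_volume_ge0 o : 0 <= obox_volume o.
Proof.
case: o => [ab|] //=; rewrite lee_fin; apply: prodr_ge0 => i _.
by rewrite le_max lexx.
Qed.

Let lebesgue_outer_ge0 A : 0 <= lebesgue_outer A.
Proof. by apply: le_ereal_inf_tmp => _ [Q _ <-]; exact: nneseries_ge0. Qed.

Let lebesgue_outer0 : lebesgue_outer set0 = 0.
Proof.
apply/eqP; rewrite eq_le lebesgue_outer_ge0 andbT.
by apply: ereal_inf_lbound; exists (fun=> None) => //; rewrite eseries0.
Qed.

Let le_lebesgue_outer : {homo lebesgue_outer : A B / A `<=` B >-> A <= B}.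
Proof.
move=> A B AB; apply: ereal_inf_le_tmp => _ [Q BQ <-]; exists Q => //.
exact: subset_trans AB BQ.
Qed.

Let lebesgue_outer_sigma_subadditive : sigma_subadditive lebesgue_outer.
Proof.
move=> A; have [[i ioo]|] := pselect (exists i, lebesgue_outer (A i) = +oo).
  rewrite (eseries_pinfty _ _ ioo) ?leey// => k _.
  by rewrite -ltNye (lt_le_trans _ (lebesgue_outer_ge0 _)).
rewrite -forallNE => Aoo.
suff add2e (e : {posnum R}) :
    lebesgue_outer (\bigcup_n A n) <= \sum_(i <oo) lebesgue_outer (A i) + e%:num%:E.
  by apply/lee_addgt0Pr => _/posnumP[].
rewrite (le_trans _ (epsilon_trick _ _ _))//.
pose P k Q := box_cover (A k) Q /\
  \sum_(j <oo) obox_volume (Q j) <= lebesgue_outer (A k) + (e%:num / (2 ^ k.+1)%:R)%:E.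
have [G PG] : {G : nat -> nat -> option ('rV[R]_n * 'rV[R]_n) & forall k, P k (G k)}.
  apply: (@choice _ _ P) => k.
  have ek : (0 < e%:num / (2 ^ k.+1)%:R :> R)%R by [].
  have Afin : lebesgue_outer (A k) \is a fin_num.
    by rewrite ge0_fin_numE// ltey; exact/eqP/Aoo.
  have [_ [Q AQ <-] Qlt] := lb_ereal_inf_adherent ek Afin.
  by exists Q; split=> //; exact: ltW.
pose v (ij : nat * nat) := obox_volume (G ij.1 ij.2).
have v_ge0 ij : 0 <= v ij by exact: obox_volume_ge0.
apply: (@le_trans _ _ (\esum_(ij in setT) v ij)).
  have /card_esym/ppcard_eqP[f] := card_nat2.
  apply: ereal_inf_lbound; exists (fun k => G (f k).1 (f k).2).
    move=> x [i _] /((PG i).1) [j _ Gij].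
    by exists (f^-1%FUN (i, j)) => //=; rewrite invK ?inE.
  rewrite (@reindex_esum _ _ _ [set: nat] [set: nat * nat] f v); last exact: bij.
  by rewrite nneseries_esumT.
rewrite (_ : esum _ _ = \sum_(i <oo) \sum_(j <oo) v (i, j)); last first.
  rewrite (_ : [set: nat * nat] = setT `*`` (fun=> setT)); last first.
    by apply/seteqP; split.
  rewrite -(@esum_esum _ _ _ _ _ (fun i j => v (i, j)))//.
  rewrite nneseries_esumT; last first.
    by move=> k; apply: nneseries_ge0 => j _ _; exact: v_ge0.
  by apply: eq_esum => i _; rewrite nneseries_esumT.
apply: lee_nneseries => [k _ _|k _]; first exact: nneseries_ge0.
exact: (PG k).2.
Qed.

HB.instance Definition _ := isOuterMeasure.Build R 'rV[R]_n lebesgue_outer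
  lebesgue_outer0 lebesgue_outer_ge0 le_lebesgue_outer
  lebesgue_outer_sigma_subadditive.

End lebesgue_outer_measure.

Definition rV_lebesgue (R : realType) (n : nat) : measurableType _ :=
  caratheodory_type (@lebesgue_outer R n).

Section lebesgue_measure_rV.
Context {R : realType} {n : nat}.

Definition lebesgueN : set (rV_lebesgue R n) -> \bar R := @lebesgue_outer R n.

HB.instance Definition _ := isMeasure.Build _ _ _ lebesgueN
  (@caratheodory_measure0 _ _ (@lebesgue_outer R n))
  (@caratheodory_measure_ge0 _ _ (@lebesgue_outer R n))
  (@caratheodory_measure_sigma_additive _ _ (@lebesgue_outer R n)).

End lebesgue_measure_rV.

Section local_expressions.
Context {R : realType} {n : nat}.
Implicit Types (f : 'rV[R]_n -> R) (G : 'rV[R]_n -> 'M[R]_n) (x : 'rV[R]_n).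

Definition grad f x : 'rV[R]_n := \row_i 'D_(ebase i) f x.

Definition hess f x : 'M[R]_n :=
  \matrix_(i, j) 'D_(ebase i) ('D_(ebase j) f) x.

(* Levi-Civita connection of the metric with Gram matrix G *)
Definition christoffel G x (k i j : 'I_n) : R :=
  2^-1 * \sum_(l < n) invmx (G x) k l *
    ('D_(ebase i) (fun y => G y j l) x + 'D_(ebase j) (fun y => G y i l) x
     - 'D_(ebase l) (fun y => G y i j) x).

Definition cov_hess G f x : 'M[R]_n :=
  \matrix_(i, j) (hess f x i j -
    \sum_(k < n) christoffel G x k i j * grad f x 0 k).

(* Pointwise norms of f, of df and of the second covariant derivative, the
   latter two being those induced by the metric on (multi)covectors *)
Definition cov_norm (i : 'I_3) G f x : R :=
  match val i with
  | 0%N => `|f x|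
  | 1%N => Num.sqrt ((grad f x *m invmx (G x) *m (grad f x)^T) 0 0)
  | _ => Num.sqrt (\tr (invmx (G x) *m cov_hess G f x *m
                        invmx (G x) *m (cov_hess G f x)^T))
  end.

End local_expressions.

Section geometry.
Context {R : realType} {n : nat}.
Implicit Type X : closed_manifold R n.

(* [gram c x] is the Gram matrix at psi c x of the coordinate frame of the chart
   c; it is relevant for c in the atlas and x in cod c only. *)
Record riemannian_metric X := RiemannianMetric {
  gram :> chart R n X -> 'rV[R]_n -> 'M[R]_n;
  gram_smooth : forall c, atlas X c -> smooth (gram c) (cod c);
  gram_sym : forall c x, atlas X c -> cod c x -> (gram c x)^T = gram c x;
  gram_pos : forall c x (v : 'rV[R]_n), atlas X c -> cod c x -> v != 0 ->
    0 < (v *m gram c x *m v^T) 0 0;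
  gram_transition : forall c d x, atlas X c -> atlas X d ->
    transition_dom c d x ->
    gram c x = 'J (transition c d) x *m gram d (transition c d x) *m
               ('J (transition c d) x)^T }.

Definition smooth_function X (f : X -> R) : Prop :=
  forall c, atlas X c -> smooth (f \o psi c) (cod c).

Record Cinfty X := MkCinfty {
  cinfty_fun :> X -> R;
  cinfty_smooth : smooth_function cinfty_fun }.

(* The local expressions of the pointwise norms agree on overlaps, so the
   suprema below are suprema over X. *)
Definition C2_norm X (g : riemannian_metric X) (f : X -> R) : \bar R :=
  (\sum_(i < 3) ereal_sup [set (cov_norm i (g cx.1) (f \o psi cx.1) cx.2)%:E
     | cx in [set cx : chart R n X * 'rV[R]_n | atlas X cx.1 /\ cod cx.1 cx.2]])%E.

Definition C2_open X (g : riemannian_metric X) (U : set (Cinfty X)) : Prop :=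
  forall F, U F -> exists2 e : R, 0 < e &
    forall G : Cinfty X, (C2_norm g (fun p => (G p - F p)%R) < e%:E)%E -> U G.

Definition critical_point X (f : X -> R) (p : X) : Prop :=
  forall c, atlas X c -> dom c p -> grad (f \o psi c) (phi c p) = 0.

Definition nondegenerate_at X (f : X -> R) (p : X) : Prop :=
  forall c, atlas X c -> dom c p -> hess (f \o psi c) (phi c p) \in unitmx.

Definition morse X (f : X -> R) : Prop :=
  smooth_function f /\ forall p, critical_point f p -> nondegenerate_at f p.

Definition riemannian_cover X (A : set X) :
    set (nat -> chart R n X * set 'rV[R]_n) :=
  [set P | (forall k, [/\ atlas X (P k).1, measurable ((P k).2 : set (rV_lebesgue R n)) &
                          (P k).2 `<=` cod (P k).1]) /\
           A `<=` \bigcup_k (psi (P k).1 @` (P k).2)].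

(* The Riemannian measure, extended to all sets as an outer measure: the infimum
   over the countable coverings by measurable pieces of coordinate patches, the
   volume of a piece being the integral of sqrt (det g) in coordinates. *)
Definition riemannian_measure X (g : riemannian_metric X) (A : set X) : \bar R :=
  ereal_inf [set (\sum_(k <oo) \int[lebesgueN]_(x in (P k).2)
                   (Num.sqrt (\det (g (P k).1 x)))%:E)%E
            | P in riemannian_cover A].

Definition measure_zero X (A : set X) : Prop :=
  forall g : riemannian_metric X, riemannian_measure g A = 0%E.

End geometry.

(* Main.v *)
Require Import Defs.
From HB Require Import structures.
From mathcomp Require Import all_boot all_order all_algebra.
From mathcomp Require Import all_classical all_reals all_analysis.
From mathcomp Require Import ring lra zify.

(** Cover N × M by finitely many products of cubes of charts, and let h_kl be
    smooth functions on M that are the coordinates x_l on the second factor of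
    the k-th product. The function sought is F_a = F + sum_kl a_kl h_kl for a
    small matrix a.

    On the k-th product, changing the k-th row of a by b translates the gradient
    of F_a(s, .) by b and does not affect the Hessian. So after the change, the
    parameters s with a degenerate critical point in the cube are those for which
    -b is a critical value of the gradient map of F_a(s, .) on it. For one s,
    Sard's theorem (for C^1 maps between spaces of the same dimension) makes
    almost every b harmless; the point is to find one a that serves for almost
    every s, which one would normally get from Fubini's theorem. Here both are
    replaced by a single count on grids (few_critical_cells). With mesh 1/q in x
    and 1/q^2 in s and b, the image under the gradient map of a pair of cells
    that meets the critical locus lies in a slab of thickness O(1/q^2) and
    diameter O(1/q), hence contains O(q^(m-1)) of the q^(2m) values b. Therefore
    some b is bad for a proportion O(1/q) of the cells of s only.

    That the bad s of the k-th product meet a proportion of at most 1/t of the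
    cells of some fine grid is an open condition on a, as degeneracy is a closed
    condition and the cubes are compact (grid_small_bad_open), and it is a dense
    one by the count (grid_small_dense). By Baire's theorem there are arbitrarily
    small a that satisfy it for all k and t. For these the bad sets are compact,
    of measure zero (grid_null_lebesgue) and nowhere dense
    (grid_null_dense_compl); N_0 is the complement of their images in N. That a
    critical point which is nondegenerate in one chart is so in all of them is
    nondegenerate_transition.

    It remains to see that small a give functions that are C^2-close to F. The
    C^2-norm is a supremum over all charts of the atlas; the pointwise norms in
    it do not depend on the chart (cov_norm_transition, which is the tensor
    character of the covariant Hessian), so they can be computed in one chart
    around each point, where they are continuous in the point and in a, and
    compactness concludes (C2_norm_small). *)

Set Implicit Arguments.
Unset Strict Implicit.
Unset Printing Implicit Defensive.

Import Order.TTheory GRing.Theory Num.Theory.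
Import numFieldNormedType.Exports.

Local Open Scope classical_set_scope.
Local Open Scope ring_scope.

(** * Calculus of k times continuously differentiable maps *)

Section Ck_calculus.
Context {R : realType} {n : nat}.
Implicit Types (U V : set 'rV[R]_n) (W : normedModType R).

Lemma Ck_subset W k (f : 'rV[R]_n -> W) U V : V `<=` U -> Ck k f U -> Ck k f V.
Proof.
move=> VU; elim: k f => [|k IH] f [cf df]; split=> //.
1,2: by move=> x /set_mem/VU/mem_set; exact: cf.
move=> i; have [dfi Cfi] := df i; split; last exact: IH.
by move=> x /VU; exact: dfi.
Qed.

(** Each of the conditions that define [Ck] concerns one point at a time. *)
Lemma Ck_local W k (f : 'rV[R]_n -> W) U :
  (forall x, U x -> exists2 V, V x & Ck k f V) -> Ck k f U.
Proof.
elim: k f => [|k IH] f H; split=> //.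
1,2: by move=> x /set_mem/H[V /mem_set Vx /Ck_continuous]; exact.
move=> i; split=> [x /H[V Vx [_ /(_ i)[+ _]]]|]; first exact.
by apply: IH => x /H[V Vx [_ /(_ i)[_ ?]]]; exists V.
Qed.

Lemma CkW W k (f : 'rV[R]_n -> W) U : Ck k.+1 f U -> Ck k f U.
Proof.
elim: k f => [|k IH] f [cf df]; split=> // i.
by have [dfi Cfi] := df i; split=> //; exact: IH.
Qed.

Lemma Ck_derivable W k (f : 'rV[R]_n -> W) U x i :
  Ck k.+1 f U -> U x -> derivable f x (ebase i).
Proof. by move=> [_ /(_ i)[+ _]]; exact. Qed.

Lemma Ck_derive W k (f : 'rV[R]_n -> W) U i :
  Ck k.+1 f U -> Ck k ('D_(ebase i) f) U.
Proof. by move=> [_ /(_ i)[]]. Qed.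

Lemma smooth_derive W (f : 'rV[R]_n -> W) U i :
  smooth f U -> smooth ('D_(ebase i) f) U.
Proof. by move=> sf k; exact: Ck_derive (sf k.+1). Qed.

Lemma CkD W k (f g : 'rV[R]_n -> W) U : open U ->
  Ck k f U -> Ck k g U -> Ck k (fun x => f x + g x) U.
Proof.
move=> oU; elim: k f g => [|k IH] f g [cf df] [cg dg].
  by split=> // x xU; apply: (@continuousD _ _ _ f g); [exact: cf|exact: cg].
split=> [x xU|i]; first by apply: (@continuousD _ _ _ f g); [exact: cf|exact: cg].
have [dfi Cfi] := df i; have [dgi Cgi] := dg i; split=> [x Ux|].
  by apply: (@derivableD _ _ _ f g); [exact: dfi|exact: dgi].
apply: Ck_eq oU _ (IH _ _ Cfi Cgi) => x Ux.
by rewrite (@deriveD _ _ _ f g); [|exact: dfi|exact: dgi].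
Qed.

Lemma CkM k (f g : 'rV[R]_n -> R) U : open U ->
  Ck k f U -> Ck k g U -> Ck k (fun x => f x * g x) U.
Proof.
move=> oU; elim: k f g => [|k IH] f g Cf Cg.
  case: Cf Cg => [cf df] [cg dg].
  by split=> // x xU; apply: (@continuousM _ _ f g); [exact: cf|exact: cg].
have [cf df] := Cf; have [cg dg] := Cg.
split=> [x xU|i]; first by apply: (@continuousM _ _ f g); [exact: cf|exact: cg].
have [dfi Cfi] := df i; have [dgi Cgi] := dg i; split=> [x Ux|].
  by apply: (@derivableM _ _ f g); [exact: dfi|exact: dgi].
apply: Ck_eq oU _ (CkD oU (IH _ _ (CkW Cf) Cgi) (IH _ _ (CkW Cg) Cfi)) => x Ux.
by rewrite (@deriveM _ _ f g); [|exact: dfi|exact: dgi].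
Qed.

Lemma Ck_sum W k (I : Type) (r : seq I) (P : pred I) (f : I -> 'rV[R]_n -> W) U :
  open U -> (forall i, P i -> Ck k (f i) U) ->
  Ck k (fun x => \sum_(i <- r | P i) f i x) U.
Proof.
move=> oU Cf; elim: r => [|i r IH].
  under eq_fun do rewrite big_nil; exact: Ck_cst.
under eq_fun do rewrite big_cons.
by case: (boolP (P i)) => [Pi|//]; apply: CkD => //; exact: Cf.
Qed.

Lemma CkMl k (a : R) (f : 'rV[R]_n -> R) U : open U ->
  Ck k f U -> Ck k (fun x => a * f x) U.
Proof. by move=> oU; apply: CkM => //; exact: Ck_cst. Qed.

Lemma Ck_coord p q k (f : 'rV[R]_n -> 'M[R]_(p, q)) i j U : open U ->
  Ck k f U -> Ck k (fun x => f x i j) U.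
Proof.
move=> oU; elim: k f => [|k IH] f [cf df].
  split=> // x xU; apply: (@continuous_comp _ _ _ f (fun A : 'M[R]_(p, q) => A i j)).
    exact: cf.
  exact: coord_continuous.
split=> [x xU|l].
  apply: (@continuous_comp _ _ _ f (fun A : 'M[R]_(p, q) => A i j)).
    exact: cf.
  exact: coord_continuous.
have [dfi Cfi] := df l; split=> [x Ux|].
  by apply: (derivable_mxP f x (ebase l)).1; exact: dfi.
apply: Ck_eq oU _ (IH _ Cfi) => x Ux.
by rewrite derive_mx ?mxE//; exact: dfi.
Qed.

Lemma Ck_id k U : Ck k (fun x : 'rV[R]_n => x) U.
Proof.
elim: k U => [|k IH] U; split=> //; try by move=> x _; exact: cvg_id.
move=> i; split=> [x _|]; first exact: derivable_id.
rewrite (_ : 'D__ _ = fun=> ebase i); first exact: Ck_cst.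
by apply/funext => x; exact: derive_id.
Qed.

Let line_derive (f : 'rV[R]_n -> R) (z v : 'rV[R]_n) (s : R) :
  derivable f (z + s *: v) v ->
  is_derive s (1 : R) (fun t => f (z + t *: v)) ('D_v f (z + s *: v)).
Proof.
pose g (t : R) := f (z + t *: v).
have E (h : R) : (g \o shift s) (h *: 1) - g s =
   (f \o shift (z + s *: v)) (h *: v) - f (z + s *: v).
  by rewrite /g /=; congr (f _ - _); rewrite scalerDl addrCA [h *: 1]mulr1.
move=> ds; apply: DeriveDef.
  by rewrite /derivable; under eq_fun do rewrite E; exact: ds.
by rewrite /derive; under eq_fun do rewrite E.
Qed.

Lemma MVT_segment_line (f : 'rV[R]_n -> R) (z v : 'rV[R]_n) :
  (forall s, 0 <= s <= 1 -> derivable f (z + s *: v) v) ->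
  exists2 s, 0 <= s <= 1 & f (z + v) - f z = 'D_v f (z + s *: v).
Proof.
move=> df; have dg s : 0 <= s <= 1 -> _ := fun H => line_derive (df s H).
have [||s] := @MVT_segment _ (fun t => f (z + t *: v))
    (fun s => 'D_v f (z + s *: v)) 0 1 ler01.
- by move=> s; rewrite in_itv /= => /andP[s0 s1]; apply: dg; rewrite !ltW.
- apply: continuous_in_subspaceT => s; rewrite inE /= in_itv /= => /dg[d _].
  exact/differentiable_continuous/derivable1_diffP.
rewrite in_itv /= => s01; rewrite scale0r scale1r addr0 subr0 mulr1 => ->.
by exists s.
Qed.

(** Mean value theorem along a line, in a form that does not care about the sign
    of the step. *)
Lemma MVT_line (f : 'rV[R]_n -> R) (z : 'rV[R]_n) (v : 'rV[R]_n) (t : R) :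
  (forall s, `|s| <= `|t| -> derivable f (z + s *: v) v) ->
  exists2 s, `|s| <= `|t| &
    f (z + t *: v) - f z = t * 'D_v f (z + s *: v).
Proof.
move=> df; pose g s := f (z + s *: v).
have dg (s : R) : `|s| <= `|t| -> is_derive s (1 : R) g ('D_v f (z + s *: v)).
  by move=> /df; exact: line_derive.
have cg (s : R) : `|s| <= `|t| -> {for s, continuous g}.
  move=> /dg [d _]; apply: differentiable_continuous.
  exact/derivable1_diffP.
have [t0|t0] := leP 0 t.
- have [||s] := @MVT_segment _ g (fun s => 'D_v f (z + s *: v)) 0 t t0.
  + move=> s; rewrite in_itv /= => /andP[s0 st]; apply: dg.
    by rewrite !ger0_norm// ltW.
  + apply: continuous_in_subspaceT => s; rewrite inE /= in_itv /= => /andP[s0 st].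
    by apply: cg; rewrite !ger0_norm.
  rewrite in_itv /= => /andP[s0 st]; rewrite /g scale0r addr0 subr0 mulrC => ->.
  by exists s => //; rewrite !ger0_norm.
- have [||s] := @MVT_segment _ g (fun s => 'D_v f (z + s *: v)) t 0 (ltW t0).
  + move=> s; rewrite in_itv /= => /andP[s0 st]; apply: dg.
    by rewrite !ltr0_norm ?lerN2 ?ltW// (lt_trans s0).
  + apply: continuous_in_subspaceT => s; rewrite inE /= in_itv /= => /andP[s0 st].
    by apply: cg; rewrite (ler0_norm st) (ltr0_norm t0) lerN2.
  rewrite in_itv /= => /andP[s0 st]; rewrite /g scale0r addr0 sub0r => e.
  by exists s; [rewrite (ler0_norm st) (ltr0_norm t0) lerN2|rewrite -opprB e; ring].
Qed.

End Ck_calculus.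

(** * Differentiability from partial derivatives, chain rule, symmetry of second derivatives *)

Section differential_calculus.
Context {R : realType}.

Lemma row_norm_le n (v : 'rV[R]_n) (M : R) :
  0 <= M -> (forall i, `|v 0 i| <= M) -> `|v| <= M.
Proof.
move=> M0 vM; rewrite [leLHS]/Num.Def.normr/= mx_normrE (bigmax_le _ M0)//=.
by move=> -[i j] _ /=; rewrite ord1.
Qed.

Lemma coord_norm_le n (v : 'rV[R]_n) i : `|v 0 i| <= `|v|.
Proof.
rewrite [leRHS]/Num.Def.normr/= mx_normrE.
exact: (le_bigmax _ (fun i : 'I_1 * 'I_n => `|v i.1 i.2|) (0, i)).
Qed.

Lemma sum_coord_le n (v : 'rV[R]_n) (a : 'I_n -> R) (e : R) :
  (forall i, `|a i| <= e) -> `|\sum_i v 0 i * a i| <= n%:R * (`|v| * e).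
Proof.
move=> ae; apply: le_trans (ler_norm_sum _ _ _) _.
apply: le_trans (_ : \sum_(i < n) `|v| * e <= _).
  apply: ler_sum => i _; rewrite normrM ler_pM//; exact: coord_norm_le.
by rewrite sumr_const card_ord -[leLHS]mulr_natl.
Qed.

Lemma cvg_sumr (T : Type) (F : set_system T) {FF : Filter F} (I : Type)
    (r : seq I) (P : pred I) (f : I -> T -> R) (a : I -> R) :
  (forall i, P i -> f i x @[x --> F] --> a i) ->
  \sum_(i <- r | P i) f i x @[x --> F] --> \sum_(i <- r | P i) a i.
Proof.
move=> fa; elim: r => [|i r IH].
  rewrite big_nil; under eq_fun do rewrite big_nil; exact: cvg_cst.
rewrite big_cons; under eq_fun do rewrite big_cons.
by case: ifP => // Pi; apply: cvgD => //; exact: fa.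
Qed.

Lemma diff_of_littleo (V W : normedModType R) (f : V -> W) (df : {linear V -> W})
    (x : V) : continuous df ->
  (forall e : R, 0 < e ->
     \forall h \near (0 : V), `|f (h + x) - f x - df h| <= e * `|h|) ->
  differentiable f x /\ 'd f x = df :> (V -> W).
Proof.
move=> cdf H.
have fo : f \o shift x = cst (f x) + df +o_ 0 id.
  apply/eqaddoP => e e0; have := H _ e0; apply: filterS => h /=.
  by rewrite !fctE /= opprD addrA.
have dE : 'd f x = df :> (V -> W) by exact: diff_unique.
by split=> //; apply/diff_locallyP; rewrite dE; split.
Qed.

Section C1_differentiable.
Context {n : nat} (f : 'rV[R]_n -> R) (U : set 'rV[R]_n) (x : 'rV[R]_n).
Hypotheses (oU : open U) (Ux : U x) (Cf : Ck 1 f U).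

Let df (v : 'rV[R]_n) : R := \sum_i v 0 i * 'D_(ebase i) f x.

Let df_linear : linear df.
Proof.
move=> a u v; rewrite /df scaler_sumr -big_split /=; apply: eq_bigr => i _.
by rewrite !mxE mulrDl scalerAl.
Qed.

Let dfL : {linear 'rV[R]_n -> R} :=
  HB.pack df (GRing.isLinear.Build _ _ _ _ _ df_linear).

Let df_continuous : continuous dfL.
Proof.
move=> v; apply: (@cvg_sumr _ (nbhs v)) => i _.
by apply: cvgM; [exact: coord_continuous | exact: cvg_cst].
Qed.

(** The increment is split into coordinate steps, each of which is controlled
    by the mean value theorem and the continuity of one partial derivative. *)
Let df_littleo (e : R) : 0 < e ->
  \forall h \near (0 : 'rV[R]_n), `|f (h + x) - f x - dfL h| <= e * `|h|.
Proof.
move=> e0; pose e1 := e / n.+1%:R; have e10 : 0 < e1 by rewrite divr_gt0.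
have : \forall y \near x, U y /\ forall i, `|'D_(ebase i) f x - 'D_(ebase i) f y| <= e1.
  apply: filterI; first exact: open_nbhs_nbhs.
  apply: (@filter_forall _ _
    (fun i y => `|'D_(ebase i) f x - 'D_(ebase i) f y| <= e1) (nbhs x)) => i.
  have := (Ck_continuous (Ck_derive i Cf) (mem_set Ux)).
  by move/cvgrPdist_le; exact.
move=> /nbhs_ballP [d /= d0 Hd].
near=> h.
have hd : `|h| < d by near: h; apply: cvgr0_norm_lt.
pose p k : 'rV[R]_n := \row_i (if (i < k)%N then h 0 i else 0).
have pS (k : 'I_n) : p k.+1 = p k + h 0 k *: ebase k.
  apply/rowP => i; rewrite !mxE ltnS leq_eqVlt eqxx /=.
  have [->|ik] := eqVneq i k; first by rewrite eqxx ltnn mulr1 add0r.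
  by rewrite (inj_eq val_inj) (negPf ik) /= mulr0 addr0.
have small (k : 'I_n) (s : R) : `|s| <= `|h 0 k| -> `|p k + s *: ebase k| <= `|h|.
  move=> sh; apply: row_norm_le => // i; rewrite !mxE eqxx /=.
  have [->|ik] := eqVneq i k.
    by rewrite ltnn mulr1 add0r (le_trans sh)// coord_norm_le.
  by rewrite mulr0 addr0; case: ifP => _; rewrite ?normr0// coord_norm_le.
have Hs (k : 'I_n) (s : R) : `|s| <= `|h 0 k| -> ball x d (x + (p k + s *: ebase k)).
  move=> sh; rewrite -ball_normE /ball_ /= opprD addNKr normrN.
  exact: le_lt_trans (small _ _ sh) hd.
have step (k : 'I_n) : `|f (x + p k.+1) - f (x + p k) - h 0 k * 'D_(ebase k) f x|
    <= e1 * `|h|.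
  have [|s sh] := @MVT_line _ _ f (x + p k) (ebase k) (h 0 k).
    move=> s sh; rewrite -addrA; apply: Ck_derivable Cf _.
    exact: (Hd _ (Hs _ _ sh)).1.
  rewrite pS addrA => ->; rewrite -mulrBr normrM mulrC.
  apply: ler_pM => //; last exact: coord_norm_le.
  by rewrite distrC -addrA; exact: (Hd _ (Hs _ _ sh)).2.
have -> : f (h + x) - f x - dfL h =
    \sum_(k < n) (f (x + p k.+1) - f (x + p k) - h 0 k * 'D_(ebase k) f x).
  rewrite sumrB; congr (_ - _).
  transitivity (\sum_(0 <= k < n) (f (x + p k.+1) - f (x + p k))); last first.
    by rewrite big_mkord.
  rewrite (telescope_sumr (fun k => f (x + p k)))//; congr (f _ - f _).
    by rewrite addrC; congr (_ + _); apply/rowP => i; rewrite mxE ltn_ord.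
  by rewrite -[LHS]addr0; congr (_ + _); apply/rowP => i; rewrite !mxE.
apply: le_trans (ler_norm_sum _ _ _) _.
apply: le_trans (_ : \sum_(k < n) e1 * `|h| <= _); first exact: ler_sum.
rewrite sumr_const card_ord -[leLHS]mulr_natl mulrA ler_wpM2r//.
by rewrite /e1 mulrCA ler_piMr ?(ltW e0)// ler_pdivrMr// mul1r ler_nat.
Unshelve. all: by end_near. Qed.

Let df_diff := diff_of_littleo df_continuous df_littleo.

Lemma C1_differentiable : differentiable f x. Proof. exact: df_diff.1. Qed.

Lemma C1_diffE : 'd f x = df :> (_ -> _). Proof. exact: df_diff.2. Qed.

Lemma C1_derive v : 'D_v f x = \sum_i v 0 i * 'D_(ebase i) f x.
Proof. by rewrite deriveE ?C1_diffE//; exact: C1_differentiable. Qed.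

End C1_differentiable.

Lemma C1_differentiable_rV n p (f : 'rV[R]_n -> 'rV[R]_p) U x :
  open U -> U x -> Ck 1 f U -> differentiable f x.
Proof.
move=> oU Ux Cf.
rewrite (_ : f = \sum_(i < p) (fun y => f y 0 i *: ebase i)); last first.
  by apply/funext => y; rewrite fct_sumE -row_sum_delta.
apply: differentiable_sum => i; apply: differentiableZl.
exact: C1_differentiable (Ck_coord 0 i oU Cf).
Qed.

Section chain_rule.
Context {p n : nat} (T : 'rV[R]_p -> 'rV[R]_n) (V : set 'rV[R]_p) (U : set 'rV[R]_n).
Hypotheses (oV : open V) (oU : open U) (TVU : forall x, V x -> U (T x)).

Lemma derive_chain (f : 'rV[R]_n -> R) x i : Ck 1 T V -> Ck 1 f U -> V x ->
  derivable (f \o T) x (ebase i) /\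
  'D_(ebase i) (f \o T) x =
    \sum_j 'D_(ebase i) (fun y => T y 0 j) x * 'D_(ebase j) f (T x).
Proof.
move=> CT Cf Vx; have dT := C1_differentiable_rV oV Vx CT.
have df := C1_differentiable oU (TVU Vx) Cf.
have dfT := differentiable_comp dT df; split; first exact: diff_derivable.
rewrite deriveE// diff_comp//= (C1_diffE oU (TVU Vx) Cf); apply: eq_bigr => j _.
by rewrite -deriveE// derive_mx ?mxE//; exact: diff_derivable.
Qed.

Lemma Ck_comp k (f : 'rV[R]_n -> R) : Ck k T V -> Ck k f U -> Ck k (f \o T) V.
Proof.
elim: k f => [|k IH] f CT Cf.
all: have cfT : {in V, continuous (f \o T)}.
1,3: by move=> x xV; apply: (@continuous_comp _ _ _ T f);
  [exact: (Ck_continuous CT xV)|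
   exact: (Ck_continuous Cf (mem_set (TVU (set_mem xV))))].
  by split.
have C1 (W : normedModType R) q (g : 'rV[R]_q -> W) A : Ck k.+1 g A -> Ck 1 g A.
  elim: (k) => // j IHj C; apply: IHj; exact: CkW.
split=> // i; split=> [x Vx|]; first exact: (derive_chain i (C1 _ _ _ _ CT) (C1 _ _ _ _ Cf) Vx).1.
apply: (@Ck_eq _ _ _ _
  (fun x => \sum_j 'D_(ebase i) (fun y => T y 0 j) x * 'D_(ebase j) f (T x)) _ V oV).
  by move=> x Vx; rewrite (derive_chain i (C1 _ _ _ _ CT) (C1 _ _ _ _ Cf) Vx).2.
apply: Ck_sum => // j _; apply: CkM => //.
  exact: Ck_derive (Ck_coord 0 j oV CT).
exact: (IH _ (CkW CT) (Ck_derive j Cf)).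
Qed.

End chain_rule.

Lemma MVT_segment_rV n (f : 'rV[R]_n -> R) (U : set 'rV[R]_n) (y z : 'rV[R]_n) :
  open U -> Ck 1 f U -> (forall s : R, 0 <= s <= 1 -> U (y + s *: (z - y))) ->
  exists2 s, 0 <= s <= 1 &
    f z - f y = \sum_i (z - y) 0 i * 'D_(ebase i) f (y + s *: (z - y)).
Proof.
move=> oU Cf Us; have [s|s] := @MVT_segment_line _ _ f y (z - y).
  by move=> s01; exact/diff_derivable/(C1_differentiable oU (Us _ s01) Cf).
move=> s01; rewrite subrKC => ->; exists s => //.
exact: (C1_derive oU (Us _ s01) Cf).
Qed.

(** The second difference of [f] over a small square is computed by the mean
    value theorem in the two possible orders. *)
Lemma derive_swap n (f : 'rV[R]_n -> R) (U : set 'rV[R]_n) x (i j : 'I_n) :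
  open U -> U x -> Ck 2 f U ->
  'D_(ebase i) ('D_(ebase j) f) x = 'D_(ebase j) ('D_(ebase i) f) x.
Proof.
move=> oU Ux Cf.
have shiftE (g : 'rV[R]_n -> R) w v y :
    (fun h : R => h^-1 *: (((fun z => g (z + w)) \o shift y) (h *: v) - g (y + w)))
  = (fun h : R => h^-1 *: ((g \o shift (y + w)) (h *: v) - g (y + w))).
  by apply/funext => h /=; rewrite addrA.
have key a b (d : R) : 0 < d -> (forall y, ball x d y -> U y) ->
   forall t : R, `|t| + `|t| < d -> exists2 y, ball x d y &
   f (x + t *: ebase a + t *: ebase b) - f (x + t *: ebase a)
   - (f (x + t *: ebase b) - f x) = t * (t * 'D_(ebase b) ('D_(ebase a) f) y).
  move=> d0 Hd t td.
  have eb c : `|ebase c : 'rV[R]_n| <= 1.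
    apply: row_norm_le => // k; rewrite mxE; case: (_ && _); first by rewrite normr1.
    by rewrite normr0.
  have bd (s s' : R) : `|s| <= `|t| -> `|s'| <= `|t| ->
      ball x d (x + s *: ebase a + s' *: ebase b).
    move=> st s't; rewrite -ball_normE /ball_ /= -addrA opprD addNKr normrN.
    apply: le_lt_trans td; apply: le_trans (ler_normD _ _) _.
    by apply: lerD; rewrite normrZ; [apply: le_trans st|apply: le_trans s't];
      rewrite ler_piMr.
  have bd0 (s : R) : `|s| <= `|t| -> ball x d (x + s *: ebase a).
    by move=> st; rewrite -[_ + _]addr0 -(scale0r (ebase b)); apply: bd; rewrite ?normr0.
  have [|s st] := @MVT_line _ _ (fun z => f (z + t *: ebase b) - f z) x (ebase a) t.
    move=> s st; apply: derivableB.
      by rewrite /derivable shiftE; apply: Ck_derivable Cf _; exact/Hd/bd.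
    by apply: Ck_derivable Cf _; exact/Hd/bd0.
  rewrite deriveB; last first.
  - by apply: Ck_derivable Cf _; exact/Hd/bd0.
  - by rewrite /derivable shiftE; apply: Ck_derivable Cf _; exact/Hd/bd.
  rewrite [X in _ * (X - _)]/derive shiftE.
  have [|s' s't] := @MVT_line _ _ ('D_(ebase a) f) (x + s *: ebase a) (ebase b) t.
    by move=> s' s't; apply: Ck_derivable (Ck_derive a Cf) _; exact/Hd/bd.
  move=> E2 E1; exists (x + s *: ebase a + s' *: ebase b); first exact: bd.
  by rewrite E1 -E2.
have C i' j' : {for x, continuous ('D_(ebase i') ('D_(ebase j') f))}.
  exact: (Ck_continuous (Ck_derive i' (Ck_derive j' Cf)) (mem_set Ux)).
apply/eqP; rewrite -subr_eq0 -normr_le0; apply/ler_addgt0Pr => e e0; rewrite add0r.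
have tri (a b c c' : R) : c' = c -> `|a - c'| <= e / 2 -> `|b - c| <= e / 2 ->
    `|a - b| <= e.
  by move=> -> ac bc; rewrite (splitr e) (le_trans (ler_distD c _ _))// lerD// distrC.
have e2 : 0 < e / 2 by rewrite divr_gt0.
have : \forall y \near x, [/\ U y,
    `|'D_(ebase i) ('D_(ebase j) f) x - 'D_(ebase i) ('D_(ebase j) f) y| <= e / 2 &
    `|'D_(ebase j) ('D_(ebase i) f) x - 'D_(ebase j) ('D_(ebase i) f) y| <= e / 2].
  have /cvgrPdist_le/(_ _ e2) Ci := C i j; have /cvgrPdist_le/(_ _ e2) Cj := C j i.
  have nU : nbhs x U by exact: open_nbhs_nbhs.
  by apply: filterS3 nU Ci Cj => y Uy Ciy Cjy; split; [exact: Uy|exact: Ciy|exact: Cjy].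
move=> /nbhs_ballP [d /= d0 Hd].
have HU y : ball x d y -> U y by move=> /Hd[].
have td : `|d / 4| + `|d / 4| < d by rewrite ger0_norm ?divr_ge0 ?ltW//; lra.
have t0 : d / 4 != 0 by rewrite gt_eqF// divr_gt0.
have [y /Hd [_ _ yd] Ey] := key i j d d0 HU _ td.
have [z /Hd [_ zd _] Ez] := key j i d d0 HU _ td.
have yz : 'D_(ebase i) ('D_(ebase j) f) z = 'D_(ebase j) ('D_(ebase i) f) y.
  apply: (mulfI t0); apply: (mulfI t0).
  have sw (a b c e' : R) : a - b - (c - e') = a - c - (b - e') by ring.
  by refine (etrans (esym Ez) (etrans _ Ey)); rewrite sw (addrAC x (_ *: ebase j)).
by refine (tri _ _ _ _ yz zd yd).
Qed.

End differential_calculus.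

(** * Flat functions *)

Section flat_functions.
Context {R : realType}.
Implicit Types (P : {poly R}) (x : R).

(** The functions P(1/x) exp(-1/x), extended by 0 to the negative half-line:
    a class of functions that is closed under differentiation, whence the
    smoothness of its members. *)
Definition flat P x : R := if 0 < x then P.[x^-1] * expR (- x^-1) else 0.

Lemma flat_le0 P x : x <= 0 -> flat P x = 0.
Proof. by move=> x0; rewrite /flat ltNge x0. Qed.

(** The exponential series dominates every power of 1/x. *)
Lemma flat_bound P : exists2 C, 0 <= C & forall x, `|flat P x| <= C * `|x|.
Proof.
exists (\sum_(i < size P) `|P`_i| * (i.+1)`!%:R).
  by apply: sumr_ge0 => i _; rewrite mulr_ge0.
move=> x; have [x0|x0] := ltP 0 x; last first.
  rewrite flat_le0// normr0 mulr_ge0//.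
  by apply: sumr_ge0 => i _; rewrite mulr_ge0.
rewrite /flat x0 horner_coef mulr_suml mulr_suml.
apply: le_trans (ler_norm_sum _ _ _) _; apply: ler_sum => i _.
rewrite !normrM -!mulrA ler_wpM2l// (gtr0_norm x0) gtr0_norm ?exprn_gt0 ?invr_gt0//.
rewrite gtr0_norm ?expR_gt0// expRN ler_pdivrMr ?expR_gt0//.
have y0 : 0 <= x^-1 by rewrite invr_ge0 ltW.
have := expR_ge1Dxn i y0 => H.
have : x^-1 ^+ i.+1 / (i.+1)`!%:R <= expR x^-1 by apply: le_trans H; rewrite lerDr.
rewrite ler_pdivrMr ?ltr0n ?fact_gt0// exprS => H'.
rewrite [leRHS](_ : _ = x * (expR x^-1 * (i.+1)`!%:R)); last by ring.
by rewrite -[leLHS](mulVKf (lt0r_neq0 x0)) ler_wpM2l// ltW.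
Qed.

Let inv_derive x : 0 < x -> is_derive x (1 : R) (fun y : R => y^-1) (- x ^- 2).
Proof.
move=> x0; have nx : x != 0 by rewrite gt_eqF.
have -> : - x ^- 2 = - x ^- 2 *: (1 : R) by rewrite [RHS]mulr1.
exact: (@is_deriveV _ id x 1 1).
Qed.

Lemma flat_derive P x : is_derive x (1 : R) (flat P) (flat ('X^2 * (P - P^`())) x).
Proof.
have [x0|x0] := ltP 0 x.
  have dinv := inv_derive x0.
  have dP := @is_derive1_comp _ (horner P) (fun y : R => y^-1) x _ _ (is_derive_poly _ _) dinv.
  have dE := @is_derive1_comp _ expR (fun y : R => - y^-1) x _ _ (is_derive_expR _) (is_deriveN dinv).
  have dPE := is_deriveM dP dE.
  apply: (@near_eq_is_derive _ _ _
    ((horner P \o (fun y : R => y^-1)) * (expR \o (fun y : R => - y^-1)))).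
  - have : \forall y \near x, 0 < y by apply: open_nbhs_nbhs; split; [exact: open_gt|].
    by apply: filterS => y y0; rewrite /flat y0.
  - apply: is_derive_eq.
    rewrite /flat x0 /= !hornerE opprK /GRing.scale /= exprVn; ring.
have flat0 y Q : y <= 0 -> flat Q y = 0 by exact: flat_le0.
rewrite flat_le0//; move: x0; rewrite le_eqVlt => /predU1P[->|x0]; last first.
  apply: (@near_eq_is_derive _ _ _ (cst 0)).
  have : \forall y \near x, y < 0 by apply: open_nbhs_nbhs; split; [exact: open_lt|].
  by apply: filterS => y y0; rewrite flat_le0// ltW.
(* At 0 the difference quotient is again of the same form, with X * P for P. *)
have [C C0 HC] := flat_bound ('X * P).
have H : h^-1 *: ((flat P \o shift 0) (h *: (1 : R)) - flat P 0) @[h --> 0^'] --> (0 : R).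
  apply/cvgr0Pnorm_le => e e0; near=> h.
  have -> : h^-1 *: ((flat P \o shift 0) (h *: (1 : R)) - flat P 0) = flat ('X * P) h.
    rewrite /= addr0 [h *: 1]mulr1 (flat_le0 P (lexx 0)) subr0 /flat.
    by case: ifP => h0; rewrite ?scaler0// !hornerE /GRing.scale /= mulrA.
  apply: le_trans (HC h) _.
  apply: le_trans (_ : (C + 1) * `|h| <= _); first by rewrite ler_wpM2r// lerDl.
  rewrite -ler_pdivlMl ?ltr_wpDl//.
  near: h; apply: dnbhs0_le; rewrite mulr_gt0 ?invr_gt0 ?ltr_wpDl//.
apply: DeriveDef; first by apply/cvg_ex; eexists; exact: H.
by apply/cvg_lim; [exact: norm_hausdorff | exact: H].
Unshelve. all: by end_near. Qed.

Lemma flat_continuous P : continuous (flat P).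
Proof.
move=> x; have [d _] := flat_derive P x.
exact/differentiable_continuous/derivable1_diffP.
Qed.

Lemma Ck_flat n k P (u : 'rV[R]_n -> R) U : open U -> Ck k u U ->
  Ck k (fun y => flat P (u y)) U.
Proof.
move=> oU; elim: k P => [|k IH] P Cu.
all: have cfu : {in U, continuous (fun y => flat P (u y))}.
1,3: by move=> y yU; apply: (@continuous_comp _ _ _ u (flat P));
  [exact: (Ck_continuous Cu yU) | exact: flat_continuous].
  by split.
split=> // i.
have H y : U y -> derivable (flat P \o u) y (ebase i) /\
   'D_(ebase i) (flat P \o u) y = flat ('X^2 * (P - P^`())) (u y) * 'D_(ebase i) u y.
  move=> Uy; have Cu1 : Ck 1 u U.
    by elim: (k) Cu => // j IHj C; apply: IHj; exact: CkW.
  have du := C1_differentiable oU Uy Cu1.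
  have [dP vP] := flat_derive P (u y).
  have /derivable1_diffP dP' := dP.
  have dc := differentiable_comp du dP'; split; first exact: diff_derivable.
  rewrite deriveE// diff_comp//= -(deriveE _ du) (deriv1E dP) derive1E vP.
  by rewrite /GRing.scale /= mulrC.
split=> [y Uy|]; first exact: (H y Uy).1.
apply: Ck_eq oU _ (CkM oU (IH _ (CkW Cu)) (Ck_derive i Cu)) => y Uy.
by rewrite (H y Uy).2.
Qed.

End flat_functions.

(** * Counting critical values on grids *)

Section grids.
Context {R : realType}.

Definition cube n (c : 'rV[R]_n) (r : R) : set 'rV[R]_n :=
  [set x | forall i, `|x 0 i - c 0 i| <= r].

(** The cells are closed, so that they cover the cube and are compact; they
    overlap along their faces. *)
Definition cell n (c : 'rV[R]_n) (r : R) q (k : {ffun 'I_n -> 'I_q}) : set 'rV[R]_n :=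
  [set x | forall i, c 0 i - r + 2 * r * (k i)%:R / q%:R <= x 0 i <=
                     c 0 i - r + 2 * r * (k i).+1%:R / q%:R].

Lemma cell_cube n (c : 'rV[R]_n) r q k : 0 <= r -> @cell n c r q k `<=` cube c r.
Proof.
move=> r0 x kx i; have /andP[x1 x2] := kx i.
have q0 : (0 : R) < q%:R by rewrite ltr0n (leq_ltn_trans _ (ltn_ord (k i))).
have h0 : 0 <= 2 * r * (k i)%:R / q%:R by rewrite !mulr_ge0// invr_ge0 ltW.
have h1 : 2 * r * (k i).+1%:R / q%:R <= 2 * r.
  by rewrite ler_pdivrMr// ler_wpM2l ?mulr_ge0// ler_nat.
rewrite ler_norml; apply/andP; split; lra.
Qed.

Lemma cell_dist n (c : 'rV[R]_n) r q k x y : 0 <= r ->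
  @cell n c r q k x -> cell c r k y -> `|x - y| <= 2 * r / q%:R.
Proof.
move=> r0 kx ky; apply: row_norm_le => [|i].
  by rewrite divr_ge0// mulr_ge0.
rewrite !mxE; have := kx i; have := ky i.
rewrite -(addn1 (k i)) natrD mulrDr mulrDl mulr1 => /andP[y1 y2] /andP[x1 x2].
rewrite ler_norml; apply/andP; split; lra.
Qed.

Lemma cube_cell n (c : 'rV[R]_n) r q x : 0 < r -> (0 < q)%N -> cube c r x ->
  exists k, @cell n c r q k x.
Proof.
move=> r0 q0 cx; have qR : (0 : R) < q%:R by rewrite ltr0n.
have r2 : 0 < 2 * r by rewrite mulr_gt0.
have H i : exists k : 'I_q, c 0 i - r + 2 * r * k%:R / q%:R <= x 0 i <=
                     c 0 i - r + 2 * r * k.+1%:R / q%:R.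
  have := cx i; rewrite ler_norml => /andP[x1 x2].
  pose y := (x 0 i - c 0 i + r) / (2 * r) * q%:R.
  have Ex : x 0 i = c 0 i - r + 2 * r * y / q%:R.
    by rewrite /y; field; rewrite !gt_eqF.
  have y0 : 0 <= y by apply: mulr_ge0 => //; apply: divr_ge0; [lra|exact: ltW].
  have yq : y <= q%:R.
    by rewrite /y ler_piMl// ler_pdivrMr// mul1r; lra.
  have mono a b : a <= b -> c 0 i - r + 2 * r * a / q%:R <= c 0 i - r + 2 * r * b / q%:R.
    by move=> ab; rewrite lerD2l ler_wpM2r ?invr_ge0 ?(ltW qR)// ler_wpM2l// ltW.
  rewrite Ex; have [yq1|yq1] := ltP y q%:R.
    have tq : (Num.truncn y < q)%N by rewrite -(ltr_nat R) (le_lt_trans _ yq1)// truncn_le.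
    have /andP[y1 y2] := truncn_itv y0.
    by exists (Ordinal tq); apply/andP; split; apply: mono => //; exact: ltW.
  have q1 : (q.-1 < q)%N by rewrite prednK.
  by exists (Ordinal q1); rewrite /= prednK// !mono// (le_trans _ yq1)// ler_nat leq_pred.
exists [ffun i => xchoose (H i)] => i.
by rewrite ffunE; exact: (xchooseP (H i)).
Qed.

End grids.

Lemma eq_mod_close d a b : a = b %[mod d] -> (a < b + d)%N -> (b < a + d)%N -> a = b.
Proof.
move=> ab h1 h2; have [d0|d0] := posnP d; first by move: h1 h2; rewrite d0; lia.
have [le|/ltnW le] := leqP b a; [move/eqP: ab | move/esym/eqP: ab];
  rewrite eqn_mod_dvd// => /dvdnP[e E].
- by case: e E => [|e]; nia.
- by case: e E => [|e]; nia.
Qed.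

Lemma ltn_close_nat (R : realType) (a b d : nat) (e : R) :
  `|a%:R - b%:R| <= e -> e < d%:R -> (a < b + d)%N.
Proof.
move=> ab ed; rewrite -(ltr_nat R) natrD -ltrBlDl.
exact: le_lt_trans (le_trans (ler_norm _) ab) ed.
Qed.

(** Reducing the coordinate [l] modulo C2 and the others modulo D is injective
    on [S]; the free slot [l] of the first component makes room for one more
    index in 'I_D, which spares the exponent m - 1. *)
Lemma card_slab m q D C2 (S : {set {ffun 'I_m -> 'I_q}}) (l : 'I_m) :
  (forall k k', k \in S -> k' \in S -> forall i, (k i < k' i + D)%N) ->
  (forall k k', k \in S -> k' \in S -> (forall i, i != l -> k i = k' i) ->
     (k l < k' l + C2)%N) ->
  (0 < D)%N -> (0 < C2)%N -> (D * #|S| <= D ^ m * C2)%N.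
Proof.
case: D => // D; case: C2 => // C2 SD SC _ _.
pose f (u : 'I_D.+1 * {ffun 'I_m -> 'I_q}) : {ffun 'I_m -> 'I_D.+1} * 'I_C2.+1 :=
  ([ffun i => if i == l then u.1 else inord (u.2 i %% D.+1)], inord (u.2 l %% C2.+1)).
have finj : {in finset.setX [set: 'I_D.+1]%SET S &, injective f}.
  move=> [e k] [e' k']; rewrite !inE /= => kS k'S [/ffunP H1 /(congr1 val) H2].
  have ee' : e = e' by have := H1 l; rewrite !ffunE eqxx.
  have E i : i != l -> k i = k' i.
    move=> il; have := H1 i; rewrite !ffunE (negPf il) => /(congr1 val) /=.
    rewrite !inordK ?ltn_mod// => kk'; apply/val_inj.
    by apply: eq_mod_close kk' _ _; exact: SD.
  congr (_, _) => //; apply/ffunP => i; have [->|/E//] := eqVneq i l.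
  move: H2 => /=; rewrite !inordK ?ltn_mod// => kk'; apply/val_inj.
  by apply: eq_mod_close kk' _ _; apply: SC => // j jl; rewrite E.
have := card_in_imset finj; rewrite cardsX cardsT card_ord => <-.
rewrite (leq_trans (max_card _))// card_prod card_ffun !card_ord//.
Qed.

Section sard.
Context {R : realType} {n m : nat}.
Variables (G : 'rV[R]_n -> 'rV[R]_m -> 'rV[R]_m) (A : 'rV[R]_n -> 'rV[R]_m -> 'M[R]_m).
Variables (c : 'rV[R]_n) (d : 'rV[R]_m) (r L : R).
Hypotheses (r0 : 0 < r) (L0 : 0 <= L).
Hypothesis G_lipschitz : forall s s' x x' e,
  cube c r s -> cube c r s' -> cube d r x -> cube d r x' ->
  `|s - s'| <= e -> `|x - x'| <= e -> `|G s x - G s' x'| <= L * e.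
(* The first-order expansion in [x] with a remainder of second order; a step [e']
   in [s] is allowed to contribute linearly, whence the finer mesh in [s]. *)
Hypothesis G_taylor : forall s s' s'' x x' x'' e e',
  cube c r s -> cube c r s' -> cube c r s'' ->
  cube d r x -> cube d r x' -> cube d r x'' -> e' <= e ->
  `|s - s'| <= e' -> `|s' - s''| <= e' -> `|x - x'| <= e -> `|x' - x''| <= e ->
  `|G s x - G s' x' - (x - x') *m A s'' x''| <= L * (e ^+ 2 + e').

Definition critical_value s (b : 'rV[R]_m) (K : set 'rV[R]_m) :=
  exists2 x, K x & G s x = b /\ \det (A s x) = 0.

Definition critical_cells q (b : 'rV[R]_m) : {set {ffun 'I_n -> 'I_q}} :=
  [set k | `[< exists2 s, cell c r k s & critical_value s b (cube d r) >]]%SET.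

Section counting.
Variables (eta : R) (q C1 C2 : nat).
Hypotheses (eta0 : 0 < eta) (q0 : (0 < q)%N).
(* In units of the mesh eta / q^2 of the grid of values, C1 * q bounds the
   diameter of a slab and C2 its thickness. *)
Hypotheses (HC1 : 2 * r * L / eta < C1%:R)
           (HC2 : m%:R * (L * ((2 * r) ^+ 2 + 2 * r)) / eta < C2%:R).

Let Q := (q ^ 2)%N.

Definition grid_value (k : {ffun 'I_m -> 'I_Q}) : 'rV[R]_m :=
  \row_i (eta * (k i)%:R / Q%:R).

Let S (sg : {ffun 'I_n -> 'I_Q}) (xi : {ffun 'I_m -> 'I_q}) :
    {set {ffun 'I_m -> 'I_Q}} :=
  [set k | `[< exists2 s, cell c r sg s &
               critical_value s (grid_value k) (cell d r xi) >]]%SET.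

Let QE : Q%:R = q%:R ^+ 2 :> R. Proof. by rewrite /Q natrX. Qed.

Let qR : (0 : R) < q%:R. Proof. by rewrite ltr0n. Qed.

Let dot_le (v w : 'rV[R]_m) : (forall i, `|w 0 i| <= 1) ->
  `|\sum_i v 0 i * w 0 i| <= m%:R * `|v|.
Proof. by move=> w1; rewrite -[`|v|]mulr1; exact: sum_coord_le. Qed.

(** If w is a unit covector that annihilates the image of the degenerate matrix
    [A s0 x0], the values of [G] on the cell vary by O(1/q) in all directions but
    only by O(1/q^2) along w. *)
Let card_S sg xi : (C1 * q * #|S sg xi| <= (C1 * q) ^ m * C2)%N.
Proof.
have [->|[k0 k0S]] := set_0Vmem (S sg xi); first by rewrite cards0 muln0.
have r0' := ltW r0.
have C1p : (0 < C1)%N.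
  by rewrite -(ltr_nat R) (le_lt_trans _ HC1)// divr_ge0 ?mulr_ge0 ?(ltW eta0).
have C2p : (0 < C2)%N.
  by rewrite -(ltr_nat R) (le_lt_trans _ HC2)// divr_ge0 ?mulr_ge0 ?addr_ge0 ?sqr_ge0 ?(ltW eta0) ?mulr_ge0.
have Sin k : k \in S sg xi -> exists s x, [/\ cell c r sg s, cell d r xi x,
    G s x = grid_value k & \det (A s x) = 0].
  by rewrite inE => /asboolP[s ss [x xx [? ?]]]; exists s, x.
have [s0 [x0 [ss0 xx0 _ detA]]] := Sin _ k0S.
have : \det (A s0 x0)^T == 0 by rewrite det_tr detA.
move=> /det0P[w' w'0 w'A].
have [i0 wi0] : exists i, w' 0 i != 0.
  apply/existsP; apply: contra_neqT w'0; rewrite negb_exists => /forallP H.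
  by apply/rowP => i; rewrite mxE; apply/eqP; have := H i; rewrite negbK.
pose l := [arg max_(i > i0) `|w' 0 i|]%O.
have Hl i : `|w' 0 i| <= `|w' 0 l| by rewrite /l; case: arg_maxP => // j _; exact.
have wl0 : 0 < `|w' 0 l| by rewrite (lt_le_trans _ (Hl i0))// normr_gt0.
(* Normalized at its largest entry, the covector has w_l = 1 and determines the
   l-th coordinate from the others without loss. *)
pose w := (w' 0 l)^-1 *: w'.
have wl : w 0 l = 1 by rewrite mxE mulVf// -normr_gt0.
have w1 i : `|w 0 i| <= 1.
  by rewrite mxE normrM normfV mulrC ler_pdivrMr// mul1r.
have wA : A s0 x0 *m w^T = 0.
  by apply: trmx_inj; rewrite trmx_mul trmxK /w -scalemxAl w'A scaler0 trmx0.
have gridB k k' i : (grid_value k - grid_value k') 0 i =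
    eta / Q%:R * ((k i)%:R - (k' i)%:R).
  by rewrite !mxE; ring.
have Q0 : (0 : R) < Q%:R by rewrite QE exprn_gt0.
have eQ : 0 < eta / Q%:R by rewrite divr_gt0.
have ee' : 2 * r / Q%:R <= 2 * r / q%:R.
  rewrite ler_pM2l ?mulr_gt0// lef_pV2 ?posrE// ler_nat /Q.
  by rewrite expnS leq_pmulr// expn1.
apply: (@card_slab _ _ _ _ _ l) => //; last by rewrite muln_gt0 C1p.
- move=> k k' /Sin[s [x [ss xx Gk _]]] /Sin[s' [x' [ss' xx' Gk' _]]] i.
  have e1 := le_trans (cell_dist r0' ss ss') ee'.
  have e2 := cell_dist r0' xx xx'.
  have := G_lipschitz (cell_cube r0' ss) (cell_cube r0' ss') (cell_cube r0' xx)
    (cell_cube r0' xx') e1 e2.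
  rewrite Gk Gk' => /(le_trans (coord_norm_le _ i)); rewrite gridB normrM.
  rewrite (gtr0_norm eQ) mulrC -ler_pdivlMr// => H.
  apply: (ltn_close_nat H); rewrite natrM -ltr_pdivrMr//.
  rewrite [ltLHS](_ : _ = 2 * r * L / eta)// QE; field.
  by rewrite !gt_eqF.
- move=> k k' /Sin[s [x [ss xx Gk _]]] /Sin[s' [x' [ss' xx' Gk' _]]] kk'.
  have := G_taylor (cell_cube r0' ss) (cell_cube r0' ss') (cell_cube r0' ss0)
    (cell_cube r0' xx) (cell_cube r0' xx') (cell_cube r0' xx0) ee'
    (cell_dist r0' ss ss') (cell_dist r0' ss' ss0) (cell_dist r0' xx xx')
    (cell_dist r0' xx' xx0).
  rewrite Gk Gk'; set v := (X in `|X| <= _) => Hv.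
  have : \sum_i v 0 i * w 0 i = eta / Q%:R * ((k l)%:R - (k' l)%:R).
    transitivity ((v *m w^T) 0 0).
      by rewrite mxE; apply: eq_bigr => i _; rewrite [w^T _ _]mxE.
    rewrite /v mulmxBl -mulmxA wA mulmx0 subr0 mxE (bigD1 l)//= big1 ?addr0.
      by rewrite gridB mxE wl mulr1.
    by move=> i il; rewrite gridB kk'// subrr mulr0 mul0r.
  move=> E; have := dot_le v w1; rewrite E normrM (gtr0_norm eQ).
  move=> /le_trans/(_ (ler_wpM2l (ler0n _ _) Hv)).
  rewrite mulrC -ler_pdivlMr// => H.
  apply: (ltn_close_nat H); apply: le_lt_trans HC2.
  rewrite le_eqVlt; apply/orP; left; apply/eqP; rewrite QE; field.
  by rewrite !gt_eqF.
Qed.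

Let crit_in_S (sg : {ffun 'I_n -> 'I_Q}) k :
  sg \in critical_cells Q (grid_value k) -> exists xi, k \in S sg xi.
Proof.
rewrite inE => /asboolP[s ss [x dx [Gx Ax]]].
have [xi xxi] := cube_cell r0 q0 dx.
by exists xi; rewrite inE; apply/asboolP; exists s => //; exists x.
Qed.

Let double_count :
  (\sum_k #|critical_cells Q (grid_value k)| <= \sum_sg \sum_xi #|S sg xi|)%N.
Proof.
apply: (@leq_trans (\sum_k \sum_sg \sum_xi (k \in S sg xi))); last first.
  rewrite exchange_big; apply: leq_sum => sg _; rewrite exchange_big.
  apply: leq_sum => xi _; rewrite -sum1_card [leqRHS]big_mkcond /=.
  by apply: leq_sum => k _; case: ifP.
apply: leq_sum => k _; rewrite -sum1_card [leqLHS]big_mkcond; apply: leq_sum => sg _.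
case: ifP => // /crit_in_S[xi kS].
by rewrite (bigD1 xi)//= kS.
Qed.

(** Double counting: if every grid value had too many critical cells, so would
    the pairs of cells of [s] and of [x] in total. *)
Lemma few_critical_cells t : (t * (C1 ^ m * C2) < C1 * q)%N ->
  exists k, (#|critical_cells Q (grid_value k)| * t <= Q ^ n)%N.
Proof.
move=> Hq; apply/existsP; apply: contraT; rewrite negb_exists => /forallP H.
suff : (C1 * q * (q ^ (2 * n + 2 * m)) <= t * (C1 ^ m * C2) * (q ^ (2 * n + 2 * m)))%N.
  by rewrite leq_pmul2r ?expn_gt0 ?q0// leqNgt Hq.
have H1 : (Q ^ m * Q ^ n <= \sum_k #|critical_cells Q (grid_value k)| * t)%N.
  have := @leq_sum {ffun 'I_m -> 'I_Q} (index_enum _) xpredT (fun=> Q ^ n)%N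
    (fun k => #|critical_cells Q (grid_value k)| * t)%N.
  rewrite sum_nat_const card_ffun !card_ord; apply=> k _.
  by have := H k; rewrite -ltnNge => /ltnW.
have H2 : (C1 * q * \sum_k #|critical_cells Q (grid_value k)| <=
    Q ^ n * (q ^ m * ((C1 * q) ^ m * C2)))%N.
  apply: (leq_trans (leq_mul (leqnn _) double_count)).
  rewrite big_distrr /=.
  have := @leq_sum {ffun 'I_n -> 'I_Q} (index_enum _) xpredT
    (fun sg => C1 * q * \sum_xi #|S sg xi|)%N (fun=> q ^ m * ((C1 * q) ^ m * C2))%N.
  rewrite sum_nat_const card_ffun !card_ord; apply=> sg _.
  rewrite big_distrr /=.
  have := @leq_sum {ffun 'I_m -> 'I_q} (index_enum _) xpredT
    (fun xi => C1 * q * #|S sg xi|)%N (fun=> (C1 * q) ^ m * C2)%N.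
  by rewrite sum_nat_const card_ffun !card_ord; apply=> xi _; exact: card_S.
rewrite -big_distrl /= in H1.
set w := (\sum_k _)%N in H1 H2; move: w H1 H2 => w.
rewrite expnMn /Q -!expnM expnD; set a := (q ^ (2 * n))%N; set b := (q ^ m)%N.
have -> : (q ^ (2 * m) = b * b)%N by rewrite mul2n -addnn expnD.
move=> H1 H2; have H3 := leq_mul (leqnn (C1 * q)) H1; have H4 := leq_mul H2 (leqnn t).
have -> : (t * (C1 ^ m * C2) * (a * (b * b)) = a * (b * (C1 ^ m * b * C2)) * t)%N by ring.
apply: leq_trans H4; rewrite -[leqRHS]mulnA; apply: leq_trans H3.
by rewrite [(a * _)%N]mulnC.
Qed.

Lemma grid_value_le k : `|grid_value k| <= eta.
Proof.
apply: row_norm_le => [|i]; first exact: ltW.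
have Q0 : (0 : R) < Q%:R by rewrite QE exprn_gt0.
rewrite mxE ger0_norm ?divr_ge0 ?mulr_ge0 ?(ltW eta0)//.
by rewrite ler_pdivrMr// ler_wpM2l ?(ltW eta0)// ler_nat ltnW.
Qed.

End counting.

(** Sard's theorem with parameters. The constants C1 and C2 do not depend on q, so
    the bound of [few_critical_cells] is as small as desired for large q. *)
Lemma sard_grid eta t : 0 < eta -> exists b : 'rV[R]_m, `|b| <= eta /\
  exists q, [/\ (0 < q)%N, (t <= q)%N & (#|critical_cells q b| * t <= q ^ n)%N].
Proof.
move=> eta0.
have [C1 H1] : exists C : nat, 2 * r * L / eta < C%:R.
  by eexists; exact: truncnS_gt.
have [C2 H2] : exists C : nat, m%:R * (L * ((2 * r) ^+ 2 + 2 * r)) / eta < C%:R.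
  by eexists; exact: truncnS_gt.
have C10 : (0 < C1)%N.
  by rewrite -(ltr_nat R) (le_lt_trans _ H1)// divr_ge0 ?mulr_ge0 ?(ltW eta0) ?(ltW r0).
pose q := (t * (C1 ^ m * C2) + t).+1.
have Hq : (t * (C1 ^ m * C2) < C1 * q)%N.
  by rewrite (leq_trans _ (leq_pmull _ C10))// /q ltnS leq_addr.
have [k Hk] := few_critical_cells eta0 (ltn0Sn _ : 0 < q)%N H1 H2 Hq.
exists (grid_value eta k); split; first exact: grid_value_le.
exists (q ^ 2)%N; split; rewrite ?expn_gt0//.
by rewrite (@leq_trans q)// ?leq_addl// /q; first lia; rewrite expnS leq_pmulr.
Qed.

End sard.

(** * Sets that are negligible on fine grids *)

Section grid_null_sets.
Context {R : realType} {n : nat}.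
Variables (c : 'rV[R]_n) (r : R).
Hypothesis r0 : 0 < r.

Definition hit_cells q (Z : set 'rV[R]_n) : {set {ffun 'I_n -> 'I_q}} :=
  [set k | `[< exists2 s, cell c r k s & Z s >]]%SET.

(** Sets of arbitrarily small proportion of cells in arbitrarily fine grids.
    Unlike the measure of a set, this involves finitely many cells at a time,
    which makes it an open condition when the set depends on parameters. *)
Definition grid_small (t : nat) (Z : set 'rV[R]_n) : Prop :=
  exists q, [/\ (0 < q)%N, (t <= q)%N & (#|hit_cells q Z| * t <= q ^ n)%N].

Definition grid_null Z := forall t, grid_small t Z.

Let r0' : 0 <= r. Proof. exact: ltW. Qed.

Let cell_obox q (k : {ffun 'I_n -> 'I_q}) : option ('rV[R]_n * 'rV[R]_n) :=
  Some (\row_i (c 0 i - r + 2 * r * (k i)%:R / q%:R),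
        \row_i (c 0 i - r + 2 * r * (k i).+1%:R / q%:R)).

Let cell_oboxE q k : obox (@cell_obox q k) = cell c r k.
Proof. by apply/seteqP; split=> x xk i; have := xk i; rewrite !mxE. Qed.

Let cell_volume q k : (0 < q)%N ->
  obox_volume (@cell_obox q k) = ((2 * r / q%:R) ^+ n)%:E.
Proof.
move=> q0; rewrite /= /box_volume; congr (_%:E).
rewrite -[in RHS](card_ord n) -prodr_const; apply: eq_bigr => i _.
rewrite !mxE max_r; rewrite -(addn1 (k i)) natrD; first by field; rewrite pnatr_eq0 -lt0n.
rewrite [leRHS](_ : _ = 2 * r / q%:R); first by rewrite divr_ge0// mulr_ge0.
by field; rewrite pnatr_eq0 -lt0n.
Qed.

Lemma grid_null_lebesgue Z : Z `<=` cube c r -> grid_null Z ->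
  lebesgue_outer Z = 0%E.
Proof.
move=> Zc Z0; apply/eqP; rewrite eq_le outer_measure_ge0 andbT.
apply/lee_addgt0Pr => e e0; rewrite add0e.
have [t Ht] : exists t : nat, (2 * r) ^+ n / e < t%:R by eexists; exact: truncnS_gt.
have t0 : (0 : R) < t%:R.
  by rewrite (le_lt_trans _ Ht)// divr_ge0 ?exprn_ge0 ?mulr_ge0 ?(ltW e0).
have [q [q0 _ Hq]] := Z0 t.
pose ks := enum (hit_cells q Z).
pose Q i := nth None (map (@cell_obox q) ks) i.
have QZ : box_cover Z Q.
  move=> z Zz; have [k kz] := cube_cell r0 q0 (Zc _ Zz).
  have kks : k \in ks by rewrite mem_enum inE; apply/asboolP; exists z.
  exists (index k ks) => //; rewrite /Q (nth_map k) ?index_mem// nth_index//.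
  by rewrite cell_oboxE.
apply: le_trans (ereal_inf_lbound (imageP _ QZ)) _.
have Q0 i : (0 <= obox_volume (Q i))%E.
  case: (Q i) => [ab|] //=; rewrite lee_fin; apply: prodr_ge0 => j _.
  by rewrite le_max lexx.
rewrite (@nneseries_split _ _ 0 (size ks)) ?add0n// [X in (_ + X)%E]eseries0; last first.
  by move=> i ki _; rewrite /Q nth_default// size_map.
rewrite adde0 big_mkord.
rewrite (eq_bigr (fun=> ((2 * r / q%:R) ^+ n)%:E)); last first.
  move=> i _.
  by rewrite /Q (nth_map (tnth (in_tuple ks) i))// cell_volume.
rewrite sumEFin lee_fin sumr_const card_ord -[leLHS]mulr_natl /ks -cardE.
rewrite expr_div_n mulrA ler_pdivrMr ?exprn_gt0 ?ltr0n//.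
move: Ht; rewrite ltr_pdivrMr// => /ltW Ht.
have {}Hq : #|hit_cells q Z|%:R * t%:R <= q%:R ^+ n :> R by rewrite -natrX -natrM ler_nat.
rewrite -(ler_pM2r t0); set H := #|_|%:R in Hq *; set a := (2 * r) ^+ n in Ht *.
have -> : H * a * t%:R = a * (H * t%:R) by ring.
have -> : e * q%:R ^+ n * t%:R = t%:R * e * q%:R ^+ n by ring.
by apply: ler_pM => //; rewrite ?mulr_ge0// exprn_ge0// mulr_ge0.
Qed.

(** A cube of side rho contains a proportion of the cells that does not depend on
    the grid. *)
Lemma grid_null_dense_compl Z x (rho : R) : grid_null Z -> cube c r x -> 0 < rho ->
  exists y, [/\ cube c r y, `|y - x| <= rho & ~ Z y].
Proof.
have close (a b k : nat) : (b < k)%N -> [/\ (a + b <= a + k)%N, (a - b <= a + k)%N,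
    (a < a + b + k)%N & (a < a - b + k)%N] by split; lia.
move=> Z0 cx rho0; apply: contrapT => H.
have {}H y : cube c r y -> `|y - x| <= rho -> Z y.
  by move=> cy yx; apply: contrapT => nZ; apply: H; exists y.
have [M' HM'] : exists M : nat, 2 * r / rho < M%:R by eexists; exact: truncnS_gt.
pose M := M'.+2; have HM : 2 * r / M%:R <= rho.
  rewrite ler_pdivrMr// -ler_pdivrMl// mulrC.
  by rewrite (le_trans (ltW HM'))// ler_nat /M; lia.
have [q [q0 tq Hq]] := Z0 ((2 * M) ^ n + M)%N.
have qR : (0 : R) < q%:R by rewrite ltr0n.
(* Starting from a cell around [x], there is room for K more cells towards the
   centre of the big cube in each coordinate direction. *)
pose K := (q %/ M)%N.
have K0 : (0 < K)%N by rewrite divn_gt0//; apply: leq_trans tq; exact: leq_addl.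
have KMq : (K * M <= q)%N by exact: leq_divM.
have qK : (q <= 2 * M * K)%N by have := ltn_ceil q (ltn0Sn _ : 0 < M)%N; rewrite -/K; nia.
have [j jx] := cube_cell r0 q0 cx.
have kP (u : {ffun 'I_n -> 'I_K}) i :
    ((if (2 * j i < q)%N then j i + u i else j i - u i) < q)%N.
  have := ltn_ord (u i); have := ltn_ord (j i); case: ifP; rewrite /M in KMq; nia.
pose k u : {ffun 'I_n -> 'I_q} := [ffun i => Ordinal (kP u i)].
have kinj : injective k.
  move=> u v /ffunP uv; apply/ffunP => i; have := uv i; rewrite !ffunE.
  move=> /(congr1 val) /= E; apply/val_inj => /=; move: E.
  have := ltn_ord (u i); have := ltn_ord (v i); have := ltn_ord (j i).
  by case: ifP; rewrite /M in KMq; nia.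
have kZ u : k u \in hit_cells q Z.
  rewrite inE; apply/asboolP.
  pose y : 'rV[R]_n := \row_i (c 0 i - r + 2 * r * (k u i)%:R / q%:R).
  have ky : cell c r (k u) y.
    move=> i; rewrite !mxE lexx /= lerD2l ler_wpM2r ?invr_ge0 ?(ltW qR)//.
    by rewrite ler_wpM2l ?mulr_ge0// ler_nat.
  exists y => //; apply: H; first exact: cell_cube ky.
  apply: row_norm_le; first exact: ltW.
  move=> i; apply: le_trans HM; rewrite !mxE.
  have /andP[x1 x2] := jx i.
  have KR : K%:R * (2 * r) / q%:R <= 2 * r / M%:R.
    rewrite ler_pdivrMr// [leRHS]mulrAC ler_pdivlMr// [leLHS]mulrAC [leRHS]mulrC.
    by rewrite ler_wpM2r ?mulr_ge0// -natrM ler_nat.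
  apply: le_trans KR.
  have Ei (a b : R) : a * (2 * r) / q%:R - b * (2 * r) / q%:R = (a - b) * (2 * r) / q%:R.
    by rewrite -!mulrBl.
  have sc (a b : R) : a <= b -> a * (2 * r) / q%:R <= b * (2 * r) / q%:R.
    by move=> ab; rewrite ler_wpM2r ?invr_ge0 ?(ltW qR)// ler_wpM2r// mulr_ge0.
  rewrite ![2 * r * _]mulrC in x1 x2 *.
  have k1 : ((k u i)%:R : R) <= (j i)%:R + K%:R.
    rewrite -natrD ler_nat ffunE /=.
    by have [? ? ? ?] := close (j i) (u i) K (ltn_ord _); case: ifP.
  have k2 : ((j i).+1%:R : R) <= (k u i)%:R + K%:R.
    rewrite -natrD ler_nat ffunE /=.
    by have [? ? ? ?] := close (j i) (u i) K (ltn_ord _); case: ifP.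
  have := sc _ _ k1; have := sc _ _ k2; rewrite !mulrDl => h2 h1.
  rewrite ler_norml; apply/andP; split; lra.
have : (K ^ n <= #|hit_cells q Z|)%N.
  have := card_imset xpredT kinj; rewrite card_ffun !card_ord => <-.
  by apply: subset_leq_card; apply/fintype.subsetP => _ /imsetP[u _ ->].
move=> HK; have := leq_trans (leq_mul HK (leqnn _)) Hq.
have : (q ^ n <= (2 * M) ^ n * K ^ n)%N by rewrite -expnMn; elim: (n) => // p IH; rewrite !expnS leq_mul.
have : (0 < K ^ n)%N by rewrite expn_gt0 K0.
move: (K ^ n)%N ((2 * M) ^ n)%N (q ^ n)%N => a b e; rewrite /M; nia.
Qed.

End grid_null_sets.

Section measure_zero_sets.
Context {R : realType} {n : nat} (X : closed_manifold R n).

Lemma lebesgue_null_measurable (Z : set 'rV[R]_n) : lebesgue_outer Z = 0%E ->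
  measurable (Z : set (rV_lebesgue R n)).
Proof.
move=> Z0; apply: le_caratheodory_measurable => Y.
have YZ : lebesgue_outer (Y `&` Z) = 0%E.
  apply/eqP; rewrite eq_le outer_measure_ge0 andbT -Z0.
  by apply: le_outer_measure; exact: subIsetr.
rewrite [X in (X + _)%E]YZ add0e; apply: le_outer_measure; exact: subIsetl.
Qed.

(** Subsets of null sets being measurable, every function is measurable on a null
    set. *)
Lemma integral_lebesgue_null (Z : set 'rV[R]_n) (f : 'rV[R]_n -> \bar R) :
  lebesgue_outer Z = 0%E -> (\int[lebesgueN]_(x in Z) f x = 0)%E.
Proof.
move=> Z0; apply: null_set_integral => //; first exact: lebesgue_null_measurable.
move=> _ Y mY; apply: lebesgue_null_measurable.
apply/eqP; rewrite eq_le outer_measure_ge0 andbT -[leRHS]Z0.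
by apply: le_outer_measure; exact: subIsetl.
Qed.

Lemma measure_zero_cover (A : set X) (c : nat -> chart R n X) (Z : nat -> set 'rV[R]_n) :
  (forall k, [/\ atlas X (c k), Z k `<=` cod (c k) & lebesgue_outer (Z k) = 0%E]) ->
  A `<=` \bigcup_k (psi (c k) @` Z k) -> measure_zero A.
Proof.
move=> cZ AZ g; apply/eqP; rewrite eq_le; apply/andP; split.
  apply: ereal_inf_lbound; exists (fun k => (c k, Z k)).
    split=> // k; have [ck Zk Zk0] := cZ k; split=> //.
    exact: lebesgue_null_measurable.
  by apply: eseries0 => k _ _ /=; apply: integral_lebesgue_null; have [] := cZ k.
apply: le_ereal_inf_tmp => _ [P [PA _] <-]; apply: nneseries_ge0 => k _ _.
by apply: integral_ge0 => x _; rewrite lee_fin sqrtr_ge0.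
Qed.

End measure_zero_sets.

(** * Christoffel symbols under linear algebra *)

Section christoffel_algebra.
Context {R : realFieldType} {n : nat}.
Implicit Types (J G : 'M[R]_n) (v : 'rV[R]_n).

(** The algebra of a change of coordinates at one point: [J] is the Jacobian
    matrix, [S] its derivative, [G], [G'] are the Gram matrices, [dG], [dG'] their
    derivatives and [v], [v'] the components of a covector. *)
Variables (J G G' : 'M[R]_n) (S dG dG' : 'I_n -> 'I_n -> 'I_n -> R) (v v' : 'rV[R]_n).
Hypotheses (S_sym : forall i j a, S i j a = S j i a) (G_sym : G^T = G).
Hypotheses (J_unit : J \in unitmx) (G_unit : G \in unitmx).
Hypotheses (G'E : G' = J *m G *m J^T) (v'E : v' = v *m J^T).
Hypothesis dG'E : forall l i j, dG' l i j =
  \sum_a \sum_b (S l i a * J j b * G a b + J i a * S l j b * G a b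
                 + \sum_c J i a * J j b * J l c * dG c a b).

Definition christoffel_sum (D : 'I_n -> 'I_n -> 'I_n -> R) (l i j : 'I_n) : R :=
  D i j l + D j i l - D l i j.

Let P l i j := \sum_a \sum_b S l i a * J j b * G a b.

Let T3 (F : 'I_n -> 'I_n -> 'I_n -> R) i j l :=
  \sum_a \sum_b \sum_c J i a * J j b * J l c * F a b c.

Let G_symE a b : G a b = G b a. Proof. by rewrite -[in LHS]G_sym mxE. Qed.

Let dG'_PT l i j : dG' l i j = P l i j + P l j i + T3 (fun a b c => dG c a b) i j l.
Proof.
rewrite dG'E /P /T3 [X in _ + X + _]exchange_big -!big_split /=; apply: eq_bigr => a _.
rewrite -!big_split /=; apply: eq_bigr => b _; congr (_ + _ + _).
by rewrite (G_symE b a) [J i a * _]mulrC.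
Qed.

Let T3_swap F i j l : T3 F i l j = T3 (fun a b c => F a c b) i j l.
Proof.
rewrite /T3; apply: eq_bigr => a _; rewrite exchange_big /=; apply: eq_bigr => b _.
by apply: eq_bigr => c _; congr (_ * _); rewrite mulrAC.
Qed.

Let T3_swap1 F i j l : T3 F j i l = T3 (fun a b c => F b a c) i j l.
Proof.
rewrite /T3 exchange_big /=; apply: eq_bigr => a _; apply: eq_bigr => b _.
by apply: eq_bigr => c _; congr (_ * _ * _); rewrite mulrC.
Qed.

Let P_sym l i j : P l i j = P i l j.
Proof. by apply: eq_bigr => a _; apply: eq_bigr => b _; rewrite S_sym. Qed.

(** The terms with second derivatives of the transition map cancel but for one
    pair, thanks to the symmetry of [S]; the others permute indices only. *)
Lemma christoffel_sum_transition l i j : christoffel_sum dG' l i j =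
  2 * P i j l + T3 (fun a b c => christoffel_sum dG c a b) i j l.
Proof.
rewrite /christoffel_sum !dG'_PT.
rewrite (T3_swap _ i j l) (_ : T3 _ j l i =
    T3 (fun a b c => dG a b c) i j l); last by rewrite T3_swap T3_swap1.
have -> : T3 (fun a b c => dG a b c + dG b a c - dG c a b) i j l =
    T3 (fun a b c => dG a b c) i j l + T3 (fun a b c => dG b a c) i j l
    - T3 (fun a b c => dG c a b) i j l.
  rewrite /T3 -sumrN -!big_split /=; apply: eq_bigr => a _.
  rewrite -sumrN -!big_split /=; apply: eq_bigr => b _.
  by rewrite -sumrN -!big_split /=; apply: eq_bigr => c _; ring.
rewrite (P_sym i l j) (P_sym j l i) (P_sym j i l); ring.
Qed.

Lemma christoffel_contraction (D : 'I_n -> 'I_n -> 'I_n -> R) (H : 'M[R]_n) (u : 'rV[R]_n) i j :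
  \sum_k (2^-1 * \sum_l invmx H k l * christoffel_sum D l i j) * u 0 k =
  2^-1 * \sum_l (u *m invmx H) 0 l * christoffel_sum D l i j.
Proof.
transitivity (2^-1 * \sum_k \sum_l u 0 k * invmx H k l * christoffel_sum D l i j).
  rewrite mulr_sumr; apply: eq_bigr => k _; rewrite mulr_sumr mulr_suml mulr_sumr.
  by apply: eq_bigr => l _; ring.
congr (_ * _); rewrite exchange_big; apply: eq_bigr => l _.
by rewrite mxE mulr_suml.
Qed.

Let G'_inv : invmx G' = invmx J^T *m invmx G *m invmx J.
Proof.
have JT : J^T \in unitmx by rewrite unitmx_tr.
have JG : J *m G \in unitmx by rewrite unitmx_mul J_unit.
have G'u : G' \in unitmx by rewrite G'E unitmx_mul JG.
apply: (can_inj (mulKmx G'u)); rewrite mulmxV// {1}G'E -!mulmxA.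
by rewrite (mulKVmx JT) (mulKVmx G_unit) mulmxV.
Qed.

Let sharpJ : v' *m invmx G' *m J = v *m invmx G.
Proof.
have JT : J^T \in unitmx by rewrite unitmx_tr.
by rewrite G'_inv v'E -!mulmxA mulVmx// mulmx1 (mulKVmx JT).
Qed.

(** The inhomogeneous term is the one by which the Hessian fails to be a tensor. *)
Lemma christoffel_transition i j :
  \sum_k (2^-1 * \sum_l invmx G' k l * christoffel_sum dG' l i j) * v' 0 k =
  \sum_a v 0 a * S i j a +
  \sum_a \sum_b J i a * J j b *
     \sum_k (2^-1 * \sum_l invmx G k l * christoffel_sum dG l a b) * v 0 k.
Proof.
rewrite christoffel_contraction; set w' := v' *m _.
under [X in _ = _ + X]eq_bigr do under eq_bigr do rewrite christoffel_contraction.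
set w := v *m _.
have wE c : \sum_l w' 0 l * J l c = w 0 c by rewrite /w -sharpJ [RHS]mxE.
have wG a : \sum_b w 0 b * G a b = v 0 a.
  have -> : v 0 a = (w *m G) 0 a by rewrite /w mulmxKV.
  by rewrite mxE; apply: eq_bigr => b _; rewrite G_symE.
under [X in _ * X = _]eq_bigr do rewrite christoffel_sum_transition mulrDr.
rewrite big_split mulrDr; congr (_ + _).
  rewrite mulr_sumr.
  transitivity (\sum_l \sum_a \sum_b w' 0 l * J l b * (S i j a * G a b)).
    apply: eq_bigr => l _; rewrite mulrCA mulKf ?pnatr_eq0//.
    rewrite /P !mulr_sumr; apply: eq_bigr => a _; rewrite mulr_sumr.
    by apply: eq_bigr => b _; ring.
  rewrite exchange_big; apply: eq_bigr => a _; rewrite exchange_big.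
  rewrite -wG mulr_suml; apply: eq_bigr => b _.
  by rewrite -mulr_suml wE; ring.
rewrite /T3 mulr_sumr.
transitivity (\sum_l \sum_a \sum_b \sum_c
    (w' 0 l * J l c) * (2^-1 * (J i a * J j b * christoffel_sum dG c a b))).
  apply: eq_bigr => l _; rewrite !mulr_sumr; apply: eq_bigr => a _.
  rewrite !mulr_sumr; apply: eq_bigr => b _; rewrite !mulr_sumr.
  by apply: eq_bigr => c _; ring.
rewrite exchange_big; apply: eq_bigr => a _; rewrite exchange_big; apply: eq_bigr => b _.
rewrite exchange_big !mulr_sumr; apply: eq_bigr => c _.
by rewrite -mulr_suml wE; ring.
Qed.

Lemma conormal_sq_transition : v' *m invmx G' *m v'^T = v *m invmx G *m v^T.
Proof.
by rewrite {2}v'E trmx_mul trmxK mulmxA sharpJ.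
Qed.

Lemma conormal_hess_transition (H H' : 'M[R]_n) : H' = J *m H *m J^T ->
  \tr (invmx G' *m H' *m invmx G' *m H'^T) = \tr (invmx G *m H *m invmx G *m H^T).
Proof.
move=> ->; have JT : J^T \in unitmx by rewrite unitmx_tr.
rewrite G'_inv !trmx_mul trmxK -!mulmxA (mulKmx J_unit) (mulKVmx JT).
rewrite [LHS]mxtrace_mulC -!mulmxA mulmxV// mulmx1.
by rewrite (mulKmx J_unit).
Qed.

End christoffel_algebra.

(** * Change of charts *)

Lemma sub_cancel (V : zmodType) (a b k z : V) : a - k = z -> a + b - (b + k) = z.
Proof. by move=> <-; rewrite opprD addrA addrK. Qed.

Lemma product3_rule (A : comPzRingType) (a g b da dg db : A) :
  a * g * db + b * (a * dg + g * da) = da * b * g + a * db * g + a * b * dg.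
Proof. ring. Qed.

Section derive_algebra.
Context {R : realType} {n : nat}.
Implicit Types (x v : 'rV[R]_n).

Lemma derivable_sumr p (h : 'I_p -> 'rV[R]_n -> R) x v :
  (forall a, derivable (h a) x v) -> derivable (fun y => \sum_a h a y) x v.
Proof. by move=> dh; rewrite -fct_sumE; exact: derivable_sum. Qed.

Lemma derive_sumr p (h : 'I_p -> 'rV[R]_n -> R) x v :
  (forall a, derivable (h a) x v) ->
  'D_v (fun y => \sum_a h a y) x = \sum_a 'D_v (h a) x.
Proof. by move=> dh; rewrite -fct_sumE derive_sum. Qed.

Lemma derive_mulr (h k : 'rV[R]_n -> R) x v : derivable h x v -> derivable k x v ->
  'D_v (fun y => h y * k y) x = h x * 'D_v k x + k x * 'D_v h x.
Proof. exact: deriveM. Qed.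

Lemma derive_coord (j l : 'I_n) x :
  'D_(ebase l) (fun y : 'rV[R]_n => y 0 j) x = (j == l)%:R.
Proof.
have := @derive_mx R _ 1 n (fun y : 'rV[R]_n => y) x (ebase l) (@derivable_id _ _ _ _).
move=> /(congr1 (fun A : 'rV[R]_n => A 0 j)); rewrite mxE => <-.
by rewrite derive_id mxE eqxx.
Qed.

Lemma derivable_mull (a : R) (h : 'rV[R]_n -> R) x v : derivable h x v ->
  derivable (fun y => a * h y) x v.
Proof. by move=> dh; apply: (@derivableM _ _ (cst a) h) => //; exact: derivable_cst. Qed.

Lemma derive_mull (a : R) (h : 'rV[R]_n -> R) x v : derivable h x v ->
  'D_v (fun y => a * h y) x = a * 'D_v h x.
Proof.
move=> dh; have := @derive_mulr (cst a) h x v (derivable_cst _ _ _) dh.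
by rewrite derive_cst mulr0 addr0.
Qed.

End derive_algebra.

Section chart_change.
Context {R : realType} {n : nat} (X : closed_manifold R n).

Lemma transition_domE (c d : chart R n X) x : transition_dom c d x ->
  [/\ cod d (transition c d x), psi d (transition c d x) = psi c x,
      transition_dom d c (transition c d x) &
      transition d c (transition c d x) = x].
Proof.
move=> [cx dx]; have E : psi d (phi d (psi c x)) = psi c x by rewrite phiK.
split=> //; first exact: phi_cod.
- split; first exact: phi_cod.
  by rewrite /transition /= E; exact: psi_dom.
- by rewrite /transition /= E psiK.
Qed.

Variables (c d : chart R n X).
Hypotheses (cX : atlas X c) (dX : atlas X d).

Let T := transition c d.
Let V := transition_dom c d.
Let oV : open V. Proof. exact: transition_dom_open. Qed.
Let sT : smooth T V. Proof. exact: atlas_smooth. Qed.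

Let DT i a := 'D_(ebase i) (fun y => T y 0 a).

Let sDT i a : smooth (DT i a) V.
Proof. by apply: smooth_derive => k; exact: Ck_coord. Qed.

Let dDT i a x j : V x -> derivable (DT i a) x (ebase j).
Proof. by move=> Vx; apply: Ck_derivable (sDT i a 1) Vx. Qed.

Lemma jacobian_transition x i a : V x -> 'J T x i a = DT i a x.
Proof.
move=> Vx; have dT := C1_differentiable_rV oV Vx (sT 1).
rewrite /jacobian mxE -deriveE// derive_mx ?mxE//.
exact: diff_derivable.
Qed.

Section function.
Variables (f : 'rV[R]_n -> R) (k : 'rV[R]_n -> R) (U : set 'rV[R]_n).
Hypotheses (oU : open U) (TU : forall x, V x -> U (T x)).
Hypothesis kE : forall x, V x -> k x = f (T x).

Let near_kE x : V x -> \forall y \near x, k y = (f \o T) y.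
Proof.
by move=> Vx; apply: filterS kE _; apply: open_nbhs_nbhs.
Qed.

Lemma derive_transition x i : Ck 1 f U -> V x ->
  'D_(ebase i) k x = \sum_a DT i a x * 'D_(ebase a) f (T x).
Proof.
move=> Cf Vx; rewrite (near_eq_derive _ (near_kE Vx)).
exact: (derive_chain oV oU TU i (sT 1) Cf Vx).2.
Qed.

End function.

Section second_order.
Variables (f : 'rV[R]_n -> R) (k : 'rV[R]_n -> R) (U : set 'rV[R]_n).
Hypotheses (oU : open U) (TU : forall x, V x -> U (T x)).
Hypothesis kE : forall x, V x -> k x = f (T x).
Hypothesis Cf : Ck 2 f U.

Let dTf a i x : V x -> derivable ('D_(ebase a) f \o T) x (ebase i) /\
    'D_(ebase i) ('D_(ebase a) f \o T) x =
    \sum_b DT i b x * 'D_(ebase b) ('D_(ebase a) f) (T x).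
Proof. by move=> Vx; exact: (derive_chain oV oU TU i (sT 1) (Ck_derive a Cf) Vx). Qed.

Lemma derive2_transition x i j : V x ->
  'D_(ebase i) ('D_(ebase j) k) x =
  \sum_a (DT j a x * (\sum_b DT i b x * 'D_(ebase b) ('D_(ebase a) f) (T x))
          + 'D_(ebase a) f (T x) * 'D_(ebase i) (DT j a) x).
Proof.
move=> Vx.
have E : \forall y \near x,
    'D_(ebase j) k y = (fun z => \sum_a DT j a z * ('D_(ebase a) f \o T) z) y.
  apply: (@filterS _ (nbhs x) _ V) (fun y => derive_transition oU TU kE j (CkW Cf)) _.
  exact: open_nbhs_nbhs.
rewrite (near_eq_derive _ E) derive_sumr => [|a]; last first.
  by apply: derivableM; [exact: dDT|exact: (dTf a i Vx).1].
apply: eq_bigr => a _; rewrite derive_mulr; [|exact: dDT|exact: (dTf a i Vx).1].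
by rewrite (dTf a i Vx).2.
Qed.

End second_order.

(** The transition in the other direction has the inverse Jacobian matrix. *)
Lemma jacobian_transition_unit x : V x -> 'J T x \in unitmx.
Proof.
move=> Vx; have [cTx _ VTx _] := transition_domE Vx.
have sT' : smooth (transition d c) (transition_dom d c) by exact: atlas_smooth.
pose J' : 'M[R]_n := \matrix_(a, j) 'D_(ebase a) (fun y => transition d c y 0 j) (T x).
suff : 'J T x *m J' = 1%:M by case/mulmx1_unit.
apply/matrixP => i j; rewrite !mxE.
have H := @derive_transition (fun y => transition d c y 0 j) (fun y => y 0 j)
  (transition_dom d c) (transition_dom_open (c:=d) (d:=c)) _ _ x i
  (Ck_coord 0 j (transition_dom_open (c:=d) (d:=c)) (sT' 1)) Vx.
transitivity ('D_(ebase i) (fun y : 'rV[R]_n => y 0 j) x).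
  rewrite H; first by apply: eq_bigr => a _; rewrite jacobian_transition// mxE.
    by move=> y /transition_domE[].
  by move=> y /transition_domE[_ _ _]; rewrite /T => ->.
by rewrite derive_coord eq_sym.
Qed.

Section smooth_function_on_charts.
Variable f : X -> R.
Hypothesis sf : smooth_function f.

Let fTE x : V x -> (f \o psi c) x = (f \o psi d) (T x).
Proof. by move=> /transition_domE[_ E _ _]; rewrite /= E. Qed.

Let Tcod x : V x -> cod d (T x).
Proof. by move=> /transition_domE[]. Qed.

Lemma grad_transition x : V x ->
  grad (f \o psi c) x = grad (f \o psi d) (T x) *m ('J T x)^T.
Proof.
move=> Vx; apply/rowP => i; rewrite !mxE.
rewrite (derive_transition (open_cod d) Tcod fTE i (sf dX 1) Vx).
by apply: eq_bigr => a _; rewrite [_^T _ _]mxE jacobian_transition// mulrC [X in _ = X * _]mxE.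
Qed.

Lemma hess_transition x i j : V x ->
  hess (f \o psi c) x i j =
  ('J T x *m hess (f \o psi d) (T x) *m ('J T x)^T) i j +
  \sum_a grad (f \o psi d) (T x) 0 a * 'D_(ebase i) (DT j a) x.
Proof.
move=> Vx; rewrite [LHS]mxE.
rewrite (derive2_transition (open_cod d) Tcod fTE (sf dX 2) i j Vx) big_split.
congr (_ + _); last by apply: eq_bigr => a _; rewrite [in RHS]mxE.
rewrite [RHS]mxE; apply: eq_bigr => a _; rewrite mulrC [_^T _ _]mxE.
rewrite [in RHS](jacobian_transition _ _ Vx); congr (_ * _); rewrite [RHS]mxE.
by apply: eq_bigr => b _; rewrite jacobian_transition// [X in _ = _ * X]mxE.
Qed.

(** At a critical point the Hessian is a bilinear form on the tangent space. *)
Lemma nondegenerate_transition x : V x -> grad (f \o psi d) (T x) = 0 ->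
  hess (f \o psi d) (T x) \in unitmx -> hess (f \o psi c) x \in unitmx.
Proof.
move=> Vx g0 hu.
have -> : hess (f \o psi c) x = 'J T x *m hess (f \o psi d) (T x) *m ('J T x)^T.
  apply/matrixP => i j; rewrite hess_transition// g0 big1 ?addr0// => a _.
  by rewrite mxE mul0r.
by rewrite !unitmx_mul unitmx_tr hu !andbT jacobian_transition_unit.
Qed.

Section metric.
Variable g : riemannian_metric X.

Lemma gram_unit (e : chart R n X) x : atlas X e -> cod e x -> g e x \in unitmx.
Proof.
move=> eX ex; rewrite unitmxE unitfE; apply/det0P => -[v v0 vg].
by have := gram_pos g eX ex v0; rewrite vg mul0mx mxE ltxx.
Qed.

Let Gd a b := fun y => g d y a b.

Let CGd a b k : Ck k (Gd a b) (cod d).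
Proof. by apply: Ck_coord (open_cod d) _; exact: gram_smooth. Qed.

Let gramE x i j : V x ->
  g c x i j = \sum_a \sum_b DT i a x * Gd a b (T x) * DT j b x.
Proof.
move=> Vx; rewrite (gram_transition g cX dX Vx) mxE [RHS]exchange_big.
apply: eq_bigr => b _; rewrite [_^T _ _]mxE [X in X * _ = _]mxE mulr_suml.
by apply: eq_bigr => a _; rewrite !jacobian_transition.
Qed.

Let derive_gram x l i j : V x -> 'D_(ebase l) (fun y => g c y i j) x =
  \sum_a \sum_b ('D_(ebase l) (DT i a) x * DT j b x * Gd a b (T x)
    + DT i a x * 'D_(ebase l) (DT j b) x * Gd a b (T x)
    + \sum_e DT i a x * DT j b x * DT l e x * 'D_(ebase e) (Gd a b) (T x)).
Proof.
move=> Vx.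
have E : \forall y \near x, g c y i j =
    (fun z => \sum_a \sum_b DT i a z * (Gd a b \o T) z * DT j b z) y.
  apply: (@filterS _ (nbhs x) _ V) (fun y => @gramE y i j) _; exact: open_nbhs_nbhs.
have dG a b := derive_chain oV (open_cod d) Tcod l (sT 1) (CGd a b 1) Vx.
have dM a b : derivable (fun y => DT i a y * (Gd a b \o T) y) x (ebase l).
  by apply: derivableM; [exact: dDT | exact: (dG a b).1].
have dMM a b : derivable (fun y => DT i a y * (Gd a b \o T) y * DT j b y) x (ebase l).
  by apply: derivableM; [exact: dM | exact: dDT].
rewrite (near_eq_derive _ E) derive_sumr => [|a]; last exact: derivable_sumr.
apply: eq_bigr => a _; rewrite derive_sumr//; apply: eq_bigr => b _.
rewrite derive_mulr//; last exact: dDT.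
rewrite derive_mulr; [|exact: dDT|exact: (dG a b).1].
rewrite (dG a b).2 /=.
under [X in _ = _ + X]eq_bigr do rewrite -mulrA.
rewrite -mulr_sumr; exact: product3_rule.
Qed.

Let T_swap x i j a : V x -> 'D_(ebase i) (DT j a) x = 'D_(ebase j) (DT i a) x.
Proof. by move=> Vx; apply: (derive_swap i j oV Vx); exact: Ck_coord. Qed.

Let G_sym x : V x -> (g d (T x))^T = g d (T x).
Proof. by move=> /Tcod; exact: gram_sym. Qed.

Let grad_trans x : V x ->
  grad (f \o psi c) x = grad (f \o psi d) (T x) *m ('J T x)^T.
Proof. exact: grad_transition. Qed.

(** The inhomogeneous terms of [hess_transition] and of the Christoffel symbols
    are the same and cancel. *)
Lemma cov_hess_transition x : V x -> cov_hess (g c) (f \o psi c) x =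
  'J T x *m cov_hess (g d) (f \o psi d) (T x) *m ('J T x)^T.
Proof.
move=> Vx; apply/matrixP => i j; rewrite [LHS]mxE hess_transition//.
rewrite [X in _ - X](@christoffel_transition _ _ ('J T x) (g d (T x)) (g c x)
  (fun i j a => 'D_(ebase i) (DT j a) x)
  (fun e a b => 'D_(ebase e) (Gd a b) (T x))
  (fun l i j => 'D_(ebase l) (fun y => g c y i j) x)
  (grad (f \o psi d) (T x))); last first.
- by move=> l i' j'; rewrite derive_gram//;
    apply: eq_bigr => a _; apply: eq_bigr => b _; rewrite !jacobian_transition//;
    congr (_ + _); apply: eq_bigr => e _; rewrite jacobian_transition.
- exact: grad_trans.
- exact: gram_transition.
- by apply: gram_unit => //; exact: Tcod.
- exact: jacobian_transition_unit.
- exact: G_sym.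
- by move=> i' j' a; exact: T_swap.
apply: sub_cancel.
pose K : 'M[R]_n := \matrix_(a, b) \sum_k christoffel (g d) (T x) k a b *
  grad (f \o psi d) (T x) 0 k.
have -> : cov_hess (g d) (f \o psi d) (T x) = hess (f \o psi d) (T x) - K.
  by apply/matrixP => a b; rewrite !mxE.
rewrite mulmxBr mulmxBl [RHS]mxE; congr (_ + _).
rewrite [RHS]mxE; congr (- _); rewrite [RHS]mxE [LHS]exchange_big.
apply: eq_bigr => b _; rewrite [_^T _ _]mxE [X in _ = X * _]mxE mulr_suml.
by apply: eq_bigr => a _; rewrite [K _ _]mxE [RHS]mulrAC.
Qed.

Lemma cov_norm_transition x (i : 'I_3) : V x ->
  cov_norm i (g c) (f \o psi c) x = cov_norm i (g d) (f \o psi d) (T x).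
Proof.
move=> Vx; have Gd_unit : g d (T x) \in unitmx by apply: gram_unit => //; exact: Tcod.
have J_unit := jacobian_transition_unit Vx.
have GE := gram_transition g cX dX Vx.
rewrite /cov_norm; case: (val i) => [|[|_]]; first by rewrite fTE.
- by rewrite (conormal_sq_transition J_unit Gd_unit GE (grad_trans Vx)).
- by rewrite (conormal_hess_transition J_unit Gd_unit GE (cov_hess_transition Vx)).
Qed.

End metric.
End smooth_function_on_charts.
End chart_change.

(** * Linear families of functions and smallness in the C^2-norm *)

Lemma cvg_eqr (R : realType) (T : Type) (F : set_system T) (f : T -> R) (a b : R) :
  a = b -> f @ F --> a -> f @ F --> b.
Proof. by move=> ->. Qed.

Section entrywise_convergence.
Context {R : realType} {T : Type} {F : set_system T} {FF : Filter F}.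

Lemma cvg_prodr (I : Type) (r : seq I) (P : pred I) (f : I -> T -> R) (a : I -> R) :
  (forall i, P i -> f i x @[x --> F] --> a i) ->
  \prod_(i <- r | P i) f i x @[x --> F] --> \prod_(i <- r | P i) a i.
Proof.
move=> fa; elim: r => [|i r IH].
  rewrite big_nil; under eq_fun do rewrite big_nil; exact: cvg_cst.
rewrite big_cons; under eq_fun do rewrite big_cons.
by case: ifP => // Pi; apply: cvgM => //; exact: fa.
Qed.

Definition entries_cvg p q (A : T -> 'M[R]_(p, q)) (B : 'M[R]_(p, q)) :=
  forall i j, A x i j @[x --> F] --> B i j.

Lemma entries_cvg_mulmx p q s (A : T -> 'M[R]_(p, q)) (B : T -> 'M[R]_(q, s)) A0 B0 :
  entries_cvg A A0 -> entries_cvg B B0 -> entries_cvg (fun x => A x *m B x) (A0 *m B0).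
Proof.
move=> AA BB i j; rewrite mxE; under eq_fun do rewrite mxE.
by apply: cvg_sumr => k _; apply: cvgM.
Qed.

Lemma entries_cvg_trmx p q (A : T -> 'M[R]_(p, q)) A0 :
  entries_cvg A A0 -> entries_cvg (fun x => (A x)^T) A0^T.
Proof. by move=> AA i j; rewrite mxE; under eq_fun do rewrite mxE; exact: AA. Qed.

Lemma entries_cvg_det p (A : T -> 'M[R]_p) A0 :
  entries_cvg A A0 -> \det (A x) @[x --> F] --> \det A0.
Proof.
move=> AA; apply: cvg_sumr => s _; apply: cvgM; first exact: cvg_cst.
by apply: cvg_prodr => i _.
Qed.

Lemma entries_cvg_invmx p (A : T -> 'M[R]_p) A0 : A0 \in unitmx ->
  entries_cvg A A0 -> entries_cvg (fun x => invmx (A x)) (invmx A0).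
Proof.
move=> uA AA i j; have cdet := entries_cvg_det AA.
have d0 : \det A0 != 0 by rewrite -unitfE -unitmxE.
have E : \forall x \near F, (\det (A x))^-1 * \adj (A x) i j = invmx (A x) i j.
  have : \forall x \near F, \det (A x) != 0 by exact: cvgr_neq0 cdet d0.
  by apply: filterS => x dx; rewrite /invmx unitmxE unitfE dx [RHS]mxE.
apply: cvg_trans (near_eq_cvg E) _.
have -> : invmx A0 i j = (\det A0)^-1 * \adj A0 i j by rewrite /invmx uA mxE.
apply: cvgM; first exact: cvgV.
rewrite mxE; under eq_fun do rewrite mxE.
apply: cvgM; first exact: cvg_cst.
by apply: entries_cvg_det => k l; rewrite !mxE; under eq_fun do rewrite !mxE; exact: AA.
Qed.

End entrywise_convergence.

Section linear_family.
Context {R : realType} {n p q : nat}.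
Variables (u0 : 'rV[R]_n -> R) (u : 'I_p -> 'I_q -> 'rV[R]_n -> R) (U : set 'rV[R]_n).
Hypotheses (oU : open U) (Cu0 : Ck 2 u0 U) (Cu : forall k l, Ck 2 (u k l) U).

(** The perturbed functions in a chart. They are linear in the parameter, which
    gives the joint continuity of their derivatives in it and in the point. *)
Definition family (a : 'M[R]_(p, q)) (y : 'rV[R]_n) : R :=
  u0 y + \sum_k \sum_l a k l * u k l y.

Let derive_lin (v0 : 'rV[R]_n -> R) (v : 'I_p -> 'I_q -> 'rV[R]_n -> R)
    (a : 'M[R]_(p, q)) i x :
  derivable v0 x (ebase i) -> (forall k l, derivable (v k l) x (ebase i)) ->
  'D_(ebase i) (fun y => v0 y + \sum_k \sum_l a k l * v k l y) x =
  'D_(ebase i) v0 x + \sum_k \sum_l a k l * 'D_(ebase i) (v k l) x.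
Proof.
move=> D0 D.
have DM k l : derivable (fun y => a k l * v k l y) x (ebase i) by exact: derivable_mull.
have DS k : derivable (fun y => \sum_l a k l * v k l y) x (ebase i).
  exact: derivable_sumr.
rewrite (@deriveD _ _ _ v0 (fun y => \sum_k \sum_l a k l * v k l y))//; last exact: derivable_sumr.
congr (_ + _); rewrite derive_sumr//; apply: eq_bigr => k _.
by rewrite derive_sumr//; apply: eq_bigr => l _; exact: derive_mull.
Qed.

Lemma derive_family a i x : U x -> 'D_(ebase i) (family a) x =
  'D_(ebase i) u0 x + \sum_k \sum_l a k l * 'D_(ebase i) (u k l) x.
Proof.
move=> Ux; apply: derive_lin => [|k l]; first exact: Ck_derivable Cu0 Ux.
exact: Ck_derivable (Cu k l) Ux.
Qed.

Lemma derive2_family a i j x : U x ->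
  'D_(ebase i) ('D_(ebase j) (family a)) x = 'D_(ebase i) ('D_(ebase j) u0) x +
  \sum_k \sum_l a k l * 'D_(ebase i) ('D_(ebase j) (u k l)) x.
Proof.
move=> Ux.
have E : \forall y \near x, 'D_(ebase j) (family a) y =
    (fun z => 'D_(ebase j) u0 z + \sum_k \sum_l a k l * 'D_(ebase j) (u k l) z) y.
  apply: (@filterS _ (nbhs x) _ U) (fun y => @derive_family a j y) _.
  exact: open_nbhs_nbhs.
rewrite (near_eq_derive _ E); apply: derive_lin => [|k l].
  exact: Ck_derivable (Ck_derive j Cu0) Ux.
exact: Ck_derivable (Ck_derive j (Cu k l)) Ux.
Qed.

Section joint_continuity.
Variables (x0 : 'rV[R]_n) (a0 : 'M[R]_(p, q)).
Hypothesis Ux0 : U x0.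

Let F := filter_prod (nbhs x0) (nbhs a0).

Let F_filter : ProperFilter F. Proof. exact: filter_prod_proper. Qed.

Lemma near_fst_open : \forall z \near F, U z.1.
Proof. by apply: cvg_fst; exact: open_nbhs_nbhs. Qed.

Lemma cvg_fst_continuous (v : 'rV[R]_n -> R) : {in U, continuous v} ->
  v z.1 @[z --> F] --> v x0.
Proof.
by move=> cv; apply: (@cvg_comp _ _ _ fst v F (nbhs x0)); [exact: cvg_fst|exact/cv/mem_set].
Qed.

Let cvg_lin (v0 : 'rV[R]_n -> R) (v : 'I_p -> 'I_q -> 'rV[R]_n -> R) :
  {in U, continuous v0} -> (forall k l, {in U, continuous (v k l)}) ->
  (fun z : 'rV[R]_n * 'M[R]_(p, q) =>
     v0 z.1 + \sum_k \sum_l z.2 k l * v k l z.1 : R) @ F -->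
  (v0 x0 + \sum_k \sum_l a0 k l * v k l x0 : R).
Proof.
move=> cv0 cv; apply: cvgD; first exact: cvg_fst_continuous.
apply: (@cvg_sumr R _ F _ _ _ _
  (fun k (z : 'rV[R]_n * 'M[R]_(p, q)) => \sum_l z.2 k l * v k l z.1)) => k _.
apply: cvg_sumr => l _; apply: cvgM; last exact: cvg_fst_continuous.
apply: (@cvg_comp _ _ _ snd (fun a : 'M[R]_(p, q) => a k l) F (nbhs a0) (nbhs (a0 k l))).
  exact: cvg_snd.
exact: coord_continuous.
Qed.

Lemma family_cvg : family z.2 z.1 @[z --> F] --> family a0 x0.
Proof.
apply: (@cvg_lin u0 u) => [|k l]; [exact: Ck_continuous Cu0|exact: Ck_continuous (Cu k l)].
Qed.

Lemma derive_family_cvg i :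
  'D_(ebase i) (family z.2) z.1 @[z --> F] --> 'D_(ebase i) (family a0) x0.
Proof.
rewrite derive_family//.
have E : \forall z \near F, 'D_(ebase i) u0 z.1 +
    \sum_k \sum_l (z.2 : 'M[R]_(p, q)) k l * 'D_(ebase i) (u k l) z.1
    = 'D_(ebase i) (family z.2) z.1.
  by apply: filterS near_fst_open => z dz; rewrite derive_family.
apply: cvg_trans (near_eq_cvg E) _.
apply: (@cvg_lin ('D_(ebase i) u0) (fun k l => 'D_(ebase i) (u k l))) => [|k l].
  exact: Ck_continuous (Ck_derive i Cu0).
exact: Ck_continuous (Ck_derive i (Cu k l)).
Qed.

Lemma derive2_family_cvg i j : 'D_(ebase i) ('D_(ebase j) (family z.2)) z.1
  @[z --> F] --> 'D_(ebase i) ('D_(ebase j) (family a0)) x0.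
Proof.
rewrite derive2_family//.
have E : \forall z \near F, 'D_(ebase i) ('D_(ebase j) u0) z.1 +
    \sum_k \sum_l (z.2 : 'M[R]_(p, q)) k l * 'D_(ebase i) ('D_(ebase j) (u k l)) z.1
    = 'D_(ebase i) ('D_(ebase j) (family z.2)) z.1.
  by apply: filterS near_fst_open => z dz; rewrite derive2_family.
apply: cvg_trans (near_eq_cvg E) _.
apply: (@cvg_lin ('D_(ebase i) ('D_(ebase j) u0))
  (fun k l => 'D_(ebase i) ('D_(ebase j) (u k l)))) => [|k l].
  exact: Ck_continuous (Ck_derive i (Ck_derive j Cu0)).
exact: Ck_continuous (Ck_derive i (Ck_derive j (Cu k l))).
Qed.

End joint_continuity.
End linear_family.

Section C2_small.
Context {R : realType} {n p q : nat} (X : closed_manifold R n).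
Variable g : riemannian_metric X.
Variable h : 'I_p -> 'I_q -> X -> R.
Hypothesis sh : forall k l, smooth_function (h k l).

Definition combination (a : 'M[R]_(p, q)) (x : X) : R :=
  \sum_k \sum_l a k l * h k l x.

Lemma combination_smooth a : smooth_function (combination a).
Proof.
move=> c cX k; have oc := open_cod c.
apply: (@Ck_sum R n R k _ _ _
  (fun i x => \sum_l a i l * h i l (psi c x))) => // i _.
by apply: Ck_sum => // l _; apply: CkMl => //; exact: (sh i l cX).
Qed.

Section local.
Variables (d : chart R n X) (x0 : 'rV[R]_n).
Hypotheses (dX : atlas X d) (dx0 : cod d x0).

Let od := open_cod d.

Let u0 : 'rV[R]_n -> R := fun=> 0.
Let u k l := h k l \o psi d.

Let Cu0 : Ck 2 u0 (cod d). Proof. exact: Ck_cst. Qed.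
Let Cu k l : Ck 2 (u k l) (cod d). Proof. exact: sh. Qed.

Let combE a : combination a \o psi d = family u0 u a.
Proof. by apply/funext => y; rewrite /family add0r. Qed.

Let F := filter_prod (nbhs x0) (nbhs (0 : 'M[R]_(p, q))).

Let F_filter : ProperFilter F. Proof. exact: filter_prod_proper. Qed.

Let near_codF : \forall z \near F, cod d z.1.
Proof. exact: near_fst_open. Qed.

Let sum0 (v : 'I_p -> 'I_q -> R) : \sum_k \sum_l (0 : 'M[R]_(p, q)) k l * v k l = 0.
Proof. by rewrite big1// => k _; rewrite big1// => l _; rewrite mxE mul0r. Qed.

Let grad_cvg0 i : grad (combination z.2 \o psi d) z.1 0 i @[z --> F] --> (0 : R).
Proof.
under eq_fun do rewrite combE mxE.
refine (cvg_eqr _ (derive_family_cvg od Cu0 Cu dx0 (i:=i))).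
by rewrite (derive_family Cu0 Cu)// sum0 addr0 derive_cst.
Qed.

Let hess_cvg0 i j : hess (combination z.2 \o psi d) z.1 i j @[z --> F] --> (0 : R).
Proof.
under eq_fun do rewrite combE mxE.
refine (cvg_eqr _ (derive2_family_cvg od Cu0 Cu dx0 (i:=i) (j:=j))).
rewrite (derive2_family od Cu0 Cu)// sum0 addr0.
rewrite (_ : 'D_(ebase j) u0 = fun=> 0) ?derive_cst//.
by apply/funext => y; rewrite derive_cst.
Qed.

Let invgram_cvg : @entries_cvg R _ F n n (fun z => invmx (g d z.1)) (invmx (g d x0)).
Proof.
apply: entries_cvg_invmx; first exact: gram_unit.
move=> i j; apply: (@cvg_fst_continuous _ _ _ _ (cod d) _ _ dx0 (fun y => g d y i j)); apply: (@Ck_continuous _ _ _ 0).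
by apply: Ck_coord => //; exact: gram_smooth.
Qed.

Let christoffel_cvg k i j :
  christoffel (g d) z.1 k i j @[z --> F] --> christoffel (g d) x0 k i j.
Proof.
have H a b e : 'D_(ebase a) (fun y => g d y b e) z.1 @[z --> F] -->
    'D_(ebase a) (fun y => g d y b e) x0.
  apply: (@cvg_fst_continuous _ _ _ _ (cod d) _ _ dx0 ('D_(ebase a) (fun y => g d y b e))).
  apply: (@Ck_continuous _ _ _ 0); apply: Ck_derive.
  by apply: Ck_coord => //; exact: gram_smooth.
apply: cvgM; first exact: cvg_cst.
apply: cvg_sumr => l _; apply: cvgM; first exact: invgram_cvg.
by apply: cvgB; [apply: cvgD|].
Qed.

Let cov_hess_cvg0 :
  @entries_cvg R _ F n n (fun z => cov_hess (g d) (combination z.2 \o psi d) z.1) 0.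
Proof.
move=> i j; rewrite mxE; under eq_fun do rewrite mxE.
apply: (cvg_eqr (subr0 0)); apply: cvgB; first exact: hess_cvg0.
apply: (@cvg_eqr _ _ _ _ (\sum_(k < n) christoffel (g d) x0 k i j * 0)).
  by rewrite big1// => k _; rewrite mulr0.
by apply: cvg_sumr => k _; apply: cvgM; [exact: christoffel_cvg|exact: grad_cvg0].
Qed.

Let cov_norm_cvg0 (i : 'I_3) :
  cov_norm i (g d) (combination z.2 \o psi d) z.1 @[z --> F] --> (0 : R).
Proof.
have grad0 : @entries_cvg R _ F 1 n (fun z => grad (combination z.2 \o psi d) z.1) 0.
  by move=> k j; rewrite ord1 mxE; exact: grad_cvg0.
rewrite /cov_norm; case: (val i) => [|[|_]].
- apply: (cvg_eqr (@normr0 R R)); apply: cvg_norm.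
  under eq_fun do rewrite combE.
  refine (cvg_eqr _ (family_cvg Cu0 Cu dx0)).
  by rewrite /family sum0 addr0.
- apply: (cvg_eqr (@sqrtr0 R)); apply: continuous_cvg; first exact: sqrt_continuous.
  apply: (@cvg_eqr _ _ _ _ (((0 : 'rV[R]_n) *m invmx (g d x0) *m 0^T) 0 0)).
    by rewrite !mul0mx mxE.
  apply: entries_cvg_mulmx; last exact: entries_cvg_trmx.
  exact: entries_cvg_mulmx.
- apply: (cvg_eqr (@sqrtr0 R)); apply: continuous_cvg; first exact: sqrt_continuous.
  apply: (@cvg_eqr _ _ _ _ (\tr (invmx (g d x0) *m 0 *m invmx (g d x0) *m (0 : 'M[R]_n)^T))).
    by rewrite mulmx0 !mul0mx mxtrace0.
  apply: cvg_sumr => k _; apply: entries_cvg_mulmx; last exact: entries_cvg_trmx.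
  apply: entries_cvg_mulmx => //; exact: entries_cvg_mulmx.
Qed.

Lemma cov_norm_small (e : R) : 0 < e ->
  \forall x \near x0 & a \near (0 : 'M[R]_(p, q)), cod d x /\
    forall i : 'I_3, cov_norm i (g d) (combination a \o psi d) x <= e.
Proof.
move=> e0; suff : \forall z \near F, cod d z.1 /\
    forall i : 'I_3, cov_norm i (g d) (combination z.2 \o psi d) z.1 <= e by [].
apply: filterI; first exact: near_codF.
apply: (@filter_forall _ _
  (fun i z => cov_norm i (g d) (combination z.2 \o psi d) z.1 <= e) F) => i.
have /cvgr0_norm_le /(_ _ e0) := @cov_norm_cvg0 i.
by apply: filterS => z; apply: le_trans; exact: ler_norm.
Qed.

End local.

(** Near a point the pointwise norms are estimated in one chart around it; by
    chart independence the estimate holds in all charts of the atlas at once. *)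
Lemma C2_norm_small (e : R) : 0 < e ->
  \forall a \near (0 : 'M[R]_(p, q)), (C2_norm g (combination a) < e%:E)%E.
Proof.
move=> e0; have e4 : 0 < e / 4 by rewrite divr_gt0.
have /compact_near_coveringP K := manifold_compact X.
pose P (a : 'M[R]_(p, q)) (y : X) := forall c x (i : 'I_3), atlas X c -> cod c x ->
  psi c x = y -> cov_norm i (g c) (combination a \o psi c) x <= e / 4.
have : \forall a \near (0 : 'M[R]_(p, q)), [set: X] `<=` P a.
  apply: (K _ (nbhs (0 : 'M[R]_(p, q))) P _) => y _.
  have [d dX dy] := atlas_cover X y.
  have [[A B] /= [nA nB] AB] := cov_norm_small dX (phi_cod dy) e4.
  exists ([set y' | dom d y' /\ A (phi d y')], B).
    split=> //=; apply: filterI.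
      by apply: open_nbhs_nbhs; split=> //; exact: open_dom.
    exact: (phi_continuous (mem_set dy)).
  move=> [y' a] /= [[dy' Ay'] Ba] c x i cX cx xy'.
  have Vx : transition_dom c d x by split => //; rewrite xy'.
  rewrite (cov_norm_transition cX dX (combination_smooth a) g i Vx).
  have := (AB (phi d y', a) (conj Ay' Ba)).2 i.
  by rewrite /transition /= xy'.
apply: filterS => a Pa; apply: (@le_lt_trans _ _ (\sum_(i < 3) (e / 4)%:E)%E).
  apply: lee_sum => i _; apply: ge_ereal_sup => _ [[c x] /= [cX cx] <-].
  by rewrite lee_fin; exact: (Pa (psi c x)).
rewrite sumEFin lte_fin sumr_const card_ord -mulr_natl.
lra.
Qed.

End C2_small.

(** * Bump functions and local coordinates *)

Section bump_functions.
Context {R : realType} {m : nat}.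

Definition sq_dist (x0 x : 'rV[R]_m) : R := \sum_i (x 0 i - x0 0 i) ^+ 2.

Lemma Ck_coord_id k i : Ck k (fun x : 'rV[R]_m => x 0 i) setT.
Proof. by apply: Ck_coord; [exact: openT|exact: Ck_id]. Qed.

Lemma CkB k (f g : 'rV[R]_m -> R) U : open U -> Ck k f U -> Ck k g U ->
  Ck k (fun x => f x - g x) U.
Proof.
move=> oU Cf Cg; under eq_fun do rewrite -[- g _]mulN1r.
by apply: CkD => //; exact: CkMl.
Qed.

Lemma Ck_sq_dist k x0 : Ck k (sq_dist x0) setT.
Proof.
apply: Ck_sum => [|i _]; first exact: openT.
have C : Ck k (fun x : 'rV[R]_m => x 0 i - x0 0 i) setT.
  by apply: CkB; [exact: openT|exact: Ck_coord_id|exact: Ck_cst].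
exact: (CkM openT C C).
Qed.

(** Composing the flat function exp(-1/t) with itself makes a plateau appear
    where the inner function exceeds a threshold. *)
Lemma bump_function (x0 : 'rV[R]_m) (rho : R) : 0 < rho ->
  exists b : 'rV[R]_m -> R, [/\ forall k, Ck k b setT,
    forall x, sq_dist x0 x < rho / 2 -> b x = 1 &
    forall x, rho <= sq_dist x0 x -> b x = 0].
Proof.
move=> rho0; have f0 t : 0 < t -> flat 1 t = expR (- t^-1) :> R.
  by move=> t0; rewrite /flat t0 hornerC mul1r.
pose e0 : R := flat 1 (rho / 2); have e00 : 0 < e0.
  by rewrite /e0 f0 ?expR_gt0// divr_gt0.
pose C := flat 1 e0; have C0 : 0 < C by rewrite /C f0 ?expR_gt0.
exists (fun x => C^-1 * (C - flat 1 (e0 - flat 1 (rho - sq_dist x0 x)))); split.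
- move=> k; apply: CkMl; first exact: openT.
  apply: CkB; [exact: openT|exact: Ck_cst|].
  apply: Ck_flat; first exact: openT.
  apply: CkB; [exact: openT|exact: Ck_cst|].
  apply: Ck_flat; first exact: openT.
  by apply: CkB; [exact: openT|exact: Ck_cst|exact: Ck_sq_dist].
- move=> x xr; rewrite [flat 1 (e0 - _)]flat_le0 ?subr0 ?mulVf ?gt_eqF//.
  have h1 : 0 < rho / 2 by rewrite divr_gt0.
  have h2 : rho / 2 <= rho - sq_dist x0 x by lra.
  rewrite subr_le0 /e0 !f0//; last exact: lt_le_trans h2.
  by rewrite ler_expR lerN2 lef_pV2 ?posrE// (lt_le_trans h1).
- move=> x xr; rewrite [flat 1 (rho - _)]flat_le0 ?subr_le0// subr0.
  by rewrite -/C subrr mulr0.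
Qed.

End bump_functions.

Lemma compact_cube (R : realType) n (c : 'rV[R]_n) (r : R) : compact (cube c r).
Proof.
have -> : cube c r = [set v | forall i, `[c 0 i - r, c 0 i + r]%classic (v 0 i)].
  apply/seteqP; split=> v H i; have := H i; rewrite /= in_itv /= ler_distl; by [].
by apply: (@rV_compact _ _ (fun i => `[c 0 i - r, c 0 i + r]%classic)) => i;
  exact: segment_compact.
Qed.

Lemma chart_preimage_open (R : realType) n (X : topologicalType) (c : chart R n X)
  (O : set X) : open O -> open (cod c `&` psi c @^-1` O).
Proof.
move=> oO; rewrite openE => x [cx Ox]; rewrite /interior.
apply: filterI; first by apply: open_nbhs_nbhs; split=> //; exact: open_cod.
apply: (psi_continuous (mem_set cx)); exact: open_nbhs_nbhs.
Qed.

Section coordinate_functions.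
Context {R : realType} {m : nat} (M : closed_manifold R m).
Variables (d : chart R m M) (x0 : 'rV[R]_m) (r : R).
Hypotheses (dM : atlas M d) (r0 : 0 < r) (dr : cube x0 r `<=` cod d).

(** The image of the cube in the manifold is compact, hence closed, so the
    extension vanishes on an open set that together with the domain of the chart
    covers the manifold. *)
Lemma extend_by0_smooth (u : 'rV[R]_m -> R) : (forall k, Ck k u setT) ->
  (forall x, ~ cube x0 r x -> u x = 0) ->
  smooth_function (fun p : M => if `[< dom d p >] then u (phi d p) else 0).
Proof.
move=> su u0 e eM k; set h := fun p : M => _; apply: Ck_local => x ex.
have [dx|ndx] := pselect (dom d (psi e x)).
  exists (transition_dom e d) => //.
  have oV := @transition_dom_open R m M e d.
  have C : Ck k (u \o transition e d) (transition_dom e d).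
    by apply: (Ck_comp oV openT) => //; exact: atlas_smooth.
  apply: Ck_eq oV _ C => y [_ dy].
  by rewrite /h /=; case: asboolP.
have cC : closed (psi d @` cube x0 r).
  apply: compact_closed; first exact: manifold_hausdorff.
  apply: continuous_compact; last exact: compact_cube.
  apply: continuous_in_subspaceT => y /set_mem/dr/mem_set; exact: psi_continuous.
exists (cod e `&` psi e @^-1` (~` (psi d @` cube x0 r))).
  by split=> // -[y xy] E; apply: ndx; rewrite /= -E; exact/psi_dom/dr.
apply: (@Ck_eq _ _ _ _ (fun=> 0)); last exact: Ck_cst.
  by apply: chart_preimage_open; exact: closed_openC.
move=> y [ey ny]; rewrite /h /=; case: asboolP => // dy.
rewrite u0// => cy; apply: ny; exists (phi d (psi e y)) => //.
exact: phiK.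
Qed.

(** These are the directions of perturbation: on [W] they shift gradients by
    constants and leave Hessians alone. *)
Lemma local_coordinates : exists (h : 'I_m -> M -> R) (r' : R) (W : set 'rV[R]_m),
  [/\ forall l, smooth_function (h l), 0 < r' <= r, open W, cube x0 r' `<=` W &
      forall l x, W x -> cod d x -> h l (psi d x) = x 0 l].
Proof.
have rho0 : 0 < r ^+ 2 by rewrite exprn_gt0.
have [b [sb b1 b0]] := bump_function x0 rho0.
pose u l x := b x * x 0 l : R.
(* A cube of radius r' lies in the ball of squared radius r^2 / 2, since
   m * r'^2 < r^2 / 2. *)
pose r' := r / (2 * m.+1%:R); have m1 : (1 : R) <= m.+1%:R by rewrite ler1n.
have m20 : (0 : R) < 2 * m.+1%:R by rewrite mulr_gt0.
exists (fun l p => if `[< dom d p >] then u l (phi d p) else 0), r',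
  [set x | sq_dist x0 x < r ^+ 2 / 2]; split.
- move=> l; apply: extend_by0_smooth => [k|x nx].
    by apply: CkM; [exact: openT|exact: sb|exact: Ck_coord_id].
  rewrite /u b0 ?mul0r//; apply: contrapT => /negP; rewrite -ltNge => xr; apply: nx => i.
  rewrite -(ler_pXn2r (ltn0Sn 1)) ?nnegrE ?(ltW r0)// real_normK ?num_real//.
  apply: le_trans (ltW xr); rewrite /sq_dist (bigD1 i)//= lerDl.
  by apply: sumr_ge0 => j _; exact: sqr_ge0.
- by rewrite /r' divr_gt0//= ler_pdivrMr// ler_peMr ?(ltW r0)//; lra.
- have := @open_lt R (r ^+ 2 / 2) => o; apply: open_comp o => x _.
  exact: (Ck_continuous (@Ck_sq_dist _ _ 0 x0) (mem_set I)).
- move=> x xr /=; apply: le_lt_trans (_ : m%:R * r' ^+ 2 < _).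
    have -> : m%:R * r' ^+ 2 = \sum_(i < m) r' ^+ 2.
      by rewrite sumr_const card_ord mulr_natl.
    apply: ler_sum => i _.
    have r'0 : 0 <= r' by rewrite divr_ge0// ltW.
    by rewrite -real_normK ?num_real// ler_pXn2r ?nnegrE.
  rewrite /r' expr_div_n mulrA ltr_pdivrMr ?exprn_gt0// mulrAC ltr_pdivlMr//.
  rewrite -mulrA mulrC -mulrA ltr_pM2l// exprMn -natr1.
  have : (0 : R) <= m%:R by []. nra.
- move=> l x Wx dx; rewrite /u; case: asboolP => [_|]; last by case; exact: psi_dom.
  by rewrite psiK// b1// mul1r.
Qed.

End coordinate_functions.

Lemma smooth_snd (R : realType) n m (N : closed_manifold R n) (M : closed_manifold R m)
  (h : M -> R) : smooth_function h ->
  smooth_function (fun p : prod_manifold N M => h p.2).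
Proof.
move=> sh _ [c cN [d dM <-]] k.
have := Ck_precomp (@rsubmx_continuous R n m) (@rsubmx_ebase R n m) (sh d dM k).
by apply: Ck_subset => x [].
Qed.

(** * Gradients and Hessians along the fibers *)

Section fibers.
Context {R : realType} {n m : nat}.
Implicit Types (H : 'rV[R]_(n + m) -> R) (s : 'rV[R]_n) (x : 'rV[R]_m).

(** [H] is the expression of a function on N × M in a product of charts, [s] the
    parameter in N. *)
Definition fiber_grad H s x : 'rV[R]_m := grad (fun y => H (row_mx s y)) x.

Definition fiber_hess H s x : 'M[R]_m := hess (fun y => H (row_mx s y)) x.

Definition fiber_degenerate H s x : Prop :=
  fiber_grad H s x = 0 /\ \det (fiber_hess H s x) = 0.

Lemma fiber_derive H s l : 'D_(ebase l) (fun y => H (row_mx s y)) =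
  fun x => 'D_(ebase (rshift n l)) H (row_mx s x).
Proof.
apply/funext => x; rewrite /derive.
apply: (congr1 (fun f : R -> R => lim (f @ 0^'))); apply/funext => h /=.
congr (_ *: (H _ - _)).
have -> : ebase (rshift n l) = row_mx 0 (ebase l) :> 'rV[R]_(n + m).
  apply/rowP => i; rewrite mxE -(splitK i); case: (fintype.split i) => j /=.
    by rewrite row_mxEl mxE eq_lrshift.
  by rewrite row_mxEr mxE (inj_eq (@rshift_inj _ _)).
by rewrite scale_row_mx add_row_mx scaler0 add0r.
Qed.

Let fiber_deriveE H s l x : 'D_(ebase l) (fun y => H (row_mx s y)) x =
  'D_(ebase (rshift n l)) H (row_mx s x).
Proof. exact: (congr1 (fun f => f x) (fiber_derive H s l)). Qed.

Lemma fiber_gradE H s x l :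
  fiber_grad H s x 0 l = 'D_(ebase (rshift n l)) H (row_mx s x).
Proof. by rewrite mxE fiber_deriveE. Qed.

Lemma fiber_hessE H s x i j : fiber_hess H s x i j =
  'D_(ebase (rshift n i)) ('D_(ebase (rshift n j)) H) (row_mx s x).
Proof. by rewrite mxE fiber_derive (fiber_deriveE ('D_(ebase (rshift n j)) H)). Qed.

Lemma cube_row_mx (s0 : 'rV[R]_n) (x0 : 'rV[R]_m) r s x :
  cube s0 r s -> cube x0 r x -> cube (row_mx s0 x0) r (row_mx s x).
Proof.
move=> sr xr i; rewrite -(splitK i); case: (fintype.split i) => j /=.
  by rewrite !row_mxEl.
by rewrite !row_mxEr.
Qed.

Lemma row_mx_norm_le s x (e : R) : `|s| <= e -> `|x| <= e ->
  `|row_mx s x : 'rV[R]_(n + m)| <= e.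
Proof.
move=> se xe; apply: row_norm_le => [|i]; first exact: le_trans se.
rewrite -(splitK i); case: (fintype.split i) => j /=.
  by rewrite row_mxEl (le_trans (coord_norm_le _ _)).
by rewrite row_mxEr (le_trans (coord_norm_le _ _)).
Qed.

End fibers.

Section cube_bounds.
Context {R : realType} {p : nat}.
Variables (c : 'rV[R]_p) (r : R) (U : set 'rV[R]_p).
Hypotheses (oU : open U) (cU : cube c r `<=` U).

Lemma cube_convex y z (t : R) : cube c r y -> cube c r z -> 0 <= t <= 1 ->
  cube c r (y + t *: (z - y)).
Proof.
move=> cy cz /andP[t0 t1] i; rewrite !mxE.
have -> : y 0 i + t * (z 0 i - y 0 i) - c 0 i =
    (1 - t) * (y 0 i - c 0 i) + t * (z 0 i - c 0 i) by ring.
apply: le_trans (ler_normD _ _) _; rewrite !normrM (ger0_norm t0).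
rewrite (ger0_norm (_ : 0 <= 1 - t)) ?subr_ge0//.
have -> : r = (1 - t) * r + t * r by ring.
by apply: lerD; rewrite ler_wpM2l ?subr_ge0.
Qed.

Lemma cube_bounded (I : finType) (f : I -> 'rV[R]_p -> R) :
  (forall i, {in U, continuous (f i)}) ->
  exists2 L, 0 <= L & forall i x, cube c r x -> `|f i x| <= L.
Proof.
move=> cf; have /compact_near_coveringP K := @compact_cube R p c r.
have : \forall L \near +oo%R, cube c r `<=` (fun x => forall i, `|f i x| <= L).
  apply: (K _ (pinfty_nbhs R) (fun L x => forall i, `|f i x| <= L)) => x /cU Ux.
  pose B := \sum_i (`|f i x| + 1).
  exists ([set y | forall i, `|f i y| < `|f i x| + 1], [set L | B < L]).
    split; last by apply: nbhs_pinfty_gt; exact: num_real.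
    apply: (@filter_forall _ _ (fun i y => `|f i y| < `|f i x| + 1) (nbhs x)) => i.
    have /cvgrPdist_lt /(_ _ ltr01) := cf i x (mem_set Ux).
    apply: filterS => y; rewrite distrC => H; rewrite -ltrBlDl.
    by apply: le_lt_trans H; exact: lerB_dist.
  move=> [y L] /= [yx BL] i; apply: ltW; apply: lt_le_trans (yx i) _.
  apply: le_trans (ltW BL); rewrite /B (bigD1 i)//= lerDl.
  by apply: sumr_ge0 => j _; rewrite addr_ge0.
move=> H; have : \forall L \near +oo%R, 0 < L /\ cube c r `<=` (fun x => forall i, `|f i x| <= L).
  by apply: filterI => //; apply: nbhs_pinfty_gt; exact: num_real.
by case/filter_ex => L [L0 HL]; exists L => [|i x /HL]; [exact: ltW|exact].
Qed.

Lemma cube_lipschitz (f : 'rV[R]_p -> R) (L : R) : Ck 1 f U ->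
  (forall i x, cube c r x -> `|'D_(ebase i) f x| <= L) ->
  forall y z, cube c r y -> cube c r z -> `|f z - f y| <= p%:R * (`|z - y| * L).
Proof.
move=> Cf fL y z cy cz.
have [t t01|t t01 ->] := MVT_segment_rV (y := y) (z := z) oU Cf.
  by apply: cU; exact: cube_convex.
by apply: sum_coord_le => i; apply: fL; exact: cube_convex.
Qed.

End cube_bounds.

Section fiber_sard.
Context {R : realType} {n m : nat}.
Variables (H : 'rV[R]_(n + m) -> R) (U : set 'rV[R]_(n + m)).
Variables (s0 : 'rV[R]_n) (x0 : 'rV[R]_m) (r : R).
Hypotheses (oU : open U) (sH : smooth H U) (r0 : 0 < r).
Hypothesis cU : cube (row_mx s0 x0) r `<=` U.

Let psi_ l := 'D_(ebase (rshift n l)) H.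

Let Cpsi l k : Ck k (psi_ l) U. Proof. exact: Ck_derive (sH k.+1). Qed.

(** The hypotheses of [sard_grid] for the gradient along the fibers: on a cube,
    bounds of the second and third derivatives give Lipschitz constants, and the
    mean value theorem gives the expansion. *)
Lemma fiber_sard_grid (eta : R) t : 0 < eta ->
  exists b : 'rV[R]_m, `|b| <= eta /\ exists q, [/\ (0 < q)%N, (t <= q)%N &
    (#|critical_cells (fiber_grad H) (fiber_hess H) s0 x0 r q b| * t <= q ^ n)%N].
Proof.
have C1 (i : 'I_m * 'I_(n + m)) : {in U, continuous ('D_(ebase i.2) (psi_ i.1))}.
  exact: Ck_continuous (Ck_derive i.2 (Cpsi i.1 1)).
have C2 (i : 'I_m * 'I_(n + m) * 'I_(n + m)) :
    {in U, continuous ('D_(ebase i.2) ('D_(ebase i.1.2) (psi_ i.1.1)))}.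
  exact: Ck_continuous (Ck_derive i.2 (Ck_derive i.1.2 (Cpsi i.1.1 2))).
have [L1 L10 HL1] := cube_bounded cU C1.
have [L2 L20 HL2] := cube_bounded cU C2.
have B1 l i z : cube (row_mx s0 x0) r z -> `|'D_(ebase i) (psi_ l) z| <= L1.
  exact: HL1 (l, i) z.
have lip1 l y z : cube (row_mx s0 x0) r y -> cube (row_mx s0 x0) r z ->
    `|psi_ l z - psi_ l y| <= (n + m)%:R * (`|z - y| * L1).
  by apply: (cube_lipschitz oU cU (Cpsi l 1)) => i z' cz'; exact: (HL1 (l, i)).
have lip2 l i y z : cube (row_mx s0 x0) r y -> cube (row_mx s0 x0) r z ->
    `|'D_(ebase i) (psi_ l) z - 'D_(ebase i) (psi_ l) y| <= (n + m)%:R * (`|z - y| * L2).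
  apply: (cube_lipschitz oU cU (Ck_derive i (Cpsi l 2))) => j z' cz'.
  exact: (HL2 (l, i, j)).
pose d : R := (n + m)%:R; have d0 : 0 <= d by [].
pose L := d * L1 + n%:R * L1 + m%:R * (d * (2 * L2)).
have L0 : 0 <= L by rewrite !addr_ge0 ?mulr_ge0.
apply: (@sard_grid R n m _ _ s0 x0 r L r0 L0).
- move=> s s' x x' e ss ss' xx xx' se xe.
  have e0 : 0 <= e by exact: le_trans se.
  apply: row_norm_le => [|l]; first by rewrite mulr_ge0.
  rewrite [X in `|X|]mxE [X in _ + X]mxE !fiber_gradE.
  apply: le_trans (lip1 l _ _ (cube_row_mx ss' xx') (cube_row_mx ss xx)) _.
  rewrite opp_row_mx add_row_mx -/d.
  apply: le_trans (_ : d * (e * L1) <= _).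
    by rewrite ler_wpM2l// ler_wpM2r// row_mx_norm_le.
  have -> : L * e = d * (e * L1) + (n%:R * L1 + m%:R * (d * (2 * L2))) * e.
    by rewrite /L; ring.
  by rewrite lerDl mulr_ge0// addr_ge0// !mulr_ge0.
- move=> s s' s'' x x' x'' e e' ss ss' ss'' xx xx' xx'' e'e se se' xe xe'.
  have e'0 : 0 <= e' by exact: le_trans se.
  have e0 : 0 <= e by exact: le_trans e'e.
  have eL : 0 <= L * (e ^+ 2 + e') by rewrite mulr_ge0// addr_ge0// sqr_ge0.
  apply: row_norm_le => // l.
  have zc := cube_row_mx ss xx; have zc' := cube_row_mx ss' xx'.
  have zc'' := cube_row_mx ss'' xx''.
  have [t' t01|t' t01 E] := MVT_segment_rV (y := row_mx s' x') (z := row_mx s x) oU (Cpsi l 1).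
    by apply: cU; exact: cube_convex.
  have tc := cube_convex zc' zc t01; set w := _ + _ *: _ in E tc.
  have ww : `|w - row_mx s'' x''| <= 2 * e.
    rewrite /w addrAC !opp_row_mx !add_row_mx; apply: le_trans (ler_normD _ _) _.
    rewrite mulr2n mulrDl !mul1r; apply: lerD.
      by apply: row_mx_norm_le => //; exact: le_trans e'e.
    case/andP: t01 => t0 t1; rewrite normrZ (ger0_norm t0).
    apply: le_trans (ler_piMl _ t1) _ => //.
    by apply: row_mx_norm_le => //; exact: le_trans e'e.
  have -> : (fiber_grad H s x - fiber_grad H s' x' - (x - x') *m fiber_hess H s'' x'') 0 l
     = \sum_(i < n) (s - s') 0 i * 'D_(ebase (lshift m i)) (psi_ l) w +
       \sum_(i < m) (x - x') 0 i * ('D_(ebase (rshift n i)) (psi_ l) w -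
          'D_(ebase (rshift n i)) (psi_ l) (row_mx s'' x'')).
    transitivity ((psi_ l (row_mx s x) - psi_ l (row_mx s' x')) -
        \sum_(i < m) (x - x') 0 i * 'D_(ebase (rshift n i)) (psi_ l) (row_mx s'' x'')).
      rewrite [LHS]mxE [X in X + _ = _]mxE [X in _ + X + _ = _]mxE !fiber_gradE.
      congr (_ + _); rewrite mxE; congr (- _); rewrite mxE; apply: eq_bigr => i _.
      by rewrite fiber_hessE.
    rewrite E big_split_ord /= -addrA -sumrB; congr (_ + _); apply: eq_bigr => i _.
      by rewrite opp_row_mx add_row_mx row_mxEl.
    by rewrite opp_row_mx add_row_mx row_mxEr mulrBr.
  apply: le_trans (ler_normD _ _) _.
  have h1 := sum_coord_le (s - s') (fun i => B1 l (lshift m i) w tc).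
  have h2 : `|\sum_(i < m) (x - x') 0 i * ('D_(ebase (rshift n i)) (psi_ l) w -
      'D_(ebase (rshift n i)) (psi_ l) (row_mx s'' x''))| <= m%:R * (`|x - x'| * (d * (2 * e * L2))).
    apply: sum_coord_le => i; apply: le_trans (lip2 l _ _ _ zc'' tc) _.
    by rewrite -/d ler_wpM2l// ler_wpM2r.
  apply: le_trans (lerD h1 h2) _.
  apply: le_trans (_ : n%:R * (e' * L1) + m%:R * (e * (d * (2 * e * L2))) <= _).
    by apply: lerD; rewrite ler_wpM2l// ler_wpM2r// !mulr_ge0.
  have -> : L * (e ^+ 2 + e') = n%:R * (e' * L1) + m%:R * (e * (d * (2 * e * L2))) +
     (d * L1 * (e ^+ 2 + e') + n%:R * L1 * e ^+ 2 + m%:R * (d * (2 * L2)) * e').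
    by rewrite /L; ring.
  by rewrite lerDl !addr_ge0// !mulr_ge0// ?addr_ge0// sqr_ge0.
Qed.

End fiber_sard.

Section degeneracy_is_closed.
Context {R : realType} {n m p q : nat}.
Variables (u0 : 'rV[R]_(n + m) -> R) (u : 'I_p -> 'I_q -> 'rV[R]_(n + m) -> R).
Variable U : set 'rV[R]_(n + m).
Hypotheses (oU : open U) (Cu0 : Ck 2 u0 U) (Cu : forall k l, Ck 2 (u k l) U).

(** The gradient and the determinant of the Hessian depend continuously on the
    parameters and on the point, and do not both vanish. *)
Lemma nondegenerate_near s0 x0 a0 : U (row_mx s0 x0) ->
  ~ fiber_degenerate (family u0 u a0) s0 x0 ->
  \forall z \near (s0, x0) & a \near a0, ~ fiber_degenerate (family u0 u a) z.1 z.2.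
Proof.
move=> Uz nd; pose F := filter_prod (nbhs (row_mx s0 x0)) (nbhs a0).
have FF : Filter F by exact: filter_prod_filter.
pose Z (w : 'rV[R]_(n + m) * 'M[R]_(p, q)) :=
  ~ ((forall l : 'I_m, 'D_(ebase (rshift n l)) (family u0 u w.2) w.1 = 0) /\
     \det (\matrix_(i < m, j < m) 'D_(ebase (rshift n i))
        ('D_(ebase (rshift n j)) (family u0 u w.2)) w.1) = 0).
have ZE s x a : fiber_degenerate (family u0 u a) s x <-> ~ Z (row_mx s x, a).
  rewrite /Z /fiber_degenerate notK.
  have -> : fiber_hess (family u0 u a) s x = \matrix_(i < m, j < m)
      'D_(ebase (rshift n i)) ('D_(ebase (rshift n j)) (family u0 u a)) (row_mx s x).
    by apply/matrixP => i j; rewrite [RHS]mxE; exact: fiber_hessE.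
  split=> -[g0 h0]; split=> //.
    by move=> l; rewrite -fiber_gradE g0 mxE.
  by apply/rowP => l; rewrite fiber_gradE g0 mxE.
have : \forall w \near F, Z w.
  have [[l gl]|ng] := pselect (exists l : 'I_m,
      'D_(ebase (rshift n l)) (family u0 u a0) (row_mx s0 x0) <> 0).
    have c := derive_family_cvg oU Cu0 Cu (a0 := a0) Uz (i := rshift n l).
    have : \forall w \near F, 'D_(ebase (rshift n l)) (family u0 u w.2) w.1 != 0.
      exact: cvgr_neq0 c (introN eqP gl).
    by apply: (@filterS _ F FF _ Z) => w /eqP wl [/(_ l)].
  have dn : \det (\matrix_(i < m, j < m) 'D_(ebase (rshift n i))
        ('D_(ebase (rshift n j)) (family u0 u a0)) (row_mx s0 x0)) != 0.
    apply/eqP => d0; apply: nd; apply/ZE => -[]; split=> // l.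
    by apply: contrapT => gl; apply: ng; exists l.
  have c : @entries_cvg R _ F m m (fun w => \matrix_(i < m, j < m)
      'D_(ebase (rshift n i)) ('D_(ebase (rshift n j)) (family u0 u w.2)) w.1)
      (\matrix_(i < m, j < m) 'D_(ebase (rshift n i))
        ('D_(ebase (rshift n j)) (family u0 u a0)) (row_mx s0 x0)).
    move=> i j; rewrite mxE; under eq_fun do rewrite mxE.
    exact: (derive2_family_cvg oU Cu0 Cu (a0 := a0) Uz (i := rshift n i) (j := rshift n j)).
  have : \forall w \near F, \det (\matrix_(i < m, j < m) 'D_(ebase (rshift n i))
      ('D_(ebase (rshift n j)) (family u0 u w.2)) w.1) != 0.
    by have cd := @entries_cvg_det R _ F FF m _ _ c; exact: (@cvgr_neq0 _ _ _ F FF _ _ cd dn).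
  by apply: (@filterS _ F FF _ Z) => w /eqP wd [_].
move=> [[A B] /= [nA nB] AB].
exists ([set z | A (row_mx z.1 z.2)], B).
  split=> //=; have c : (fun z => row_mx z.1 z.2) @ (s0, x0) --> row_mx s0 x0.
    by apply: (@row_mx_cvg R _ (nbhs (s0, x0)) _ n m fst snd s0 x0);
      [exact: cvg_fst|exact: cvg_snd].
  exact: c nA.
by move=> [[s x] a] /= [Az Ba] /ZE; apply; exact: (AB (row_mx s x, a)).
Qed.

End degeneracy_is_closed.

(** * Finite covers by products of cubes *)

(** The sets of indices that contain a given finite family form a filter base, and
    compactness is uniformity of local properties along filters. *)
Lemma finite_subcover (T : topologicalType) (J : Type) (S : J -> set T) :
  compact [set: T] -> (forall z : T, exists i, nbhs z (S i)) ->
  exists K (P : 'I_K -> J), forall z, exists k, S (P k) z.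
Proof.
move=> /compact_near_coveringP cT zS.
pose F (A : set (set J)) := exists K (P : 'I_K -> J),
  forall D : set J, (forall k, D (P k)) -> A D.
have FF : Filter F.
  split; first by exists 0%N, (fun k : 'I_0 => match notF (ltn_ord k) with end).
  - move=> A B [K1 [P1 A1]] [K2 [P2 B2]].
    exists (K1 + K2)%N,
      (fun i => match fintype.split i with inl j => P1 j | inr j => P2 j end).
    move=> D DP; split; [apply: A1 => k; have := DP (unsplit (inl k))
                        |apply: B2 => k; have := DP (unsplit (inr k))];
      by rewrite unsplitK.
  - by move=> A B AB [K [P KP]]; exists K, P => D /KP/AB.
have [|K [P KP]] := cT _ F (fun D z => exists2 i, D i & S i z) FF.
  move=> z _; have [i zi] := zS z.
  exists (S i, [set D | D i]); last by move=> [y D] /= [Sy Di]; exists i.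
  by split=> //=; exists 1%N, (fun=> i) => D /(_ ord0).
exists K, P => z; have [|i [k _ <-] Sz] := KP (range P) _ z I; last by exists k.
by move=> k; exists k.
Qed.

Section patches.
Context {R : realType} {n m : nat} (N : closed_manifold R n) (M : closed_manifold R m).

(** A product of two cubes of charts, with functions on [M] that are the
    coordinates near the second cube: the unit in which critical points are
    made nondegenerate. *)
Record patch := Patch {
  pN : chart R n N;
  pM : chart R m M;
  ps : 'rV[R]_n;
  px : 'rV[R]_m;
  pr : R;
  pW : set 'rV[R]_m;
  ph : 'I_m -> M -> R;
  pN_atlas : atlas N pN;
  pM_atlas : atlas M pM;
  pr_gt0 : 0 < pr;
  ps_cod : cube ps pr `<=` cod pN;
  px_cod : cube px pr `<=` cod pM;
  pW_open : open pW;
  pW_cube : cube px pr `<=` pW;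
  ph_smooth : forall l, smooth_function (ph l);
  ph_coord : forall l x, pW x -> cod pM x -> ph l (psi pM x) = x 0 l }.

Definition patch_set (P : patch) : set (N * M) :=
  [set z | [/\ dom (pN P) z.1, dom (pM P) z.2, cube (ps P) (pr P) (phi (pN P) z.1)
             & cube (px P) (pr P) (phi (pM P) z.2)]].

Let cube_nbhs p (x : 'rV[R]_p) (A : set 'rV[R]_p) : nbhs x A ->
  exists2 r : R, 0 < r & cube x r `<=` A.
Proof.
move=> /nbhs_ballP[r /= r0 rA]; exists (r / 2); first by rewrite divr_gt0.
move=> y yr; apply: rA; rewrite -ball_normE /ball_ /=.
apply: (@le_lt_trans _ _ (r / 2)); last by rewrite ltr_pdivrMr// ltr_pMr// ltr1n.
apply: row_norm_le => [|i]; first by rewrite divr_ge0// ltW.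
by rewrite !mxE distrC.
Qed.

Let nbhs_cube p (x : 'rV[R]_p) (r : R) : 0 < r -> nbhs x (cube x r).
Proof.
move=> r0; apply/nbhs_ballP; exists r => //= y.
rewrite -ball_normE /ball_ /= => xy i; apply: ltW; apply: le_lt_trans xy.
by have := coord_norm_le (x - y) i; rewrite !mxE distrC.
Qed.

Let cube_sub p (x : 'rV[R]_p) (r r' : R) : r <= r' -> cube x r `<=` cube x r'.
Proof. by move=> rr y yr i; exact: le_trans (yr i) rr. Qed.

Lemma patch_at (z : N * M) : exists P : patch, nbhs z (patch_set P).
Proof.
have [c cN cz] := atlas_cover N z.1; have [d dM dz] := atlas_cover M z.2.
have cc : nbhs (phi c z.1) (cod c).
  by apply: open_nbhs_nbhs; split; [exact: open_cod|exact: phi_cod].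
have dd : nbhs (phi d z.2) (cod d).
  by apply: open_nbhs_nbhs; split; [exact: open_cod|exact: phi_cod].
have [r1 r10 h1] := cube_nbhs cc; have [r2 r20 h2] := cube_nbhs dd.
have [h [r3 [W [sh /andP[r30 r32] oW WW hW]]]] := local_coordinates dM r20 h2.
pose r := Num.min r1 r3; have r0 : 0 < r by rewrite lt_min r10.
have rr1 : r <= r1 by rewrite ge_min lexx.
have rr3 : r <= r3 by rewrite ge_min lexx orbT.
have k1 := subset_trans (cube_sub (x := phi c z.1) rr1) h1.
have k2 := subset_trans (cube_sub (x := phi d z.2) (le_trans rr3 r32)) h2.
have k3 := subset_trans (cube_sub (x := phi d z.2) rr3) WW.
exists (Patch cN dM r0 k1 k2 oW k3 sh hW).
exists ([set s | dom c s /\ cube (phi c z.1) r (phi c s)],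
        [set x | dom d x /\ cube (phi d z.2) r (phi d x)]); last first.
  by move=> [s x] /= [[? ?] [? ?]].
split=> /=; apply: filterI.
- by apply: open_nbhs_nbhs; split=> //; exact: open_dom.
- exact: (phi_continuous (mem_set cz)) (nbhs_cube _ r0).
- by apply: open_nbhs_nbhs; split=> //; exact: open_dom.
- exact: (phi_continuous (mem_set dz)) (nbhs_cube _ r0).
Qed.

Lemma finite_patches : exists K (P : 'I_K -> patch), forall z, exists k, patch_set (P k) z.
Proof.
exact: finite_subcover (manifold_compact (prod_manifold N M)) patch_at.
Qed.

End patches.

(** * Bad parameters of a perturbed function *)

Section linear_perturbation.
Context {R : realType} {m : nat}.

Let hessE (h : 'rV[R]_m -> R) x i j :
  hess h x i j = 'D_(ebase i) ('D_(ebase j) h) x.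
Proof. by rewrite mxE. Qed.

Variables (f g : 'rV[R]_m -> R) (b : 'rV[R]_m) (V : set 'rV[R]_m).
Hypotheses (oV : open V) (Cf : Ck 2 f V).
Hypothesis gE : forall x, V x -> g x = f x - \sum_j b 0 j * x 0 j.

Let derive_g x l : V x -> 'D_(ebase l) g x = 'D_(ebase l) f x - b 0 l.
Proof.
move=> Vx.
have E : \forall y \near x, g y = (f - (fun y => \sum_j b 0 j * y 0 j)) y.
  by apply: (@filterS _ (nbhs x) _ V) gE _; exact: open_nbhs_nbhs.
have dc j : derivable (fun y : 'rV[R]_m => y 0 j) x (ebase l).
  by apply: Ck_derivable (@Ck_coord_id R m 1 j) I.
have dm j : derivable (fun y : 'rV[R]_m => b 0 j * y 0 j) x (ebase l).
  exact: derivable_mull.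
rewrite (near_eq_derive _ E) deriveB; [|exact: Ck_derivable Cf Vx|exact: derivable_sumr].
congr (_ - _); rewrite derive_sumr// (bigD1 l)//= big1 => [|j jl].
  by rewrite derive_mull// derive_coord eqxx mulr1 addr0.
by rewrite derive_mull// derive_coord (negPf jl) mulr0.
Qed.

Lemma grad_linear_perturbation x : V x -> grad g x = grad f x - b.
Proof. by move=> Vx; apply/rowP => l; rewrite !mxE derive_g. Qed.

Lemma hess_linear_perturbation x : V x -> hess g x = hess f x.
Proof.
move=> Vx; apply/matrixP => i j; refine (etrans (hessE g x i j) (etrans _ (esym (hessE f x i j)))).
have E : \forall y \near x, 'D_(ebase j) g y = ('D_(ebase j) f - cst (b 0 j)) y.
  apply: (@filterS _ (nbhs x) _ V) (fun y => @derive_g y j) _.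
  exact: open_nbhs_nbhs.
rewrite (near_eq_derive _ E) deriveB; [|exact: Ck_derivable (Ck_derive j Cf) Vx|].
  by rewrite derive_cst subr0.
exact: derivable_cst.
Qed.

End linear_perturbation.

Lemma compact_cell (R : realType) n (c : 'rV[R]_n) r q k : compact (@cell R n c r q k).
Proof.
pose I i := `[c 0 i - r + 2 * r * (k i)%:R / q%:R,
              c 0 i - r + 2 * r * (k i).+1%:R / q%:R]%classic.
have -> : cell c r k = [set v | forall i, I i (v 0 i)].
  by apply/seteqP; split=> v H i; have := H i; rewrite /I /= in_itv.
by apply: (@rV_compact _ _ I) => i; exact: segment_compact.
Qed.

(** Smallness on a grid is the condition that certain cells, which are compact,
    be missed. *)
Lemma grid_small_open (R : realType) n (A : topologicalType) (c : 'rV[R]_n) (r : R) t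
    (B : A -> set 'rV[R]_n) : 0 <= r ->
  (forall a (S : set 'rV[R]_n), compact S -> S `<=` cube c r ->
     (forall s, S s -> ~ B a s) -> \forall a' \near a, forall s, S s -> ~ B a' s) ->
  open [set a | grid_small c r t (B a)].
Proof.
move=> r0 HB; rewrite openE => a [q [q0 tq Hq]]; rewrite /interior.
have : \forall a' \near a, forall k : {ffun 'I_n -> 'I_q},
    k \notin hit_cells c r q (B a) -> k \notin hit_cells c r q (B a').
  apply: (@filter_forall _ _ (fun k a' => k \notin hit_cells c r q (B a) ->
    k \notin hit_cells c r q (B a')) (nbhs a)) => k.
  have [hit|/negP nk] := pselect (k \in hit_cells c r q (B a)).
    by apply: nearW => a' /negP[].
  have := HB a (cell c r k) (@compact_cell _ _ _ _ _ _) (cell_cube (k := k) r0).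
  have nB s : cell c r k s -> ~ B a s.
    by move=> ks Bs; move: nk; rewrite inE => /asboolP; apply; exists s.
  move=> /(_ nB); apply: filterS => a' H _; rewrite inE; apply/asboolP => -[s ks].
  exact: H.
apply: filterS => a' H; exists q; split=> //.
apply: leq_trans Hq; rewrite leq_mul2r subset_leq_card ?orbT//.
by apply/fintype.subsetP => k; apply: contraLR; exact: H.
Qed.

Section perturbed_functions.
Context {R : realType} {n m : nat} (N : closed_manifold R n) (M : closed_manifold R m).
Variables (F : Cinfty (prod_manifold N M)) (K : nat) (P : 'I_K -> patch N M).

Definition perturbation : 'M[R]_(K, m) -> prod_manifold N M -> R :=
  @combination R (n + m) K m (prod_manifold N M) (fun k l p => ph (P k) l p.2).

Definition perturbed (a : 'M[R]_(K, m)) (p : prod_manifold N M) : R :=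
  F p + perturbation a p.

Lemma ph_snd_smooth k l :
  smooth_function (fun p : prod_manifold N M => ph (P k) l p.2).
Proof. by apply: smooth_snd; exact: ph_smooth. Qed.

Lemma perturbed_smooth a : smooth_function (perturbed a).
Proof.
move=> c cX k; apply: CkD; first exact: open_cod.
  exact: (cinfty_smooth F cX).
exact: (combination_smooth ph_snd_smooth a cX).
Qed.

Section one_patch.
Variable k : 'I_K.

Let c := pN (P k).
Let d := pM (P k).
Let s0 := ps (P k).
Let x0 := px (P k).
Let r := pr (P k).
Let e := prod_chart c d.

Let eX : atlas (prod_manifold N M) e.
Proof. by exists c; [exact: pN_atlas|exists d; [exact: pM_atlas|]]. Qed.

Let u0 := F \o psi e.
Let u j l := (fun p : prod_manifold N M => ph (P j) l p.2) \o psi e.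
Let Ha := family u0 u.

Let su0 : smooth u0 (cod e). Proof. exact: cinfty_smooth. Qed.
Let su j l : smooth (u j l) (cod e). Proof. exact: ph_snd_smooth. Qed.
Let oe : open (cod e). Proof. exact: open_cod. Qed.

Let HaE a : Ha a = perturbed a \o psi e. Proof. by []. Qed.

Let sHa a : smooth (Ha a) (cod e).
Proof. by rewrite HaE; exact: perturbed_smooth. Qed.

Let cod_row_mx s x : cube s0 r s -> cube x0 r x -> cod e (row_mx s x).
Proof. by move=> ss xx; split; rewrite ?row_mxKl ?row_mxKr; [exact: ps_cod|exact: px_cod]. Qed.

Definition degenerate_at a (s : 'rV[R]_n) (x : 'rV[R]_m) : Prop :=
  fiber_degenerate (perturbed a \o psi e) s x.

Definition bad a : set 'rV[R]_n :=
  [set s | cube s0 r s /\ exists2 x, cube x0 r x & degenerate_at a s x].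

Let nondeg_near s x a : cube s0 r s -> cube x0 r x -> ~ degenerate_at a s x ->
  \forall z \near (s, x) & a' \near a, ~ degenerate_at a' z.1 z.2.
Proof.
move=> ss xx; apply: (nondegenerate_near oe (su0 2) (fun j l => su j l 2)).
exact: cod_row_mx.
Qed.

Let nondeg_near_compact (S : set 'rV[R]_n) a : compact S -> S `<=` cube s0 r ->
  (forall s x, S s -> cube x0 r x -> ~ degenerate_at a s x) ->
  \forall a' \near a, forall s x, S s -> cube x0 r x -> ~ degenerate_at a' s x.
Proof.
move=> cS Sc nd.
have /compact_near_coveringP C := compact_setX cS (@compact_cube R m x0 r).
have : \forall a' \near a, S `*` cube x0 r `<=` (fun z => ~ degenerate_at a' z.1 z.2).
  apply: (C _ (nbhs a) (fun a' z => ~ degenerate_at a' z.1 z.2)) => -[s x] /= [Ss xx].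
  exact: nondeg_near (Sc _ Ss) xx (nd _ _ Ss xx).
by apply: filterS => a' H s x Ss xx; exact: (H (s, x)).
Qed.

(** By compactness of the second cube, parameters near a good one are good. *)
Lemma bad_compact a : compact (bad a).
Proof.
apply: (@subclosed_compact _ _ (cube s0 r)); last 2 first.
- exact: compact_cube.
- by move=> s [].
rewrite -openC openE => s ns; rewrite /interior.
have [ss|nss] := pselect (cube s0 r s); last first.
  apply: (@filterS _ (nbhs s) _ (~` cube s0 r)) => [s' ? []//|].
  apply: open_nbhs_nbhs; split=> //; apply: closed_openC.
  by apply: compact_closed; [exact: norm_hausdorff|exact: compact_cube].
have /compact_near_coveringP C := @compact_cube R m x0 r.
have nd x : cube x0 r x -> ~ degenerate_at a s x.
  by move=> xx dx; apply: ns; split=> //; exists x.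
have : \forall s' \near s, cube x0 r `<=` (fun x => ~ degenerate_at a s' x).
  apply: (C _ (nbhs s) (fun s' x => ~ degenerate_at a s' x)) => x xx.
  have [[A B] /= [[[A1 A2] /= [nA1 nA2] A12] nB] AB] := nondeg_near ss xx (nd _ xx).
  exists (A2, A1); first by split.
  move=> [x' s'] /= [Ax' As']; apply: (AB ((s', x'), a)); split => /=.
    exact: (A12 (s', x')).
  exact: nbhs_singleton nB.
by apply: filterS => s' H [ss' [x xx dx]]; exact: (H x xx).
Qed.

Lemma grid_small_bad_open t : open [set a | grid_small s0 r t (bad a)].
Proof.
have r0 : 0 <= r by apply: ltW; exact: pr_gt0.
apply: grid_small_open => // a S cS Sc nS.
have nd s x : S s -> cube x0 r x -> ~ degenerate_at a s x.
  by move=> Ss xx dx; apply: (nS s Ss); split; [exact: Sc|exists x].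
apply: filterS (nondeg_near_compact cS Sc nd) => a' H s Ss [_ [x xx dx]].
exact: H Ss xx dx.
Qed.

(** A small change of the [k]-th row of the parameter is a linear perturbation in
    the chart, and [fiber_sard_grid] provides a suitable one. *)
Lemma grid_small_dense t : dense [set a | grid_small s0 r t (bad a)].
Proof.
move=> O [a Oa] oO; have /nbhs_ballP[eta /= eta0 aO] : nbhs a O by exact: open_nbhs_nbhs.
have r0 : 0 < r by exact: pr_gt0.
have cU : cube (row_mx s0 x0) r `<=` cod e.
  move=> z zc; rewrite -(hsubmxK z); apply: cod_row_mx => i.
    by have := zc (lshift m i); rewrite row_mxEl mxE.
  by have := zc (rshift n i); rewrite row_mxEr mxE.
have e2 : 0 < eta / 2 by rewrite divr_gt0.
have [b [be [q [q0 tq Hq]]]] := fiber_sard_grid oe (sHa a) r0 cU t e2.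
pose a' : 'M[R]_(K, m) := \matrix_(i, j) (a i j - (i == k)%:R * b 0 j).
exists a'; split.
  apply: aO; rewrite -ball_normE /ball_ /=.
  apply: (@le_lt_trans _ _ (eta / 2)); last by rewrite ltr_pdivrMr// ltr_pMr// ltr1n.
  rewrite [leLHS]/Num.Def.normr/= mx_normrE (bigmax_le _ (ltW e2))//= => -[i j] _ /=.
  rewrite !mxE opprB addrC addrNK; case: eqP => _; last by rewrite mul0r normr0 ltW.
  by rewrite mul1r; exact: le_trans (coord_norm_le b j) be.
exists q; split=> //; apply: leq_trans Hq; rewrite leq_mul2r subset_leq_card ?orbT//.
apply/fintype.subsetP => sg; rewrite inE => /asboolP[s ss [_ [x xx [gx hx]]]].
rewrite inE; apply/asboolP; exists s; first exact: ss.
exists x; first exact: xx.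
pose V := pW (P k) `&` cod d.
have oV : open V by apply: openI; [exact: pW_open|exact: open_cod].
have Vx : V x by split; [exact: pW_cube|exact: px_cod].
have sc : cod c s by apply: ps_cod; exact: cell_cube (ltW r0) _ ss.
have Cf : Ck 2 (fun y => Ha a (row_mx s y)) V.
  apply: (@Ck_comp _ _ _ _ V (cod e) oV oe _ 2 (Ha a)).
  - by move=> y [_ dy]; split; rewrite ?row_mxKl ?row_mxKr.
  - by apply: Ck_row_mx => //; [exact: Ck_cst|exact: Ck_id].
  - exact: sHa.
have gE y : V y -> Ha a' (row_mx s y) = Ha a (row_mx s y) - \sum_j b 0 j * y 0 j.
  move=> [Wy dy]; rewrite /Ha /family -addrA; congr (_ + _).
  have -> : \sum_j b 0 j * y 0 j =
      \sum_i \sum_j (i == k)%:R * b 0 j * u i j (row_mx s y).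
    rewrite (bigD1 k)//= [X in _ + X]big1 => [|i ik].
      rewrite addr0; apply: eq_bigr => j _; rewrite eqxx mul1r; congr (_ * _).
      by rewrite /u /= row_mxKr ph_coord.
    by rewrite big1// => j _; rewrite (negPf ik) !mul0r.
  rewrite -sumrB; apply: eq_bigr => i _; rewrite -sumrB; apply: eq_bigr => j _.
  by rewrite mxE mulrBl.
split.
  have := grad_linear_perturbation oV Cf gE Vx; rewrite /fiber_grad => E.
  by apply/esym/subr0_eq/oppr_inj; rewrite oppr0 opprB -E; exact: gx.
by have := hess_linear_perturbation oV Cf gE Vx; rewrite /fiber_hess => <-.
Qed.

End one_patch.
End perturbed_functions.

(** * Generic perturbations *)

Lemma dense_finite_inter (T : topologicalType) (K : nat) (O : 'I_K -> set T) :
  (forall k, open (O k) /\ dense (O k)) -> dense [set s | forall k, O k s].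
Proof.
move=> HO; suff H (ks : seq 'I_K) : dense [set s | forall k, k \in ks -> O k s].
  move=> A A0 oA; have [s [As Os]] := H (enum 'I_K) A A0 oA.
  by exists s; split=> // k; apply: Os; rewrite mem_enum.
elim: ks => [|k ks IH] A A0 oA.
  by have [s As] := A0; exists s; split.
have [ok dk] := HO k; have [s [As Oks]] := dk A A0 oA.
have [||s' [[As' Oks'] H]] := IH (A `&` O k).
- by exists s.
- exact: openI.
exists s'; split=> // j; rewrite inE => /orP[/eqP->//|]; exact: H.
Qed.

Lemma open_finite_inter (T : topologicalType) (K : nat) (O : 'I_K -> set T) :
  (forall k, open (O k)) -> open [set s | forall k, O k s].
Proof.
move=> oO; rewrite openE => s Os; rewrite /interior.
apply: (@filter_forall _ _ (fun k s => O k s) (nbhs s)) => k.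
by apply: open_nbhs_nbhs; split.
Qed.

Section bad_parameters.
Context {R : realType} {n m : nat} (N : closed_manifold R n) (M : closed_manifold R m).
Variables (F : Cinfty (prod_manifold N M)) (K : nat) (P : 'I_K -> patch N M).
Variable a : 'M[R]_(K, m).
Hypothesis cover : forall z, exists k, patch_set (P k) z.
Hypothesis small : forall k, grid_null (ps (P k)) (pr (P k)) (bad F P k a).

Definition bad_set k : set N := psi (pN (P k)) @` bad F P k a.

Lemma bad_set_closed k : closed (bad_set k).
Proof.
apply: compact_closed; first exact: manifold_hausdorff.
apply: continuous_compact; last exact: bad_compact.
apply: continuous_in_subspaceT => s /set_mem[sc _].
exact/psi_continuous/mem_set/ps_cod.
Qed.

(** In the chart of the patch this is [grid_null_dense_compl]; points outside the
    bad set are their own approximation. *)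
Lemma bad_set_dense_compl k : dense (~` bad_set k).
Proof.
move=> O [s Os] oO; have [[s' bs' ss']|] := pselect (bad_set k s); last by exists s.
have s'c := bs'.1; have cs' := ps_cod s'c.
have : nbhs s' (psi (pN (P k)) @^-1` O).
  by apply: (psi_continuous (mem_set cs')); rewrite ss'; exact: open_nbhs_nbhs.
move=> /nbhs_ballP[rho /= rho0 HO].
have rho2 : 0 < rho / 2 by rewrite divr_gt0.
have half : rho / 2 < rho by rewrite ltr_pdivrMr// ltr_pMr// ltr1n.
have [y [yc ys ny]] := grid_null_dense_compl (pr_gt0 (P k)) (@small k) s'c rho2.
exists (psi (pN (P k)) y); split.
  apply: HO; rewrite -ball_normE /ball_ /= distrC; exact: le_lt_trans ys half.
move=> [w bw wy]; apply: ny.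
have <- : w = y by rewrite -(psiK (ps_cod bw.1)) -[RHS](psiK (ps_cod yc)) wy.
exact: bw.
Qed.

Definition good_set : set N := [set s | forall k, (~` bad_set k) s].

Lemma good_set_open : open good_set.
Proof. by apply: open_finite_inter => k; apply: closed_openC; exact: bad_set_closed. Qed.

Lemma good_set_dense : dense good_set.
Proof.
apply: dense_finite_inter => k; split; last exact: bad_set_dense_compl.
by apply: closed_openC; exact: bad_set_closed.
Qed.

Lemma good_set_compl_null : measure_zero (~` good_set).
Proof.
have [s _] := manifold_nonempty N; have [c0 c0N _] := atlas_cover N s.
pose c (i : nat) := if insub i is Some k then pN (P k) else c0.
pose Z (i : nat) := if insub i is Some k then bad F P k a else set0.
apply: (@measure_zero_cover _ _ _ _ c Z) => [i|s' ngs].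
  rewrite /c /Z; case: insubP => [k _ _|_]; split=> //.
  - exact: pN_atlas.
  - by move=> x [xc _]; exact: ps_cod.
  - by apply: (@grid_null_lebesgue _ _ (ps (P k)) (pr (P k))) => //;
      [exact: pr_gt0|move=> x []].
have [k bk] : exists k, bad_set k s'.
  by apply: contrapT => nb; apply: ngs => k bk; apply: nb; exists k.
by exists (val k) => //; rewrite /c /Z valK.
Qed.

Let fiber_smooth s : smooth_function (fun x : M => perturbed F P a (s, x)).
Proof.
move=> d dM k; have [c cN cs] := atlas_cover N s.
have eX : atlas (prod_manifold N M) (prod_chart c d) by exists c => //; exists d.
have -> : (fun x : M => perturbed F P a (s, x)) \o psi d =
    (perturbed F P a \o psi (prod_chart c d)) \o (fun x => row_mx (phi c s) x).
  by apply/funext => x; rewrite /= /prod_psi row_mxKl row_mxKr phiK.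
apply: (@Ck_comp _ _ _ _ (cod d) (cod (prod_chart c d)) (open_cod d) (open_cod _)).
- move=> x dx; split; rewrite ?row_mxKl ?row_mxKr//; exact: phi_cod.
- by apply: Ck_row_mx; [exact: open_cod|exact: Ck_cst|exact: Ck_id].
- exact: (perturbed_smooth F P a eX).
Qed.

(** A critical point lies in some patch; there its Hessian is nondegenerate in
    the chart of the patch, and then in every chart. *)
Lemma good_set_morse s : good_set s -> morse (fun x : M => perturbed F P a (s, x)).
Proof.
move=> gs; split=> [|x cx c cM cx'] ; first exact: fiber_smooth.
have [k [/= ds dx sc xc]] := cover (s, x).
set d := pM (P k) in dx xc.
have dM : atlas M d by exact: pM_atlas.
have g0 : grad ((fun x => perturbed F P a (s, x)) \o psi d) (phi d x) = 0.
  exact: cx.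
have fE : (fun y => (perturbed F P a \o psi (prod_chart (pN (P k)) d))
    (row_mx (phi (pN (P k)) s) y)) = (fun x => perturbed F P a (s, x)) \o psi d.
  by apply/funext => y; rewrite /= /prod_psi row_mxKl row_mxKr phiK.
have hu : hess ((fun x => perturbed F P a (s, x)) \o psi d) (phi d x) \in unitmx.
  rewrite unitmxE unitfE; apply/eqP => h0; apply: (gs k).
  exists (phi (pN (P k)) s); last by rewrite phiK.
  split; first exact: sc.
  exists (phi d x); first exact: xc.
  by split; rewrite /fiber_grad /fiber_hess fE.
have Vx : transition_dom c d (phi c x).
  by split; [exact: phi_cod|rewrite phiK].
have TE : transition c d (phi c x) = phi d x by rewrite /transition /= phiK.
by apply: (nondegenerate_transition cM dM (fiber_smooth s) Vx); rewrite TE.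
Qed.

End bad_parameters.

(* This makes matrices a complete normed module, as Baire's theorem requires. *)
HB.instance Definition _ (R : realType) (p q : nat) :=
  Uniform_isComplete.Build 'M[R]_(p, q) (@mx_complete R p q).

Theorem theorem3p1 (R : realType) (n m : nat)
    (N : closed_manifold R n) (M : closed_manifold R m)
    (g : riemannian_metric (prod_manifold N M))
    (F : Cinfty (prod_manifold N M)) (U : set (Cinfty (prod_manifold N M))) :
  C2_open g U -> U F ->
  exists (F' : Cinfty (prod_manifold N M)) (N0 : set N),
    [/\ U F', open N0, dense N0, measure_zero (~` N0) &
        forall s : N, N0 s -> morse (fun x : M => F' (s, x))].
Proof.
move=> oU UF; have [e e0 Ue] := oU F UF.
have [K [P cover]] := finite_patches N M.
pose small := [set a : 'M[R]_(K, m) | (C2_norm g (perturbation P a) < e%:E)%E].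
have nsmall : nbhs (0 : 'M[R]_(K, m)) small.
  exact: (C2_norm_small g (ph_snd_smooth P) e0).
pose O (k : 'I_K) t := [set a : 'M[R]_(K, m) |
  grid_small (ps (P k)) (pr (P k)) t (bad F P k a)].
(* One open dense set for each pair of a patch and a proportion 1/t. *)
pose A i := if unpickle i is Some (k, t) then O k t else setT.
have dA : dense (\bigcap_i A i).
  apply: Baire => i; rewrite /A; case: unpickle => [[k t]|].
    by split; [exact: grid_small_bad_open|exact: grid_small_dense].
  by split; [exact: openT|move=> B B0 _; rewrite setIT].
have [||a [/interior_subset sa Aa]] := dA small°.
- by exists 0; exact: nsmall.
- exact: open_interior.
have null k : grid_null (ps (P k)) (pr (P k)) (bad F P k a).
  by move=> t; have := Aa (pickle (k, t)) I; rewrite /A pickleK.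
exists (MkCinfty (perturbed_smooth F P a)), (good_set F P a); split.
- apply: Ue; rewrite (_ : (fun p => _) = perturbation P a)//.
  by apply/funext => p; rewrite /= /perturbed addrC addKr.
- exact: good_set_open.
- exact: good_set_dense.
- exact: good_set_compl_null.
- by move=> s; exact: good_set_morse.
Qed.
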